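(* For every $p$, $q$ and $s>0$ satisfying $2\le p,q<\infty$ and $$s>\max\Big\{1-\frac1q,\ \frac32-\frac1q-\frac2p\Big\},$$ there is a constant $C>0$ such that $$\|S(t)f\|_{L_x^pL_t^q(I)}\le C\|f\|_{H_x^s}$$ for every $f\in H_x^s(B_2\times\mathbb{T})$ and every interval $I\subset\mathbb{R}$ with $|I|\le1$.
   Context: $B_2=\{x'\in\mathbb{R}^2:|x'|<1\}$, $\mathbb{T}=\mathbb{R}/\mathbb{Z}$, $x=(x_1,x_2,x_3)\in B_2\times\mathbb{T}$. $(e_n)_{n\ge1}$ is the sequence of real, $L^2(B_2)$-normalized radial eigenfunctions of $-\Delta$ on $B_2$ with vanishing Dirichlet boundary conditions, with eigenvalues $\lambda_n^2$, $0<\lambda_1<\lambda_2<\cdots$. Put $z_{n,n'}=\sqrt{\lambda_n^2+(2\pi n')^2}$ for $n\ge1$, $n'\in\mathbb{Z}$, and $\langle x\rangle=(1+|x|^2)^{1/2}$. For $s\in\mathbb{R}$, $H_x^s=H_x^s(B_2\times\mathbb{T})$ is the space of $f=\sum_{n\ge1,n'\in\mathbb{Z}}a_{n,n'}e_n(x_1,x_2)e^{2\pi i n'x_3}$ with $\|f\|_{H_x^s}=\big(\sum_{n,n'}\langle z_{n,n'}\rangle^{2s}|a_{n,n'}|^2\big)^{1/2}<\infty$ (in particular functions radial in $(x_1,x_2)$). For such $f$, $$S(t)f=\sum_{n,n'}a_{n,n'}e_n(x_1,x_2)e^{i(2\pi n'x_3-z_{n,n'}t)}.$$ $\|u\|_{L_x^pL_t^q(I)}=\big\|\,\|u(t,x)\|_{L_t^q(I)}\big\|_{L_x^p(B_2\times\mathbb{T})}$.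 *)

(* Defs.v *)
From HB Require Import structures.
From mathcomp Require Import all_boot all_order all_algebra finmap.
From mathcomp Require Import all_classical all_reals all_analysis.
From mathcomp.real_closed Require Import complex.

Set Implicit Arguments.
Unset Strict Implicit.
Unset Printing Implicit Defensive.

Import Order.TTheory GRing.Theory Num.Theory.
Import numFieldNormedType.Exports.

Local Open Scope classical_set_scope.
Local Open Scope ring_scope.

Section Definitions.
Context {R : realType}.

(* The norm that the library puts on R * R is the max norm, whence the explicit
   Euclidean norm. *)
Definition enorm (x : R * R) : R := Num.sqrt (x.1 ^+ 2 + x.2 ^+ 2).

Definition disk : set (R * R) := [set x | enorm x < 1].

Definition closed_disk : set (R * R) := [set x | enorm x <= 1].

(* B_2 x T; functions on T = R/Z are represented on the fundamental domain
   [0, 1[, on which Lebesgue measure is the Haar measure of T. *)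
Definition cylinder : set (R * R * R) := disk `*` `[0, 1[.

Local Notation mu1 := (@lebesgue_measure R).
Local Notation mu2 := (mu1 \x mu1)%E.
Local Notation mu3 := (mu2 \x mu1)%E.

Definition laplacian (g : R * R -> R) (x : R * R) : R :=
  'D_(1, 0) ('D_(1, 0) g) x + 'D_(0, 1) ('D_(0, 1) g) x.

Definition C2_on (A : set (R * R)) (g : R * R -> R) : Prop :=
  forall x, A x -> forall v w : R * R,
    [/\ derivable g x v, derivable ('D_v g) x w &
        {for x, continuous ('D_w ('D_v g))}].

Definition radial (g : R * R -> R) : Prop :=
  forall x y, closed_disk x -> enorm x = enorm y -> g x = g y.

Definition radial_dirichlet_eigenfunction (m : R) (g : R * R -> R) : Prop :=
  [/\ radial g,
      C2_on disk g /\ {within closed_disk, continuous g},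
      forall x, enorm x = 1 -> g x = 0,
      forall x, disk x -> - laplacian g x = m * g x &
      exists2 x, disk x & g x != 0].

(* Index n : nat stands for n + 1 in the usual numbering (e_n)_{n >= 1}.  The
   last clause says that no eigenvalue is left out. *)
Definition radial_dirichlet_sequence
    (lam : nat -> R) (e : nat -> R * R -> R) : Prop :=
  [/\ forall n, 0 < lam n,
      forall n, lam n < lam n.+1,
      forall n, radial_dirichlet_eigenfunction (lam n ^+ 2) (e n),
      forall n, (\int[mu2]_(x in disk) ((e n x ^+ 2)%:E) = 1)%E &
      forall m g, radial_dirichlet_eigenfunction m g ->
        exists n, m = lam n ^+ 2].

Definition cis (t : R) : R[i] := (cos t +i* sin t)%C.

Definition freq (lam : nat -> R) (j : nat * int) : R :=
  Num.sqrt (lam j.1 ^+ 2 + (2 * pi * j.2%:~R) ^+ 2).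

Definition bracket (x : R) : R := Num.sqrt (1 + x ^+ 2).

Definition mode (e : nat -> R * R -> R) (j : nat * int) (x : R * R * R)
    : R[i] :=
  (e j.1 x.1)%:C%C * cis (2 * pi * j.2%:~R * x.2).

Definition cmeasurable d (T : measurableType d) (D : set T) (f : T -> R[i]) :=
  measurable_fun D (fun x => complex.Re (f x)) /\
  measurable_fun D (fun x => complex.Im (f x)).

Definition L2_norm (f : R * R * R -> R[i]) : \bar R :=
  ('N[mu3]_2%:E[(fun x => (Normc.normc (f x))%:E) \_ cylinder])%E.

(* f = \sum_j a_j phi_j, the sum being unconditionally convergent (i.e. along
   the net of finite sets of indices) in L^2(B_2 x T). *)
Definition L2_sum (a : nat * int -> R[i]) (phi : nat * int -> R * R * R -> R[i])
    (f : R * R * R -> R[i]) : Prop :=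
  cmeasurable cylinder f /\
  forall eps : R, 0 < eps -> exists A : {fset nat * int},
    forall B : {fset nat * int}, (A `<=` B)%fset ->
      (L2_norm (fun x => f x - \sum_(j <- B) a j * phi j x)%R < eps%:E)%E.

Definition Hs_norm (lam : nat -> R) (s : R) (a : nat * int -> R[i]) : \bar R :=
  ((\esum_(j in [set: nat * int])
      (bracket (freq lam j) `^ (2 * s) * Normc.normc (a j) ^+ 2)%:E)
   `^ (2^-1))%E.

(* f belongs to H^s and has coefficients a.  The condition L2_sum makes this
   the space H^s for s >= 0 only (for s < 0 its elements need not be functions).
   The coefficients are determined by f, so the norm of f in H^s is
   Hs_norm lam s a. *)
Definition Hs_with_coefs (lam : nat -> R) (e : nat -> R * R -> R) (s : R)
    (f : R * R * R -> R[i]) (a : nat * int -> R[i]) : Prop :=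
  L2_sum a (mode e) f /\ (Hs_norm lam s a < +oo)%E.

(* u is a jointly measurable representative of (t, x) |-> (S(t) f)(x), where f
   has coefficients a; two of them agree for every t at almost every x. *)
Definition evolution (lam : nat -> R) (e : nat -> R * R -> R)
    (a : nat * int -> R[i]) (u : R -> R * R * R -> R[i]) : Prop :=
  cmeasurable (setT `*` cylinder) (fun tx : R * (R * R * R) => u tx.1 tx.2) /\
  forall t, L2_sum (fun j => a j * cis (- (freq lam j * t))) (mode e) (u t).

Definition LpxLqt_norm (p q : R) (I : set R) (u : R -> R * R * R -> R[i])
    : \bar R :=
  ('N[mu3]_p%:E[(fun x =>
     'N[mu1]_q%:E[(fun t => (Normc.normc (u t x))%:E) \_ I]) \_ cylinder])%E.

End Definitions.

(* Main.v *)
Require Import Defs.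
From HB Require Import structures.
From mathcomp Require Import all_boot all_order all_algebra finmap.
From mathcomp Require Import all_classical all_reals all_analysis.
From mathcomp.real_closed Require Import complex.
From mathcomp Require Import measurable_realfun.
From mathcomp Require Import ring lra zify.

Set Implicit Arguments.
Unset Strict Implicit.
Unset Printing Implicit Defensive.

Import Order.TTheory GRing.Theory Num.Theory.
Import numFieldNormedType.Exports.

Local Open Scope classical_set_scope.
Local Open Scope ring_scope.

(* Each e_n (r, 0) is a regular solution of r G'' + G' + lam_n^2 r G = 0, so it is
   e_n(0) J_0(lam_n r); two monotone quantities attached to this equation give
   |e_n(x)|^2 <= 12 / |x| and |e_n|^2 <= 96 (lam_n + 1).  All eigenfunctions being
   dilates of one function, lam_n / lam_(n+1) is a zero of e_(n+1); since two
   neighbouring zeros cannot be too close, lam_(n+1) - lam_n >= c > 0.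

   By this gap, for every y the sum of 1 / (1 + (y - z)^2) over the frequencies
   z = z_(n,n') <= N is O(N).  Testing |sum b_j e^(-i z_j t)|^2 against the weight
   4 - t^2, whose Fourier transform decays quadratically, and applying Schur's
   test bounds its L^2 norm over a unit time interval by O(N^(1/2)) |b|, while
   counting the O(N^2) frequencies bounds its supremum by O(N) |b|.  Interpolation
   gives O(N^(1 - 1/q)) |b| in L^q in time, and dyadic blocks add up as soon as
   sigma > 1 - 1/q derivatives are available.

   For fixed x this is applied with b_j = a_j e_n(x) and sigma = s - 1/2 + theta:
   as |e_n(x)|^2 <= C lam_n^(1 - 2 theta) |x|^(- 2 theta), the L^q norm in time is
   at most C |x|^(- theta) times the H^s norm.  The hypothesis on s leaves room for
   some theta <= 1/2 with theta p < 2, which makes |x|^(- theta) an L^p function.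
   The bound passes from partial sums to u by Fatou's lemma along a subsequence. *)

(** * Radial solutions *)

(** The two lower bounds on [s] have one origin. Trading a power of lam_n for |x|^(- theta) is most
    profitable at theta = 1/2, which requires s > 1 - 1/q, but |x|^(-1/2) is in L^p of the disc only
    for p < 4. For p >= 4, theta has to stay below 2/p, and s > 3/2 - 1/q - theta becomes the second
    bound. No Bessel asymptotics enter: the normalization of e_n acts only through the bound 2 l^2
    for r^2 (G'^2 + l^2 G^2), a primitive of 2 l^2 r G^2. The gap separates the lam_n but not the
    z_(n,n'): n' and -n' give the same frequency, and when n' dominates, a step in n hardly moves z.
    Separation therefore holds only in the larger of the two coordinates. With the other one free,
    up to a multiple of N frequencies can share a unit window, which is the source of N^(1/2) in the
    L^2 bound. A last obstacle: S(t) f is an L^2 limit for each t separately, hence defined up to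
    null sets of x depending on t, while the mixed norm looks at functions of t for fixed x. *)

Section OneVariable.
Context {R : realType}.
Implicit Types (f g : R -> R) (x a b : R).

Lemma is_derive_addf f g x df dg : is_derive x 1 f df -> is_derive x 1 g dg ->
  is_derive x 1 (fun y => f y + g y) (df + dg).
Proof. exact: is_deriveD. Qed.

Lemma is_derive_oppf f x df : is_derive x 1 f df ->
  is_derive x 1 (fun y => - f y) (- df).
Proof. exact: is_deriveN. Qed.

Lemma is_derive_mulf f g x df dg : is_derive x 1 f df -> is_derive x 1 g dg ->
  is_derive x 1 (fun y => f y * g y) (df * g x + f x * dg).
Proof.
by move=> hf hg; apply: is_derive_eq; rewrite addrC [X in X + _]mulrC.
Qed.

Lemma is_derive_expf f x df n : is_derive x 1 f df ->
  is_derive x 1 (fun y => f y ^+ n) (n%:R * f x ^+ n.-1 * df).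
Proof.
move=> hf; have -> : (fun y => f y ^+ n) = f ^+ n by rewrite exprfctE.
exact: is_derive_eq.
Qed.

Lemma is_derive_invf f x df : f x != 0 -> is_derive x 1 f df ->
  is_derive x 1 (fun y => (f y)^-1) (- df / f x ^+ 2).
Proof.
move=> fx0 hf; have := is_deriveV fx0 => /(_ _ _ hf) h.
by apply: (is_derive_eq h); rewrite /GRing.scale/= mulNr mulNr mulrC.
Qed.

Lemma is_derive_compf f g x df dg : is_derive x 1 f df ->
  is_derive (f x) 1 g dg -> is_derive x 1 (fun y => g (f y)) (dg * df).
Proof. by move=> hf hg; exact: is_derive1_comp. Qed.

Lemma is_derive_sqrtf f x df : 0 < f x -> is_derive x 1 f df ->
  is_derive x 1 (fun y => Num.sqrt (f y)) (df / (2 * Num.sqrt (f x))).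
Proof.
move=> fx0 hf; apply: is_derive_eq.
  exact: (is_derive_compf hf (is_derive1_sqrt fx0)).
by rewrite mulrC.
Qed.

Lemma is_derive_continuous f x df : is_derive x 1 f df -> {for x, continuous f}.
Proof. by move=> [hf _]; apply/differentiable_continuous/derivable1_diffP. Qed.

Lemma is_derive_within f df a b :
  (forall x, a <= x <= b -> is_derive x 1 f (df x)) ->
  {within `[a, b], continuous f}.
Proof.
move=> h; apply: derivable_within_continuous => x; rewrite in_itv/= => xab.
by have [] := h x xab.
Qed.

Lemma mean_value f df a b : a <= b ->
  (forall x, a < x < b -> is_derive x 1 f (df x)) ->
  {within `[a, b], continuous f} ->
  exists2 c, a <= c <= b & f b - f a = df c * (b - a) /\ (a < b -> a < c < b).
Proof.
rewrite le_eqVlt => /predU1P[-> _ _|ab h fc].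
  by exists b; rewrite ?lexx// !subrr mulr0; split=> //; rewrite ltxx.
have dh x : x \in `]a, b[ -> is_derive x 1 f (df x) by rewrite in_itv/= => /h.
have [c cab ->] := MVT ab dh fc.
move: cab; rewrite in_itv/= => /andP[ac cb].
by exists c; rewrite ?(ltW ac) ?(ltW cb)// ac cb.
Qed.

Lemma derive_ge0_nondecreasing f df a b : a <= b ->
  (forall x, a <= x <= b -> is_derive x 1 f (df x)) ->
  (forall x, a < x < b -> 0 <= df x) -> f a <= f b.
Proof.
rewrite le_eqVlt => /predU1P[->//|ab h h0].
have h' x : a < x < b -> is_derive x 1 f (df x).
  by move=> /andP[ax xb]; apply: h; rewrite !ltW.
have [c _ [e /(_ ab)/h0 dc]] := mean_value (ltW ab) h' (is_derive_within h).
by rewrite -subr_ge0 e mulr_ge0// subr_ge0 ltW.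
Qed.

Lemma derive_bounded_dist f df a b M : a <= b ->
  (forall x, a < x < b -> is_derive x 1 f (df x)) ->
  {within `[a, b], continuous f} ->
  (forall x, a < x < b -> `|df x| <= M) -> `|f b - f a| <= M * (b - a).
Proof.
rewrite le_eqVlt => /predU1P[-> _ _ _|ab h fc hM].
  by rewrite !subrr normr0 mulr0.
have [c _ [-> /(_ ab) /hM dc]] := mean_value (ltW ab) h fc.
by rewrite normrM (@ger0_norm _ (b - a)) ?subr_ge0 ?(ltW ab)// ler_wpM2r ?subr_ge0 ?(ltW ab).
Qed.

End OneVariable.

(* Plain [apply] would let typeclass resolution fill in the premises with the
   library's pointfree instances, whose values are written with [*:]. *)
Ltac isd := repeat first
  [ eassumption
  | notypeclasses refine (is_derive_cst _ _ _)
  | notypeclasses refine (is_derive_id _ _)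
  | notypeclasses refine (is_derive_addf _ _)
  | notypeclasses refine (is_derive_oppf _)
  | notypeclasses refine (is_derive_mulf _ _)
  | notypeclasses refine (is_derive_expf _ _) ].
Ltac isd_eq := notypeclasses refine (is_derive_eq _ _).

(** * The radial equation and its monotone quantities *)

Section RadialODE.
Context {R : realType}.
Implicit Types (l r : R) (G : R -> R).

(** The equation is multiplied by r, so that it makes sense at r = 0, where it reads G1 0 = 0 and
    singles out the regular solutions. The point r = 1 is excluded because eigenfunctions are C^2 in
    the open disc only; the boundary value enters later by continuity. *)
Definition radial_solution l G (G1 G2 : R -> R) := forall r : R, 0 <= r < 1 ->
  [/\ is_derive r 1 G (G1 r), is_derive r 1 G1 (G2 r) &
      r * G2 r + G1 r + l ^+ 2 * r * G r = 0].

Lemma radial_solution_G1_0 l G (G1 G2 : R -> R) : radial_solution l G G1 G2 -> G1 0 = 0.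
Proof.
by move=> /(_ 0); rewrite lexx ltr01 => /(_ isT)[_ _]; rewrite !(mul0r, mulr0) add0r addr0.
Qed.

(** The equation gives G2 + l^2 G = - G1 / r, so the energy has derivative - 2 G1^2 / r. Its sign
    matters at interior points only, which allows a = 0. *)
Lemma radial_energy_le l G G1 G2 a r : radial_solution l G G1 G2 ->
  0 <= a -> a <= r -> r < 1 ->
  G1 r ^+ 2 + l ^+ 2 * G r ^+ 2 <= G1 a ^+ 2 + l ^+ 2 * G a ^+ 2.
Proof.
move=> sol a0 ar r1; rewrite -lerN2.
apply: (@derive_ge0_nondecreasing _
  (fun x => - (G1 x ^+ 2 + l ^+ 2 * G x ^+ 2))
  (fun x => - (2 * G1 x * (G2 x + l ^+ 2 * G x)))) => // x /andP[ax xr].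
- have [|h1 h2 _] := sol x; first by rewrite (le_trans a0 ax) (le_lt_trans xr r1).
  by isd_eq; [isd|rewrite /=; ring].
- have x0 : 0 < x by exact: le_lt_trans ax.
  have [|_ _ eq] := sol x; first by rewrite (ltW x0) (lt_trans xr r1).
  have -> : G2 x + l ^+ 2 * G x = - G1 x / x.
    by apply: (mulfI (lt0r_neq0 x0)); rewrite mulrCA mulfV ?lt0r_neq0// mulr1 -[RHS]addr0 -eq; ring.
  have -> : - (2 * G1 x * (- G1 x / x)) = 2 * G1 x ^+ 2 / x by ring.
  by rewrite divr_ge0 ?(ltW x0)// mulr_ge0// sqr_ge0.
Qed.

(** At the centre G1 vanishes, so the energy there is l^2 G(0)^2 and dominates each of its two terms
    further out. *)
Lemma radial_solution_le0 l G G1 G2 r : 0 < l -> radial_solution l G G1 G2 ->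
  0 <= r < 1 -> `|G r| <= `|G 0|.
Proof.
move=> l0 sol /andP[r0 r1]; have := radial_energy_le sol (lexx 0) r0 r1.
rewrite (radial_solution_G1_0 sol) expr0n/= add0r => h.
have : l ^+ 2 * G r ^+ 2 <= l ^+ 2 * G 0 ^+ 2.
  by apply: le_trans h; rewrite lerDr sqr_ge0.
rewrite ler_pM2l ?exprn_gt0// => h2.
by rewrite -ler_sqr ?nnegrE// !real_normK ?num_real.
Qed.

Lemma radial_solution_derive_le l G G1 G2 r : 0 < l -> radial_solution l G G1 G2 ->
  0 <= r < 1 -> `|G1 r| <= l * `|G 0|.
Proof.
move=> l0 sol /andP[r0 r1]; have := radial_energy_le sol (lexx 0) r0 r1.
rewrite (radial_solution_G1_0 sol) expr0n/= add0r => h.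
have : G1 r ^+ 2 <= (l * G 0) ^+ 2.
  by rewrite exprMn; apply: le_trans h; rewrite lerDl mulr_ge0 ?sqr_ge0.
have -> : l * `|G 0| = `|l * G 0| by rewrite normrM gtr0_norm.
move=> h2.
by rewrite -ler_sqr ?nnegrE// !real_normK ?num_real.
Qed.

Lemma radial_solution_unique l G G1 G2 r : 0 < l -> radial_solution l G G1 G2 ->
  G 0 = 0 -> 0 <= r < 1 -> G r = 0.
Proof.
move=> l0 sol G0 /(radial_solution_le0 l0 sol).
by rewrite G0 normr0 normr_le0 => /eqP.
Qed.

(** A Pohozaev-type quantity: in its derivative all terms with G1 form a multiple of the equation,
    and 2 l^2 r G^2 remains. It thus measures the mass inside radius r, and away from the centre it
    controls G and G1 together. *)
Definition radial_flux l G (G1 : R -> R) r : R := r ^+ 2 * (G1 r ^+ 2 + l ^+ 2 * G r ^+ 2).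

Lemma is_derive_radial_flux l G G1 G2 r : radial_solution l G G1 G2 ->
  0 <= r < 1 ->
  is_derive r 1 (radial_flux l G G1) (2 * l ^+ 2 * r * G r ^+ 2).
Proof.
move=> sol r01; have [h1 h2 eq] := sol _ r01.
isd_eq; first by rewrite /radial_flux; isd.
rewrite /=.
transitivity (2 * r * G1 r * (r * G2 r + G1 r + l ^+ 2 * r * G r) + 2 * l ^+ 2 * r * G r ^+ 2).
  by ring.
by rewrite eq mulr0 add0r.
Qed.

(* With v = sqrt r * G, which solves v'' + q v = 0 for q = l^2 + 1/(4 r^2), this
   is v'^2 / q + v^2; it is nondecreasing because q decreases. *)
Definition radial_amplitude l G (G1 : R -> R) r : R :=
  r * (2 * r * G1 r + G r) ^+ 2 / (4 * l ^+ 2 * r ^+ 2 + 1) + r * G r ^+ 2.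

Lemma radial_amplitude_le l G G1 G2 a b : radial_solution l G G1 G2 ->
  0 <= a -> a <= b -> b < 1 ->
  radial_amplitude l G G1 a <= radial_amplitude l G G1 b.
Proof.
move=> sol a0 ab b1.
have D0 x : 0 < 4 * l ^+ 2 * x ^+ 2 + 1.
  by rewrite ltr_wpDl// mulr_ge0 ?sqr_ge0// mulr_ge0 ?sqr_ge0.
(* In terms of v and q this derivative is - q' v'^2 / q^2, the terms in v v' cancelling by v'' = - q
   v. Written with G it has no singularity at 0, so a = 0 is allowed. *)
apply: (@derive_ge0_nondecreasing _ _
  (fun x => 2 * (2 * x * G1 x + G x) ^+ 2 / (4 * l ^+ 2 * x ^+ 2 + 1) ^+ 2)) => // x /andP[ax xb].
- have [|h1 h2 eq] := sol x; first by rewrite (le_trans a0 ax) (le_lt_trans xb b1).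
  isd_eq.
    rewrite /radial_amplitude; notypeclasses refine (is_derive_addf _ _); last by isd.
    notypeclasses refine (is_derive_mulf _ _); first by isd.
    by notypeclasses refine (is_derive_invf _ _); [exact: lt0r_neq0|isd].
  have D' := lt0r_neq0 (D0 x).
  have -> : G1 x = - (x * G2 x + l ^+ 2 * x * G x).
    by apply/eqP; rewrite -addr_eq0 addrA addrAC -eq; apply/eqP; ring.
  by rewrite /=; field.
- by rewrite divr_ge0 ?sqr_ge0// mulr_ge0 ?sqr_ge0.
Qed.

End RadialODE.

Lemma within_continuous_compW (U V W : topologicalType) (A : set U) (B : set V)
    (f : U -> V) (g : V -> W) :
  continuous f -> (forall x, A x -> B (f x)) -> {within B, continuous g} ->
  {within A, continuous (fun x => g (f x))}.
Proof.
move=> cf fAB /subspace_continuousP cg; apply/subspace_continuousP => x Ax S nS.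
have /cf h := cg _ (fAB _ Ax) _ nS.
by apply: (@filterS _ (nbhs x) _ _ _ _ h) => y /= gy /fAB.
Qed.

(** * Size and zeros of regular solutions *)

Section RadialODEBounds.
Context {R : realType}.
Implicit Types (l m r al a b : R) (G H : R -> R).

Lemma radial_flux_nondecreasing l G (G1 G2 : R -> R) a b :
  radial_solution l G G1 G2 -> 0 <= a -> a <= b -> b < 1 ->
  radial_flux l G G1 a <= radial_flux l G G1 b.
Proof.
move=> sol a0 ab b1; apply: (derive_ge0_nondecreasing ab) => x /andP[ax xb].
  apply: (is_derive_radial_flux sol).
  by rewrite (le_trans a0 ax) (le_lt_trans xb b1).
by rewrite mulr_ge0 ?sqr_ge0// mulr_ge0 ?(le_trans a0 (ltW ax))// mulr_ge0 ?sqr_ge0.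
Qed.

(** The flux at 1/2 gives G^2 <= 8 and G1^2 <= 8 l^2 there, so the amplitude at 1/2 is at most 8 + 4
    = 12. Being nondecreasing, it bounds r G^2 on the whole of [0, 1/2]. Beyond 1/2 the flux at r
    suffices: r^2 G^2 <= 2. *)
Lemma radial_solution_decay l G (G1 G2 : R -> R) r : 0 < l ->
  radial_solution l G G1 G2 ->
  (forall x : R, 0 <= x < 1 -> radial_flux l G G1 x <= 2 * l ^+ 2) ->
  0 <= r < 1 -> r * G r ^+ 2 <= 12.
Proof.
move=> l0 sol flux r01.
have l20 : 0 < l ^+ 2 by rewrite exprn_gt0.
have [r0 r1] := andP r01.
have [r2|r2] := leP r (1 / 2).
  have l1 : (1 : R) / 2 < 1 by lra.
  have := flux (1 / 2); rewrite l1 divr_ge0//= => /(_ isT).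
  rewrite /radial_flux => h.
  have g8 : G (1 / 2) ^+ 2 <= 8.
    rewrite -(ler_pM2l l20); have := sqr_ge0 (G1 (1 / 2)); nra.
  have k8 : G1 (1 / 2) ^+ 2 <= 8 * l ^+ 2.
    have : 0 <= l ^+ 2 * G (1 / 2) ^+ 2 by rewrite mulr_ge0 ?sqr_ge0.
    nra.
  have := radial_amplitude_le sol r0 r2 l1.
  rewrite {2}/radial_amplitude.
  have -> : 4 * l ^+ 2 * (1 / 2) ^+ 2 + 1 = l ^+ 2 + 1 :> R by field.
  have : (1 / 2) * (2 * (1 / 2) * G1 (1 / 2) + G (1 / 2)) ^+ 2 / (l ^+ 2 + 1) <= 8 :> R.
    rewrite ler_pdivrMr ?addr_gt0//; have := sqr_ge0 (G1 (1 / 2) - G (1 / 2)); nra.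
  have : r * G r ^+ 2 <= radial_amplitude l G G1 r.
    rewrite lerDr divr_ge0//; first by rewrite mulr_ge0// sqr_ge0.
    by rewrite addr_ge0// mulr_ge0 ?sqr_ge0// mulr_ge0 ?sqr_ge0.
  move: (radial_amplitude _ _ _ r) (_ / (l ^+ 2 + 1)) (r * G r ^+ 2) => A B D.
  lra.
have := flux _ r01; rewrite /radial_flux => h.
have h2 : r ^+ 2 * G r ^+ 2 <= 2.
  rewrite -(ler_pM2l l20).
  have : 0 <= r ^+ 2 * G1 r ^+ 2 by rewrite mulr_ge0 ?sqr_ge0.
  nra.
have g0 : 0 <= r * G r ^+ 2 by rewrite mulr_ge0 ?sqr_ge0.
nra.
Qed.

(** As |G1| <= l |G 0|, the function keeps half of its central value up to r = 1 / (2 (l + 1)). The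
    decay bound at this r gives G(0)^2 <= 4 G(r)^2 <= 4 * 12 / r = 96 (l + 1). Taking l + 1 instead
    of l keeps r < 1 for small l. *)
Lemma radial_solution_sup l G (G1 G2 : R -> R) : 0 < l ->
  radial_solution l G G1 G2 ->
  (forall x : R, 0 <= x < 1 -> radial_flux l G G1 x <= 2 * l ^+ 2) ->
  G 0 ^+ 2 <= 96 * (l + 1).
Proof.
move=> l0 sol flux; set r := (2 * (l + 1))^-1.
have l10 : 0 < 2 * (l + 1) by lra.
have r0 : 0 < r by rewrite invr_gt0.
have rl : r * (2 * (l + 1)) = 1 by rewrite mulVf// lt0r_neq0.
have r1 : r < 1 by nra.
have r01 : 0 <= r < 1 by rewrite (ltW r0).
have dist : `|G r - G 0| <= l * `|G 0| * (r - 0).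
  apply: (@derive_bounded_dist _ _ G1) => [|x /andP[x0 xr]||x /andP[x0 xr]].
  - exact: ltW.
  - by have [|//] := sol x; rewrite (ltW x0) (lt_trans xr r1).
  - apply: is_derive_within => x /andP[x0 xr].
    have [|h _ _] := sol x; last exact: h.
    by rewrite x0 (le_lt_trans xr r1).
  - by apply: radial_solution_derive_le sol _; rewrite // (ltW x0) (lt_trans xr r1).
have half : `|G 0| <= 2 * `|G r|.
  have : `|G 0| <= `|G r| + `|G r - G 0|.
    by rewrite -[X in `|X| <= _](subrKC (G r)) (le_trans (ler_normD _ _))// distrC.
  have := normr_ge0 (G 0); have : l * r <= 1 / 2 by nra.
  nra.
have sq : G 0 ^+ 2 <= 4 * G r ^+ 2.
  rewrite -(real_normK (num_real (G 0))) -(real_normK (num_real (G r))).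
  have := normr_ge0 (G 0); nra.
have := radial_solution_decay l0 sol flux r01.
have := sqr_ge0 (G r).
have -> : G r ^+ 2 = 2 * (l + 1) * (r * G r ^+ 2) by rewrite mulrA [2 * _ * r]mulrC rl mul1r.
nra.
Qed.

Lemma radial_solution_scale m G (G1 G2 : R -> R) al : 0 < al -> al <= 1 ->
  radial_solution m G G1 G2 ->
  radial_solution (al * m) (fun r => G (al * r)) (fun r => al * G1 (al * r))
    (fun r => al ^+ 2 * G2 (al * r)).
Proof.
move=> al0 al1 sol r /andP[r0 r1].
have [|h1 h2 eq] := sol (al * r).
  by rewrite mulr_ge0 ?(ltW al0)//= (le_lt_trans _ r1)// -[leRHS]mul1r ler_wpM2r.
have hs : is_derive r 1 (fun y : R => al * y) al.
  by isd_eq; [isd|rewrite /= mul0r add0r mulr1].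
split.
- isd_eq; first exact: (is_derive_compf hs h1).
  by rewrite mulrC.
- isd_eq.
    notypeclasses refine (is_derive_mulf _ _); first by isd.
    exact: (is_derive_compf hs h2).
  by rewrite /=; ring.
- transitivity (al * (al * r * G2 (al * r) + G1 (al * r) + m ^+ 2 * (al * r) * G (al * r))).
    by ring.
  by rewrite eq mulr0.
Qed.

Lemma radial_solution_lincomb l G (G1 G2 : R -> R) H (H1 H2 : R -> R) a b :
  radial_solution l G G1 G2 -> radial_solution l H H1 H2 ->
  radial_solution l (fun r => a * G r + b * H r)
    (fun r => a * G1 r + b * H1 r) (fun r => a * G2 r + b * H2 r).
Proof.
move=> solG solH r r01.
have [g1 g2 eqG] := solG _ r01; have [h1 h2 eqH] := solH _ r01.
split.
- by isd_eq; [isd|rewrite /=; ring].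
- by isd_eq; [isd|rewrite /=; ring].
- transitivity (a * (r * G2 r + G1 r + l ^+ 2 * r * G r)
    + b * (r * H2 r + H1 r + l ^+ 2 * r * H r)); first by ring.
  by rewrite eqG eqH !mulr0 addr0.
Qed.

(* Regular solutions with the same value at the centre agree, so after rescaling
   the radius both functions are multiples of one and the same Bessel function. *)
Lemma radial_solution_common_zero l m G (G1 G2 : R -> R) H (H1 H2 : R -> R) :
  0 < l -> l <= m -> radial_solution l G G1 G2 -> radial_solution m H H1 H2 ->
  {within `[0, 1], continuous G} -> G 1 = 0 -> G 0 != 0 ->
  {within `[0, 1], continuous H} -> H (l / m) = 0.
Proof.
move=> l0 lm solG solH cG G10 G00 cH.
have m0 : 0 < m by exact: lt_le_trans lm.
set al := l / m.
have al0 : 0 < al by rewrite divr_gt0.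
have al1 : al <= 1 by rewrite ler_pdivrMr// mul1r.
have := radial_solution_scale al0 al1 solH.
rewrite (_ : al * m = l); last by rewrite mulfVK// lt0r_neq0.
move=> solHs; have := radial_solution_lincomb (- H 0) (G 0) solG solHs.
set K := (fun r => _); set K1 := (fun r => _) => solK.
have K0 : K 0 = 0 by rewrite /K mulr0; ring.
(* Since K vanishes at 0, the derivative bound l |K 0| is zero. The mean value inequality carries
   this to r = 1, where only continuity is available. *)
have : `|K 1 - K 0| <= 0 * (1 - 0).
  apply: (@derive_bounded_dist _ K K1) => // [x /andP[x0 x1]||x /andP[x0 x1]].
  - by have [|//] := solK x; rewrite (ltW x0).
  - have cHs : {within `[0, 1], continuous (fun r => H (al * r))}.
      apply: (@within_continuous_compW R R R _ `[0, 1]%classic (fun r : R => al * r) H) => //.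
      - by move=> x; apply: cvgM; [exact: cvg_cst|exact: cvg_id].
      - move=> x /=; rewrite !in_itv/= => /andP[x0 x1].
        by rewrite mulr_ge0 ?(ltW al0)//= -[1]mulr1 ler_pM ?(ltW al0).
    move=> x; apply: (@cvgD _ _ _ (nbhs x)).
    + by apply: (@cvgM _ _ (nbhs x)); [exact: cvg_cst|exact: cG].
    + by apply: (@cvgM _ _ (nbhs x)); [exact: cvg_cst|exact: cHs].
  - have := @radial_solution_derive_le _ _ _ _ _ x l0 solK.
    by rewrite K0 normr0 mulr0 (ltW x0) x1 => /(_ isT).
rewrite mul0r K0 subr0 normr_le0 /K G10 mulr0 add0r mulr1 mulf_eq0 (negbTE G00).
by move=> /eqP.
Qed.

(* G has a critical point g in (al, 1).  Integrating (r G')' = - l^2 r G from g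
   bounds G', and then G, by l^2 (1 - al)^2 / al times the maximum of |G|. *)
Lemma radial_solution_zero_gap l G (G1 G2 : R -> R) al : 0 < l ->
  radial_solution l G G1 G2 -> {within `[0, 1], continuous G} -> G 0 != 0 ->
  G 1 = 0 -> 0 < al -> al < 1 -> G al = 0 -> al <= l ^+ 2 * (1 - al) ^+ 2.
Proof.
move=> l0 sol cG G00 G10 al0 al1 Gal.
have cGs : {within `[al, 1], continuous G}.
  apply: continuous_subspaceW cG => x /=; rewrite !in_itv/= => /andP[ax ->].
  by rewrite (le_trans (ltW al0) ax).
have dG x : al < x < 1 -> is_derive x 1 G (G1 x).
  by move=> /andP[ax x1]; have [|//] := sol x; rewrite (ltW (lt_trans al0 ax)) x1.
have [g _ [e /(_ al1)/andP[alg g1]]] := mean_value (ltW al1) dG cGs.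
have G1g : G1 g = 0.
  move/eqP: e; rewrite G10 Gal subrr eq_sym mulf_eq0 subr_eq0 (gt_eqF al1) orbF.
  by move/eqP.
have g0 : 0 < g by exact: lt_trans alg.
have [c cal1 cmax] : exists2 c, c \in `[al, 1]%R &
    forall t, t \in `[al, 1]%R -> `|G t| <= `|G c|.
  apply: (@EVT_max _ (fun x => `|G x|)); first exact: ltW.
  by move=> x; apply: continuous_comp; [exact: cGs|exact: norm_continuous].
set M := `|G c|.
(* If M = 0, then G and G1 both vanish at g, and so does the flux. Being nondecreasing and
   nonnegative, the flux vanishes on all of (0, g], so G is constant on [0, g] and G 0 = 0. *)
have M0 : 0 < M.
  rewrite lt_neqAle normr_ge0 andbT eq_sym; apply/negP => /eqP M0.
  have Gg : G g = 0.
    apply/eqP; rewrite -normr_le0 -M0; apply: cmax.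
    by rewrite in_itv/= !ltW.
  have flux0 x : 0 < x <= g -> G1 x = 0.
    move=> /andP[x0 xg].
    have := radial_flux_nondecreasing sol (ltW x0) xg g1.
    rewrite /radial_flux Gg G1g expr0n/= mulr0 addr0 mulr0.
    rewrite pmulr_rle0 ?exprn_gt0// => h.
    apply/eqP; rewrite -sqrf_eq0 eq_le sqr_ge0 andbT (le_trans _ h)// lerDl.
    by rewrite mulr_ge0 ?sqr_ge0.
  have : `|G g - G 0| <= 0 * (g - 0).
    apply: (@derive_bounded_dist _ G G1) => [|x /andP[x0 xg]||x /andP[x0 xg]].
    - exact: ltW.
    - by have [|//] := sol x; rewrite (ltW x0) (lt_trans xg g1).
    - apply: continuous_subspaceW cG => x /=; rewrite !in_itv/= => /andP[-> xg].
      by rewrite (le_trans xg (ltW g1)).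
    - by rewrite flux0 ?normr0// x0 ltW.
  by rewrite mul0r Gg sub0r normrN normr_le0 (negbTE G00).
have GM x : al < x < 1 -> `|G x| <= M.
  by move=> /andP[ax x1]; apply: cmax; rewrite in_itv/= !ltW.
have dP x : al < x < 1 -> is_derive x 1 (fun r => r * G1 r) (- (l ^+ 2 * x * G x)).
  move=> /andP[ax x1].
  have [|h1 h2 eq] := sol x; first by rewrite (ltW (lt_trans al0 ax)) x1.
  isd_eq; first by isd.
  by apply/eqP; rewrite -addr_eq0 /= mul1r [G1 x + _]addrC eq.
have bP x : al < x < 1 -> `|- (l ^+ 2 * x * G x)| <= l ^+ 2 * M.
  move=> x01; have [ax x1] := andP x01.
  have x0 := lt_trans al0 ax.
  rewrite normrN -mulrA normrM (ger0_norm (sqr_ge0 l)) ler_wpM2l ?sqr_ge0//.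
  rewrite normrM (gtr0_norm x0).
  by rewrite -[M]mul1r ler_pM ?GM// ltW.
have bG1 x : al < x < 1 -> `|G1 x| <= l ^+ 2 * M * (1 - al) / al.
  move=> x01; have [ax x1] := andP x01.
  have xg : `|x * G1 x| <= l ^+ 2 * M * (1 - al).
    have l2M : 0 <= l ^+ 2 * M by rewrite mulr_ge0 ?sqr_ge0// ltW.
    have [xg|gx] := leP x g.
      have : `|g * G1 g - x * G1 x| <= l ^+ 2 * M * (g - x).
        apply: (@derive_bounded_dist _ (fun r => r * G1 r) (fun x => - (l ^+ 2 * x * G x))) => //.
        - by move=> y /andP[xy yg]; apply: dP; rewrite (lt_trans ax xy) (lt_trans yg g1).
        - apply: (@is_derive_within _ _ (fun x => - (l ^+ 2 * x * G x))) => y /andP[xy yg].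
          by apply: dP; rewrite (lt_le_trans ax xy) (le_lt_trans yg g1).
        - by move=> y /andP[xy yg]; apply: bP; rewrite (lt_trans ax xy) (lt_trans yg g1).
      rewrite G1g mulr0 sub0r normrN => h; apply: (le_trans h).
      by rewrite ler_wpM2l// lerB// ltW.
    have : `|x * G1 x - g * G1 g| <= l ^+ 2 * M * (x - g).
      apply: (@derive_bounded_dist _ (fun r => r * G1 r) (fun x => - (l ^+ 2 * x * G x))).
      - exact: ltW.
      - by move=> y /andP[xy yg]; apply: dP; rewrite (lt_trans alg xy) (lt_trans yg x1).
      - apply: (@is_derive_within _ _ (fun x => - (l ^+ 2 * x * G x))) => y /andP[xy yg].
        by apply: dP; rewrite (lt_le_trans alg xy) (le_lt_trans yg x1).
      - by move=> y /andP[xy yg]; apply: bP; rewrite (lt_trans alg xy) (lt_trans yg x1).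
    rewrite G1g mulr0 subr0 => h; apply: (le_trans h).
    by rewrite ler_wpM2l// lerB// ltW.
  rewrite ler_pdivlMr// (le_trans _ xg)// normrM mulrC ler_wpM2r//.
  by rewrite ger0_norm ?(ltW (lt_trans al0 ax))// ltW.
have [ac c1] : al <= c /\ c <= 1 by move: cal1; rewrite in_itv/= => /andP.
have : `|G c - G al| <= l ^+ 2 * M * (1 - al) / al * (c - al).
  apply: (@derive_bounded_dist _ G G1) => //.
  - by move=> x /andP[ax xc]; apply: dG; rewrite ax (lt_le_trans xc c1).
  - apply: continuous_subspaceW cGs => x /=; rewrite !in_itv/= => /andP[-> xc].
    by rewrite (le_trans xc c1).
  - by move=> x /andP[ax xc]; apply: bG1; rewrite ax (lt_le_trans xc c1).
rewrite Gal subr0 -/M => h.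
have h2 : M <= l ^+ 2 * M * (1 - al) / al * (1 - al).
  apply: (le_trans h); rewrite ler_wpM2l ?lerB//.
  by rewrite divr_ge0 ?(ltW al0)// !mulr_ge0 ?sqr_ge0// ?subr_ge0 ltW.
have h3 : M * al <= M * (l ^+ 2 * (1 - al) ^+ 2).
  have -> : M * (l ^+ 2 * (1 - al) ^+ 2) =
      l ^+ 2 * M * (1 - al) / al * (1 - al) * al.
    by field; exact: lt0r_neq0.
  by rewrite ler_pM2r.
by rewrite ler_pM2l in h3.
Qed.

End RadialODEBounds.

(** * Radial eigenfunctions *)

Section RadialEigenfunction.
Context {R : realType}.
Implicit Types (g : R * R -> R) (r s y : R).

Lemma is_derive_along g (a v : R * R) y :
  derivable g (a + y *: v) v ->
  is_derive y 1 (fun s => g (a + s *: v)) ('D_v g (a + y *: v)).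
Proof.
have E : (fun h : R => h^-1 *: (((fun s => g (a + s *: v)) \o shift y) (h *: 1) - g (a + y *: v)))
    = (fun h : R => h^-1 *: ((g \o shift (a + y *: v)) (h *: v) - g (a + y *: v))).
  apply/funext => h /=; congr (_ *: (g _ - _)).
  by rewrite /shift /= [h *: 1]mulr1 scalerDl addrCA.
move=> dg; split; first by rewrite /derivable E.
by rewrite /derive E.
Qed.

Lemma disk_axis r : (disk (r, 0) : Prop) = (`|r| < 1).
Proof. by rewrite /disk/= /enorm/= expr0n/= addr0 sqrtr_sqr. Qed.

Lemma enorm_ge0 (x : R * R) : 0 <= enorm x.
Proof. exact: sqrtr_ge0. Qed.

Lemma enorm_axis r : 0 <= r -> enorm (r, 0) = r.
Proof. by move=> r0; rewrite /enorm/= expr0n/= addr0 sqrtr_sqr ger0_norm. Qed.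

Lemma radial_axis g (x : R * R) : radial g -> closed_disk x -> g x = g (enorm x, 0).
Proof. by move=> rg dx; apply: rg => //; rewrite enorm_axis ?enorm_ge0. Qed.

Definition axis_derive g r := 'D_(1, 0) g (r, 0).

Lemma axisE r : (r, 0) = (0, 0) + r *: (1, 0) :> R * R.
Proof. by congr pair => /=; rewrite ?scaler0 ?addr0// add0r [_ *: _]mulr1. Qed.

Lemma is_derive_axis g r : derivable g (r, 0) (1, 0) ->
  is_derive r 1 (fun s => g (s, 0)) (axis_derive g r).
Proof.
rewrite /axis_derive axisE => /is_derive_along.
by rewrite (_ : (fun s => g (s, 0)) = (fun s => g ((0, 0) + s *: (1, 0))))//; apply/funext => s; rewrite -axisE.
Qed.

Lemma verticalE r y : (r, y) = (r, 0) + y *: (0, 1) :> R * R.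
Proof. by congr pair => /=; rewrite ?scaler0 ?addr0// add0r [_ *: _]mulr1. Qed.

Lemma is_derive_vertical g r y : derivable g (r, y) (0, 1) ->
  is_derive y 1 (fun s => g (r, s)) ('D_(0, 1) g (r, y)).
Proof.
rewrite verticalE => /is_derive_along.
by rewrite (_ : (fun s => g (r, s)) = (fun s => g ((r, 0) + s *: (0, 1))))//; apply/funext => s; rewrite -verticalE.
Qed.

Lemma near_sqr_lt a y : a + y ^+ 2 < 1 -> \forall s \near y, a + s ^+ 2 < 1.
Proof.
have c : (fun s => a + s ^+ 2) @ y --> a + y ^+ 2.
  by apply: cvgD; [exact: cvg_cst|exact: exprn_continuous].
by move=> h; exact: (cvgr_lt _ c _ h).
Qed.

(** Along the vertical line through (r, 0) the eigenfunction is G(rho) with rho = sqrt (r^2 + y^2).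
    Its y-derivative G'(rho) y / rho has derivative G'(r) / r at y = 0, which is the first-order
    term of the polar Laplacian. *)
Lemma radial_eigenfunction_ode m g : radial_dirichlet_eigenfunction (m ^+ 2) g ->
  radial_solution m (fun r => g (r, 0)) (axis_derive g)
    (axis_derive ('D_(1, 0) g)).
Proof.
move=> [rg [C2 cg] _ eig _] r /andP[r0 r1].
have dr s : `|s| < 1 -> disk (s, 0) by rewrite disk_axis.
have hG s : `|s| < 1 -> is_derive s 1 (fun s => g (s, 0)) (axis_derive g s).
  by move=> /dr/C2/(_ (1, 0) (0, 0))[d _ _]; exact: is_derive_axis.
have hr : `|r| < 1 by rewrite ger0_norm.
have hG1 : is_derive r 1 (axis_derive g) (axis_derive ('D_(1, 0) g) r).
  by have [_ d _] := C2 _ (dr _ hr) (1, 0) (1, 0); exact: is_derive_axis.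
split; [exact: hG|exact: hG1|].
(* At the centre only G'(0) = 0 is to be shown; radial symmetry makes G even, so G'(0) = - G'(0). *)
have [r00|rn0] := eqVneq r 0.
  rewrite r00 mulr0 !mul0r add0r addr0.
  have h0 : is_derive (0 : R) 1 (fun s => g (s, 0)) (axis_derive g 0).
    by apply: hG; rewrite normr0.
  have hN : is_derive (0 : R) 1 (fun s => g (- s, 0)) (axis_derive g 0 * - 1).
    notypeclasses refine (is_derive_compf (f := fun s : R => - s) (g := fun s => g (s, 0)) _ _); first by isd.
    by rewrite oppr0.
  have hN' : is_derive (0 : R) 1 (fun s => g (s, 0)) (axis_derive g 0 * - 1).
    apply: near_eq_is_derive hN.
    near=> s; apply: rg; rewrite /closed_disk /enorm/=.
      rewrite expr0n addr0 sqrrN -[leRHS](@sqrtr1 R) ler_sqrt// -[s ^+ 2]add0r ltW//; near: s.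
      by apply: near_sqr_lt; rewrite expr0n/= addr0.
    by rewrite sqrrN.
  have := @derive_val _ _ _ _ _ _ _ h0; rewrite (@derive_val _ _ _ _ _ _ _ hN').
  lra.
have {}r0 : 0 < r by rewrite lt_neqAle eq_sym rn0.
have := eig _ (dr _ hr); rewrite /laplacian.
suff -> : 'D_(0, 1) ('D_(0, 1) g) (r, 0) = axis_derive g r / r.
  rewrite -/(axis_derive ('D_(1, 0) g) r) => e.
  transitivity (r * (axis_derive ('D_(1, 0) g) r + axis_derive g r / r + m ^+ 2 * g (r, 0))).
    by field.
  by rewrite -e; ring.
pose rho (y : R) := Num.sqrt (r ^+ 2 + y ^+ 2).
have q0 (y : R) : 0 < r ^+ 2 + y ^+ 2 by rewrite ltr_pwDl ?exprn_gt0// sqr_ge0.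
have rho0 : rho 0 = r by rewrite /rho expr0n addr0 sqrtr_sqr gtr0_norm.
have drho y : is_derive y 1 rho (y / rho y).
  isd_eq.
    notypeclasses refine (is_derive_sqrtf _ _); first exact: q0.
    by isd.
  have : rho y != 0 by rewrite gt_eqF// sqrtr_gt0.
  by rewrite /= -/(rho y) => h; field.
have vert y : r ^+ 2 + y ^+ 2 < 1 ->
    'D_(0, 1) g (r, y) = axis_derive g (rho y) * (y / rho y).
  move=> ry1.
  have rho1 : rho y < 1 by rewrite -[1](@sqrtr1 R) ltr_sqrt.
  have rhoge0 : 0 <= rho y by exact: sqrtr_ge0.
  have h1 : is_derive y 1 (fun s => g (r, s)) ('D_(0, 1) g (r, y)).
    have [|d _ _] := C2 (r, y) _ (0, 1) (0, 0); first exact: rho1.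
    exact: is_derive_vertical.
  have h2 : is_derive y 1 (fun s => g (rho s, 0)) (axis_derive g (rho y) * (y / rho y)).
    notypeclasses refine (is_derive_compf (f := rho) (g := fun s => g (s, 0)) _ _) => //.
    by apply: hG; rewrite ger0_norm.
  rewrite -(@derive_val _ _ _ _ _ _ _ h1) -(@derive_val _ _ _ _ _ _ _ h2).
  apply: near_eq_derive; near=> s; rewrite radial_axis//.
  rewrite /closed_disk /enorm/= -[leRHS](@sqrtr1 R) ler_sqrt// ltW//; near: s.
  exact: near_sqr_lt.
have h1 : is_derive (0 : R) 1 (fun y => 'D_(0, 1) g (r, y)) ('D_(0, 1) ('D_(0, 1) g) (r, 0)).
  have [_ d _] := C2 _ (dr _ hr) (0, 1) (0, 1).
  exact: is_derive_vertical.
have h2 : is_derive (0 : R) 1 (fun y => axis_derive g (rho y) * (y / rho y)) (axis_derive g r / r).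
  isd_eq.
    notypeclasses refine (is_derive_mulf _ _).
      notypeclasses refine (is_derive_compf (drho 0) _); rewrite rho0; exact: hG1.
    notypeclasses refine (is_derive_mulf _ _); first by isd.
    by notypeclasses refine (is_derive_invf _ (drho 0)); rewrite rho0.
  by rewrite /= rho0; field.
rewrite -(@derive_val _ _ _ _ _ _ _ h1) -(@derive_val _ _ _ _ _ _ _ h2).
apply: near_eq_derive; near=> y; apply: vert; near: y.
by apply: near_sqr_lt; rewrite expr0n/= addr0 expr_lt1// ltW.
Unshelve. all: by end_near.
Qed.

Lemma radial_eigenfunction_axis_continuous m g : radial_dirichlet_eigenfunction m g ->
  {within `[-1, 1], continuous (fun r => g (r, 0))}.
Proof.
move=> [_ [_ cg] _ _ _].
apply: (@within_continuous_compW R _ R _ closed_disk (fun r : R => (r, 0)) g) => //.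
  move=> x.
  exact: (@cvg_pair R R R (nbhs x) (nbhs x) (nbhs (0 : R)) _ _ _ (fun r => r)
    (fun=> 0) (@cvg_id _ _) (cvg_cst _)).
move=> x /=; rewrite in_itv/= -ler_norml.
by rewrite /closed_disk/= /enorm/= expr0n addr0 sqrtr_sqr.
Qed.

Lemma radial_eigenfunction_continuous m g : radial_dirichlet_eigenfunction m g ->
  {within `[0, 1], continuous (fun r => g (r, 0))}.
Proof.
move=> /radial_eigenfunction_axis_continuous; apply: continuous_subspaceW => x /=.
by rewrite !in_itv/= => /andP[x0 ->]; rewrite andbT (le_trans _ x0)// oppr_le0.
Qed.

Lemma radial_eigenfunction_boundary m g : radial_dirichlet_eigenfunction m g ->
  g (1, 0) = 0.
Proof. by move=> [_ _ bg _ _]; apply: bg; rewrite enorm_axis. Qed.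

Lemma radial_eigenfunction_centre m g : 0 < m ->
  radial_dirichlet_eigenfunction (m ^+ 2) g -> g (0, 0) != 0.
Proof.
move=> m0 eg; have sol := radial_eigenfunction_ode eg.
have [rg _ _ _ [x dx gx]] := eg; apply: contra_neq gx => g0.
rewrite radial_axis//; last exact: ltW.
by rewrite (radial_solution_unique m0 sol g0)// enorm_ge0.
Qed.

End RadialEigenfunction.

Section Integrals.
Context {R : realType}.
Local Notation mu1 := (@lebesgue_measure R).

Lemma integral_is_derive (f F : R -> R) (a b : R) : a <= b ->
  (forall x, a <= x <= b -> is_derive x 1 F (f x)) ->
  {within `[a, b], continuous f} ->
  (\int[mu1]_(x in `[a, b]) (f x)%:E = (F b - F a)%:E)%E.
Proof.
rewrite le_eqVlt => /predU1P[->|ab] dF cf.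
  by rewrite set_itv1 integral_set1 subrr.
rewrite (@continuous_FTC2 _ f F)//.
- split; first by move=> x; rewrite in_itv/= => /andP[ax xb]; have [] := dF x _; rewrite ?(ltW ax) ?ltW.
  + apply: cvg_at_right_filter; apply: (is_derive_continuous (dF a _)).
    by rewrite lexx ltW.
  + apply: cvg_at_left_filter; apply: (is_derive_continuous (dF b _)).
    by rewrite lexx ltW.
- move=> x; rewrite in_itv/= => /andP[ax xb].
  have h : a <= x <= b by rewrite !ltW.
  by rewrite derive1E (@derive_val _ _ _ _ _ _ _ (dF x h)).
Qed.

End Integrals.

(** * From the L^2 normalization to the flux bound *)

Section Normalization.
Context {R : realType}.
Local Notation mu1 := (@lebesgue_measure R).
Local Notation mu2 := (mu1 \x mu1)%E.
Implicit Types (g : R * R -> R) (m r : R).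

Lemma measurable_enorm : measurable_fun setT (@enorm R).
Proof.
apply: (measurableT_comp (continuous_measurable_fun (@sqrt_continuous R))).
by apply: measurable_funD; apply: measurable_funX; [exact: measurable_fst|exact: measurable_snd].
Qed.

Lemma measurable_disk : measurable (@disk R).
Proof.
rewrite (_ : disk = @enorm R @^-1` `]-oo, 1[).
  by rewrite -[X in measurable X]setTI; apply: measurable_enorm => //; exact: measurable_itv.
by apply/seteqP; split=> x /=; rewrite in_itv.
Qed.

Lemma radial_eigenfunction_axis_derive m g r :
  radial_dirichlet_eigenfunction m g -> `|r| < 1 ->
  is_derive r 1 (fun s => g (s, 0)) (axis_derive g r).
Proof.
move=> [_ [C2 _] _ _ _] r1; apply: is_derive_axis.
have dr : disk (r, 0) by rewrite disk_axis.
have [d _ _] := C2 _ dr (1, 0) (0, 0); exact: d.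
Qed.

Lemma measurable_radial_eigenfunction m g : radial_dirichlet_eigenfunction m g ->
  measurable_fun disk g.
Proof.
move=> eg; apply: (@eq_measurable_fun _ _ _ _ _ ((fun r => g (r, 0)) \o enorm)).
  move=> x; rewrite inE => dx; rewrite /= [RHS]radial_axis//; last exact: ltW.
  by have [] := eg.
apply: (@measurable_comp _ _ _ _ _ _ (`[-1, 1] : set R)) => //.
- move=> _ [x dx <-]/=; rewrite in_itv/= (ltW dx) andbT (le_trans _ (enorm_ge0 x))// oppr_le0.
- apply: subspace_continuous_measurable_fun => //.
  exact: radial_eigenfunction_axis_continuous eg.
- by apply: measurable_funTS; exact: measurable_enorm.
Qed.

(* The flux is the integral of 2 l^2 r G^2.  In place of polar coordinates, the
   mass of the first quadrant is bounded below by Fubini in (a, b) and, for fixed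
   a, the substitution rho = sqrt (a^2 + b^2), with d rho <= d b. *)
Lemma radial_flux_le m g r : 0 < m ->
  radial_dirichlet_eigenfunction (m ^+ 2) g ->
  (\int[mu2]_(x in disk) (g x ^+ 2)%:E = 1)%E -> 0 <= r < 1 ->
  radial_flux m (fun r => g (r, 0)) (axis_derive g) r <= 2 * m ^+ 2.
Proof.
move=> m0 eg ig r01; have [r0 r1] := andP r01.
set G := fun r => g (r, 0).
have sol := radial_eigenfunction_ode eg.
have dG (x : R) : `|x| < 1 -> is_derive x 1 G (axis_derive g x).
  exact: radial_eigenfunction_axis_derive eg.
have dG2 (x : R) : `|x| < 1 -> is_derive x 1 (fun x => G x ^+ 2) (2 * G x * axis_derive g x).
  by move=> /dG h; isd_eq; [isd|rewrite /=; ring].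
(* Starting the primitive at -1 rather than 0 makes 0 an interior point, so that H is differentiable
   there too. *)
pose H x := \int[mu1]_(t in `[-1, x]) (G t ^+ 2).
have dH (x : R) : `|x| < 1 -> is_derive x 1 H (G x ^+ 2).
  move=> x1; have [xN1 x1'] : -1 < x /\ x < 1 by apply/andP; rewrite -ltr_norml.
  have [||d e] := @continuous_FTC1_closed _ (fun x => G x ^+ 2) (-1) x 1 x1' _ xN1.
  - apply: continuous_compact_integrable; first exact: segment_compact.
    have cG := radial_eigenfunction_axis_continuous eg.
    by move=> y; apply: (@cvgM _ _ (nbhs y)); exact: cG.
  - exact: is_derive_continuous (dG2 _ x1).
  - by split; [exact: d|rewrite -derive1E; exact: e].
pose rho (a b : R) := Num.sqrt (a ^+ 2 + b ^+ 2).
have rhol (a b : R) : 0 <= b -> b <= r -> a <= Num.sqrt (r ^+ 2 - b ^+ 2) -> 0 <= a -> rho b a <= r.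
  move=> b0 br aX a0; rewrite /rho -[leRHS]ger0_norm// -sqrtr_sqr ler_sqrt ?sqr_ge0//.
  have : a ^+ 2 <= r ^+ 2 - b ^+ 2.
    have h : 0 <= r ^+ 2 - b ^+ 2 by rewrite subr_ge0 ler_sqr ?nnegrE.
    by rewrite -(sqr_sqrtr h) ler_sqr ?nnegrE ?sqrtr_ge0.
  by rewrite lerBrDl.
pose F : R * R -> \bar R := (fun x => (g x ^+ 2)%:E) \_ disk.
have F0 x : (0 <= F x)%E by rewrite /F patchE; case: ifPn => // _; rewrite lee_fin sqr_ge0.
have mF : measurable_fun setT F.
  apply/(measurable_restrictT _ measurable_disk).
  apply/measurable_EFinP; apply: measurable_funX.
  exact: measurable_radial_eigenfunction eg.
have inner (a : R) : 0 < a -> a <= r -> ((H r - H a)%:E <= \int[mu1]_b F (a, b))%E.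
  move=> a0 ar; set X := Num.sqrt (r ^+ 2 - a ^+ 2).
  have mFa : measurable_fun setT (fun b => F (a, b)).
    exact: (measurableT_comp mF (pair1_measurable a)).
  have X0 : 0 <= X by exact: sqrtr_ge0.
  have rho0 b : 0 < rho a b by rewrite sqrtr_gt0 ltr_pwDl ?exprn_gt0// sqr_ge0.
  have drho (b : R) : is_derive b 1 (rho a) (b / rho a b).
    isd_eq.
      notypeclasses refine (is_derive_sqrtf _ _); first by rewrite -sqrtr_gt0; exact: rho0.
      by isd.
    have := lt0r_neq0 (rho0 b).
    by rewrite /= -/(rho a b) => h; field.
  have rho_le (b : R) : b \in `[0, X] -> rho a b <= r.
    by rewrite in_itv/= => /andP[b0 bX]; apply: rhol => //; exact: ltW.
  have rho_lt1 (b : R) : b \in `[0, X] -> `|rho a b| < 1.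
    by move=> /rho_le h; rewrite ger0_norm ?sqrtr_ge0// (le_lt_trans h).
  pose f b := G (rho a b) ^+ 2 * (b / rho a b).
  have cG2 : {within `[0, X], continuous (fun b => G (rho a b) ^+ 2)}.
    apply: derivable_within_continuous => b /rho_lt1 h.
    by have [] := is_derive_compf (drho b) (dG2 _ h).
  have cf : {within `[0, X], continuous f}.
    move=> b; apply: (@cvgM _ _ (nbhs b)); first exact: cG2.
    apply: continuous_subspaceT b => b.
    apply: (@cvgM _ _ (nbhs b)); first exact: cvg_id.
    apply: cvgV; first by rewrite gt_eqF.
    exact: is_derive_continuous (drho b).
  have -> : H r - H a = H (rho a X) - H (rho a 0).
    rewrite /rho /X sqr_sqrtr ?subr_ge0 ?ler_sqr ?nnegrE ?(ltW a0)//.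
    by rewrite subrKC expr0n addr0 !sqrtr_sqr ger0_norm// gtr0_norm.
  have dHr (b : R) : 0 <= b <= X -> is_derive b 1 (fun b => H (rho a b)) (f b).
    move=> hb; have h : `|rho a b| < 1 by apply: rho_lt1; rewrite in_itv.
    exact: (is_derive_compf (drho b) (dH _ h)).
  rewrite -(integral_is_derive X0 dHr cf).
  apply: (@le_trans _ _ (\int[mu1]_(b in `[0%R, X]) F (a, b))%E); last first.
    apply: ge0_subset_integral => //; exact: mFa.
  have mI : measurable (`[0, X] : set R) by exact: measurable_itv.
  apply: ge0_le_integral => //.
  - move=> b /=; rewrite in_itv/= => /andP[b0 _].
    by rewrite lee_fin mulr_ge0 ?sqr_ge0// divr_ge0// ltW.
  - by apply/measurable_EFinP; apply: subspace_continuous_measurable_fun.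
  - by apply: measurable_funTS; exact: mFa.
  - move=> b /=; rewrite in_itv/= => /andP[b0 bX].
    have hb : b \in `[0, X] by rewrite in_itv/= b0.
    have dab : disk (a, b) by rewrite /disk/= (le_lt_trans (rho_le _ hb)).
    rewrite /F patchE mem_set// lee_fin (_ : g (a, b) = G (rho a b)); last first.
      by rewrite radial_axis//; [have [] := eg|exact: ltW].
    rewrite -[leRHS]mulr1 ler_wpM2l ?sqr_ge0// ler_pdivrMr// mul1r.
    by rewrite /rho -[leLHS]ger0_norm// -sqrtr_sqr ler_sqrt ?addr_ge0 ?sqr_ge0// lerDr sqr_ge0.
(* Integration by parts: flux / (2 m^2) is a primitive of a G(a)^2 and offsets the derivative of - a
   H(a). At a = 0 both terms vanish and at a = r the first one does, so the integral of H r - H a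
   over [0, r] is flux(r) / (2 m^2). *)
have dP (a : R) : 0 <= a < 1 -> is_derive a 1
    (fun a => a * (H r - H a) + radial_flux m G (axis_derive g) a / (2 * m ^+ 2)) (H r - H a).
  move=> a01; have ha : `|a| < 1 by have [? ?] := andP a01; rewrite ger0_norm.
  have h1 := dH _ ha; have h2 := is_derive_radial_flux sol a01.
  isd_eq; first by isd.
  by rewrite /= -/(G a); field; exact: lt0r_neq0.
have cHr : {within `[0, r], continuous (fun a => H r - H a)}.
  apply: derivable_within_continuous => a; rewrite in_itv/= => /andP[a0 ar].
  have ha : `|a| < 1 by rewrite ger0_norm// (le_lt_trans ar).
  have h1 := dH _ ha.
  have h2 : is_derive a 1 (fun a => H r - H a) (0 - G a ^+ 2) by isd.
  by have [] := h2.
have : ((radial_flux m G (axis_derive g) r / (2 * m ^+ 2))%:E <= 1)%E.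
  rewrite -ig integral_mkcond -/F fubini_tonelli1//.
  have dPr (a : R) : 0 <= a <= r -> is_derive a 1
      (fun a => a * (H r - H a) + radial_flux m G (axis_derive g) a / (2 * m ^+ 2)) (H r - H a).
    by move=> /andP[a0 ar]; apply: dP; rewrite a0 (le_lt_trans ar).
  have := integral_is_derive r0 dPr cHr.
  rewrite subrr mulr0 mul0r !add0r /radial_flux expr0n !mul0r subr0 => <-.
  have mH : measurable_fun (`[0, r] : set R) (fun a => (H r - H a)%:E).
    by apply/measurable_EFinP; apply: subspace_continuous_measurable_fun.
  (* The endpoint a = 0 is removed because [inner] needs a > 0, which keeps rho away from 0. *)
  rewrite -integral_itv_obnd_cbnd; last first.
    by apply: measurable_funS mH => //; exact: subset_itv_oc_cc.
  apply: (@le_trans _ _ (\int[mu1]_(a in `]0%R, r]) fubini_F mu1 F a)%E); last first.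
    apply: ge0_subset_integral => //; first exact: measurable_fun_fubini_tonelli_F.
    by move=> a _; apply: integral_ge0 => b _.
  have mI : measurable (`]0, r] : set R) by exact: measurable_itv.
  apply: ge0_le_integral => //.
  - move=> a /=; rewrite in_itv/= => /andP[a0 ar]; rewrite lee_fin.
    rewrite subr_ge0; apply: (@derive_ge0_nondecreasing _ H (fun x => G x ^+ 2)) => //.
      move=> x /andP[ax xr]; apply: dH.
      by rewrite ger0_norm ?(le_trans (ltW a0) ax)// (le_lt_trans xr).
    by move=> x _; exact: sqr_ge0.
  - by apply: measurable_funS mH => //; exact: subset_itv_oc_cc.
  - by apply: measurable_funTS; exact: measurable_fun_fubini_tonelli_F.
  - by move=> a /=; rewrite in_itv/= => /andP[a0 ar]; exact: inner.
by rewrite lee_fin ler_pdivrMr ?mul1r// mulr_gt0// exprn_gt0.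
Qed.

End Normalization.

(** * Eigenvalue gap and pointwise bounds *)

Section RadialSequence.
Context {R : realType}.
Variables (lam : nat -> R) (e : nat -> R * R -> R).
Hypothesis he : radial_dirichlet_sequence lam e.

Lemma radial_eigenvalue_le n m : (n <= m)%N -> lam n <= lam m.
Proof.
have [_ lam_lt _ _ _] := he.
by apply: (homo_leq (lexx : reflexive <=%R) le_trans) => k; exact: ltW.
Qed.

(** Let d be the difference and al = lam n / (lam n + d), a zero of the next eigenfunction. If d <
    lam 0 <= lam n, then al >= 1/2; but the spacing of zeros gives al <= d^2, which is below 1/4 if
    d < 1/2. *)
Lemma radial_eigenvalue_gap_succ n : Num.min (1 / 2) (lam 0) <= lam n.+1 - lam n.
Proof.
have [lam_gt0 lam_lt eg _ _] := he; rewrite leNgt; apply/negP.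
set d := lam n.+1 - lam n; rewrite lt_min => /andP[d2 d0].
have l0 := lam_gt0 n; have l1 := lam_gt0 n.+1; have lt := lam_lt n.
have d_gt0 : 0 < d by rewrite subr_gt0.
have sol0 := radial_eigenfunction_ode (eg n).
have sol1 := radial_eigenfunction_ode (eg n.+1).
set al := lam n / lam n.+1.
have al_eq : al * lam n.+1 = lam n by rewrite mulfVK// lt0r_neq0.
have zero : e n.+1 (al, 0) = 0.
  apply: (radial_solution_common_zero l0 (ltW lt) sol0 sol1).
  - exact: radial_eigenfunction_continuous (eg n).
  - exact: radial_eigenfunction_boundary (eg n).
  - exact: radial_eigenfunction_centre (eg n).
  - exact: radial_eigenfunction_continuous (eg n.+1).
have al0 : 0 < al by rewrite divr_gt0.
have al1 : al < 1 by rewrite ltr_pdivrMr// mul1r.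
have := radial_solution_zero_gap l1 sol1
  (radial_eigenfunction_continuous (eg n.+1))
  (radial_eigenfunction_centre l1 (eg n.+1))
  (radial_eigenfunction_boundary (eg n.+1)) al0 al1 zero.
have -> : lam n.+1 ^+ 2 * (1 - al) ^+ 2 = d ^+ 2.
  by rewrite -exprMn mulrBr mulr1 [_ * al]mulrC al_eq.
have : d < lam n := lt_le_trans d0 (radial_eigenvalue_le (leq0n n)).
have : lam n.+1 = lam n + d by rewrite subrKC.
have : 1 / 2 <= al -> al <= d ^+ 2 -> False by nra.
move=> h e1 dl; apply: h; rewrite ler_pdivlMr// e1; lra.
Qed.

(** The normalization c <= 1 lets one constant serve for the spacing in n and in n'. *)
Lemma radial_eigenvalue_gap : exists2 c : R, 0 < c <= 1 &
  forall m n, (m <= n)%N -> c * (n%:R - m%:R) <= lam n - lam m.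
Proof.
have [lam_gt0 _ _ _ _] := he.
exists (Num.min (1 / 2) (lam 0)).
  by rewrite lt_min lam_gt0 divr_gt0//= ge_min; apply/orP; left; lra.
move=> m n mn; rewrite -(subnK mn); elim: (n - m)%N => [|k IH].
  by rewrite add0n !subrr mulr0.
have := radial_eigenvalue_gap_succ (k + m); rewrite addSn -natr1; lra.
Qed.

Lemma radial_eigenfunction_decay n x : disk x -> enorm x * e n x ^+ 2 <= 12.
Proof.
move=> dx; have [lam_gt0 _ eg ig _] := he; have [rg _ _ _ _] := eg n.
rewrite (radial_axis rg (ltW dx)).
apply: (radial_solution_decay (lam_gt0 n) (radial_eigenfunction_ode (eg n))).
  by move=> r r01; exact: radial_flux_le (ig n) _.
by rewrite enorm_ge0.
Qed.

Lemma radial_eigenfunction_sup n x : disk x -> e n x ^+ 2 <= 96 * (lam n + 1).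
Proof.
move=> dx; have [lam_gt0 _ eg ig _] := he; have [rg _ _ _ _] := eg n.
have sol := radial_eigenfunction_ode (eg n).
apply: le_trans (radial_solution_sup (lam_gt0 n) sol _); last first.
  by move=> r r01; exact: radial_flux_le (ig n) _.
rewrite (radial_axis rg (ltW dx)).
rewrite -(real_normK (num_real (e n (enorm x, 0)))) -(real_normK (num_real (e n (0, 0)))).
rewrite ler_sqr ?nnegrE//; apply: (radial_solution_le0 (lam_gt0 n) sol).
by rewrite enorm_ge0.
Qed.

(** Geometric mean of the uniform bound, to the power 1 - tau, and the decay bound, to the power
    tau. The constant 12 is raised to 96 so that the two powers recombine. *)
Lemma radial_eigenfunction_bound n x (tau : R) : disk x -> 0 < enorm x ->
  0 <= tau <= 1 ->
  e n x ^+ 2 <= 96 * (lam n + 1) `^ (1 - tau) * enorm x `^ (- tau).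
Proof.
move=> dx x0 /andP[tau0 tau1]; have [lam_gt0 _ _ _ _] := he.
have l1 : 0 < lam n + 1 by rewrite addr_gt0.
have [->|en0] := eqVneq (e n x) 0.
  by rewrite expr0n/= !mulr_ge0 ?powR_ge0.
have E0 : 0 < e n x ^+ 2 by rewrite exprn_even_gt0.
have h1 := radial_eigenfunction_sup n dx.
have h2 : e n x ^+ 2 <= 96 / enorm x.
  rewrite ler_pdivlMr// mulrC (le_trans (radial_eigenfunction_decay n dx))//.
  by rewrite ler_nat.
have -> : e n x ^+ 2 = (e n x ^+ 2) `^ (1 - tau) * (e n x ^+ 2) `^ tau.
  by rewrite -powRD ?subrK ?oner_eq0// powRr1// ltW.
apply: (@le_trans _ _ ((96 * (lam n + 1)) `^ (1 - tau) * (96 / enorm x) `^ tau)).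
  apply: ler_pM; rewrite ?powR_ge0//.
  - by apply: ge0_ler_powR => //; rewrite ?subr_ge0 ?nnegrE// ?ltW// mulr_gt0.
  - by apply: ge0_ler_powR => //; rewrite ?nnegrE ?ltW// divr_gt0.
rewrite !powRM ?invr_ge0 ?(ltW l1) ?(ltW x0)//.
rewrite mulrACA -powRD ?subrK ?oner_eq0// powRr1//.
by rewrite -powR_inv1 ?(ltW x0)// -powRrM mulN1r mulrA.
Qed.

End RadialSequence.

(** * Separation of the frequencies *)

Section SumsOverSubsets.
Context {R : numDomainType}.

Lemma sum_uniq_subset_le (J : eqType) (s t : seq J) (F : J -> R) :
  uniq s -> {subset s <= t} -> (forall j, 0 <= F j) ->
  \sum_(j <- s) F j <= \sum_(j <- t) F j.
Proof.
move=> + + F0; elim: s t => [t _ _|x s IH t /= /andP[xs us] st].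
  by rewrite big_nil sumr_ge0.
have xt : x \in t by apply: st; rewrite mem_head.
rewrite big_cons (big_rem x xt)/= lerD2l; apply: IH => // y ys.
have [yx|yx] := eqVneq y x; first by rewrite -yx ys in xs.
have : y \in t by apply: st; rewrite inE ys orbT.
by rewrite (perm_mem (perm_to_rem xt)) inE (negbTE yx).
Qed.

Lemma sum_inj_le (I J : eqType) (s : seq I) (t : seq J) (phi : I -> J)
    (F : J -> R) : uniq s -> {in s &, injective phi} ->
  (forall i, i \in s -> phi i \in t) -> (forall j, 0 <= F j) ->
  \sum_(i <- s) F (phi i) <= \sum_(j <- t) F j.
Proof.
move=> us inj st F0; rewrite -(big_map phi xpredT F).
apply: sum_uniq_subset_le => //; first by rewrite map_inj_in_uniq.
by move=> _ /mapP[i si ->]; exact: st.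
Qed.

End SumsOverSubsets.

Section SchurSums.
Context {R : realType}.
Implicit Types (c y a b t : R).

Definition cauchy_kernel (x : R) : R := (1 + x ^+ 2)^-1.

Lemma cauchy_kernel_ge0 x : 0 <= cauchy_kernel x.
Proof. by rewrite invr_ge0 addr_ge0// sqr_ge0. Qed.

Lemma cauchy_kernel_le (x z : R) : `|x| <= `|z| -> cauchy_kernel z <= cauchy_kernel x.
Proof.
move=> xz; rewrite lef_pV2 ?posrE ?ltr_pwDl ?sqr_ge0// lerD2l.
by rewrite -(real_normK (num_real x)) -(real_normK (num_real z)) ler_sqr ?nnegrE.
Qed.

Lemma sum_cauchy_kernel a M : 0 < a ->
  \sum_(0 <= i < M) cauchy_kernel (a * i%:R) <= 1 + 2 / a ^+ 2.
Proof.
move=> a0; case: M => [|M].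
  by rewrite big_geq// addr_ge0// divr_ge0// sqr_ge0.
(* The sharper bound is what induction can carry: 1 / k^2 <= 2 (1/k - 1/(k + 1)) telescopes. *)
apply: (@le_trans _ _ (1 + 2 * (1 - M.+1%:R^-1) / a ^+ 2)).
  elim: M => [|M IH].
    by rewrite big_nat1 mulr0 /cauchy_kernel expr0n addr0 !invr1 subrr mulr0 mul0r addr0.
  rewrite big_nat_recr//= (le_trans (lerD IH (lexx _)))//.
  rewrite -addrA lerD2l -lerBrDl -mulrBl.
  have M0 : 0 < M.+1%:R :> R by rewrite ltr0n.
  have -> : 2 * (1 - M.+2%:R^-1) - 2 * (1 - M.+1%:R^-1) = 2 / (M.+1%:R * M.+2%:R) :> R.
    rewrite -[M.+2%:R]natr1; field.
    by rewrite !lt0r_neq0// ?addr_gt0.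
  apply: (@le_trans _ _ ((a ^+ 2 * M.+1%:R ^+ 2)^-1)).
    by rewrite -exprMn lef_pV2 ?posrE ?ltr_pwDl ?sqr_ge0 ?exprn_gt0 ?mulr_gt0// lerDr.
  rewrite invfM mulrC ler_wpM2r ?invr_ge0 ?sqr_ge0//.
  rewrite -div1r ler_pdivrMr ?exprn_gt0// mulrAC ler_pdivlMr ?mulr_gt0 ?ltr0n//.
  have M1 : 1 <= M.+1%:R :> R by rewrite ler1n.
  rewrite mul1r -[M.+2%:R]natr1 expr2; nra.
rewrite lerD2l ler_wpM2r ?invr_ge0 ?sqr_ge0//.
by rewrite -[leRHS]mulr1 ler_wpM2l// gerBl invr_ge0.
Qed.

(** Twice the bound of [sum_cauchy_kernel] at step c / 2, once for each side of the term nearest to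
    y. *)
Definition schur_const c : R := 2 * (1 + 8 / c ^+ 2).

(* Every term is compared with the one nearest to y. *)
Lemma sum_cauchy_kernel_separated (w : nat -> R) (P : pred nat) c y M : 0 < c ->
  (forall m n, P m -> P n -> (m <= n)%N -> c * (n%:R - m%:R) <= `|w n - w m|) ->
  \sum_(0 <= n < M | P n) cauchy_kernel (y - w n) <= schur_const c.
Proof.
move=> c0 sep.
have S0 : 0 <= schur_const c.
  by rewrite mulr_ge0// addr_ge0// divr_ge0// sqr_ge0.
rewrite big_mkord.
have [i0 Pi0|noP] := pickP (fun i : 'I_M => P i); last first.
  by rewrite big_pred0.
have [i1 Pi1 imin] := @arg_minP _ _ _ i0 (fun i : 'I_M => P i) (fun i => `|y - w i|) Pi0.
have c20 : 0 < c / 2 by rewrite divr_gt0.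
pose F (k : nat) := cauchy_kernel (c / 2 * k%:R).
have F0 k : 0 <= F k by exact: cauchy_kernel_ge0.
(* Subtraction is truncated, so (n - i1) + (i1 - n) is |n - i1|. The spacing c drops to c / 2
   because |w n - w i1| <= 2 |y - w n| when w i1 is nearest to y. *)
have bound (n : 'I_M) : P n -> cauchy_kernel (y - w n) <= F ((n - i1) + (i1 - n))%N.
  move=> Pn; apply: cauchy_kernel_le.
  rewrite ger0_norm; last by rewrite mulr_ge0 ?(ltW c20).
  have tri : `|w n - w i1| <= 2 * `|y - w n|.
    have -> : w n - w i1 = (y - w i1) - (y - w n) by ring.
    apply: (le_trans (ler_normB _ _)); have := imin _ Pn; lra.
  have [ni|/ltnW ni] := leqP n i1.
    have := sep _ _ Pn Pi1 ni; rewrite distrC => h.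
    rewrite (eqP ni : (n - i1 = 0)%N) add0n natrB//.
    lra.
  have := sep _ _ Pi1 Pn ni => h.
  rewrite (eqP ni : (i1 - n = 0)%N) addn0 natrB//.
  lra.
apply: (le_trans (ler_sum _ bound)).
apply: (@le_trans _ _ (\sum_(n < M) F ((n - i1) + (i1 - n))%N)).
  by rewrite [leRHS](bigID (fun i : 'I_M => P i))/= lerDl sumr_ge0.
rewrite (bigID (fun n : 'I_M => (i1 <= n)%N))/=.
have half (Q : pred nat) (phi : nat -> nat) :
    (forall n m, Q n -> Q m -> phi n = phi m -> n = m) ->
    (forall n, Q n -> (n < M)%N -> (phi n < M)%N) ->
    \sum_(n < M | Q n) F (phi n) <= 1 + 8 / c ^+ 2.
  move=> inj lt; rewrite -(big_mkord Q (fun n => F (phi n))) -big_filter.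
  apply: (@le_trans _ _ (\sum_(0 <= k < M) F k)).
    apply: sum_inj_le => //.
    - by rewrite filter_uniq// iota_uniq.
    - by move=> n m; rewrite !mem_filter => /andP[Qn _] /andP[Qm _]; exact: inj.
    - move=> n; rewrite mem_filter !mem_index_iota !leq0n/= => /andP[Qn]; exact: lt.
  apply: (le_trans (sum_cauchy_kernel M c20)).
  rewrite lerD2l exprMn exprVn le_eqVlt; apply/orP; left; apply/eqP.
  by field; exact: lt0r_neq0.
rewrite /schur_const mulr2n mulrDl mul1r; apply: lerD.
- apply: (half (fun n => i1 <= n)%N (fun n => (n - i1) + (i1 - n))%N) => n; lia.
- apply: (half (fun n => ~~ (i1 <= n))%N (fun n => (n - i1) + (i1 - n))%N) => n; have := ltn_ord i1; lia.
Qed.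

(** The difference of the roots is (a - b) (a + b) divided by their sum, and t <= b <= a bounds the
    roots by 2 a and 2 b. Thus moving the larger leg moves the hypotenuse at least half as much. *)
Lemma hypot_separated a b t : 0 <= t -> t <= b -> b <= a ->
  (a - b) / 2 <= Num.sqrt (a ^+ 2 + t ^+ 2) - Num.sqrt (b ^+ 2 + t ^+ 2).
Proof.
move=> t0 tb ba.
have [ab|] := ltP b a; last first.
  move=> ab; have -> : a = b by apply/eqP; rewrite eq_le ab ba.
  by rewrite !subrr mul0r.
have sum2 x : t <= x -> Num.sqrt (x ^+ 2 + t ^+ 2) <= 2 * x.
  move=> tx; have x0 : 0 <= x := le_trans t0 tx.
  rewrite -[leRHS]ger0_norm ?mulr_ge0// -sqrtr_sqr ler_sqrt ?sqr_ge0//.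
  nra.
have h1 := sum2 _ tb; have h2 := sum2 _ (le_trans tb ba).
have A2 := sqr_sqrtr (addr_ge0 (sqr_ge0 a) (sqr_ge0 t)).
have B2 := sqr_sqrtr (addr_ge0 (sqr_ge0 b) (sqr_ge0 t)).
have A0 : 0 < Num.sqrt (a ^+ 2 + t ^+ 2).
  by rewrite sqrtr_gt0 ltr_wpDr ?sqr_ge0// exprn_gt0//; lra.
have B0 := sqrtr_ge0 (b ^+ 2 + t ^+ 2).
move: (Num.sqrt (a ^+ 2 + _)) (Num.sqrt (b ^+ 2 + _)) A2 B2 A0 B0 h1 h2 => A B A2 B2 A0 B0 h1 h2.
rewrite leNgt; apply/negP => h.
have : (A - B) * (A + B) < (a - b) / 2 * (A + B) by rewrite ltr_pM2r// ltr_pwDl.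
have -> : (A - B) * (A + B) = (a - b) * (a + b).
  by transitivity (A ^+ 2 - B ^+ 2); [ring|rewrite A2 B2; ring].
have : (a - b) / 2 * (A + B) <= (a - b) / 2 * (2 * (a + b)).
  by rewrite ler_wpM2l ?divr_ge0 ?subr_ge0//; lra.
lra.
Qed.

End SchurSums.

Definition int_box (M : nat) : seq int :=
  [seq Posz i | i <- iota 0 M] ++ [seq Negz i | i <- iota 0 M].

Definition freq_box (M : nat) : seq (nat * int) :=
  [seq (n, k) | n <- iota 0 M, k <- int_box M].

Lemma mem_int_box M (k : int) : (`|k| < M)%N -> k \in int_box M.
Proof.
case: k => k /= kM; rewrite mem_cat; apply/orP; [left|right]; apply: map_f;
  rewrite mem_iota/= add0n //; lia.
Qed.

(** * Counting and separating the frequencies *)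

Section FrequencyCount.
Context {R : realType}.
Variables (lam : nat -> R) (c : R).
Hypotheses (c0 : 0 < c) (c1 : c <= 1) (lam_gt0 : forall n, 0 < lam n).
Hypothesis gap : forall m n, (m <= n)%N -> c * (n%:R - m%:R) <= lam n - lam m.

Lemma freqE n (k : int) :
  freq lam (n, k) = Num.sqrt (lam n ^+ 2 + (2 * pi * `|k|%N%:R) ^+ 2).
Proof.
rewrite /freq/= !exprMn; congr (Num.sqrt (_ + _ * _)).
by rewrite -(real_normK (num_real (k%:~R : R))) -intr_norm -abszE.
Qed.

Lemma ge2pi : 2 <= 2 * pi :> R.
Proof. by have := pi_ge2 R; lra. Qed.

Lemma freq_ge_lam n k : lam n <= freq lam (n, k).
Proof.
rewrite /freq/= -[leLHS]ger0_norm ?(ltW (lam_gt0 n))// -sqrtr_sqr.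
by rewrite ler_sqrt ?addr_ge0 ?sqr_ge0// lerDl sqr_ge0.
Qed.

Lemma freq_ge_abs n (k : int) : `|k|%N%:R <= freq lam (n, k).
Proof.
rewrite freqE; apply: (@le_trans _ _ (2 * pi * `|k|%N%:R)).
  by rewrite ler_peMl//; have := ge2pi; lra.
have p0 : 0 <= 2 * pi * `|k|%N%:R :> R by rewrite mulr_ge0// (le_trans _ ge2pi).
by rewrite -{1}(ger0_norm p0) -sqrtr_sqr ler_sqrt ?addr_ge0 ?sqr_ge0// lerDr sqr_ge0.
Qed.

Definition box_size (N : R) : nat := (Num.trunc (N / c)).+1.

Lemma box_size_le N : 1 <= N -> (box_size N)%:R <= 2 / c * N.
Proof.
move=> N1; have N0 : 0 <= N by exact: le_trans N1.
rewrite /box_size -natr1.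
have : (Num.trunc (N / c))%:R <= N / c by rewrite truncn_le divr_ge0// ltW.
have : 1 <= N / c by rewrite ler_pdivlMr// mul1r (le_trans c1).
rewrite -mulrA [c^-1 * N]mulrC; lra.
Qed.

Lemma lt_box_size N x : 0 <= N -> x * c <= N -> x < (box_size N)%:R.
Proof.
move=> N0; rewrite -ler_pdivlMr// => h; apply: (le_lt_trans h).
by rewrite /box_size truncnS_gt.
Qed.

(** Both c n < lam n <= z and c |n'| <= |n'| <= z hold, so n and |n'| are at most N / c. *)
Lemma mem_freq_box N j : 0 <= N -> freq lam j <= N -> j \in freq_box (box_size N).
Proof.
case: j => n k N0 h; apply: allpairs_f.
- rewrite mem_iota/= add0n -(ltr_nat R) lt_box_size//.
  have h1 := gap (leq0n n); have h2 := freq_ge_lam n k; have h3 := lam_gt0 0.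
  rewrite subr0 mulrC in h1; lra.
- apply: mem_int_box; rewrite -(ltr_nat R) lt_box_size//.
  apply: le_trans h; apply: le_trans (freq_ge_abs n k).
  by rewrite -[leRHS]mulr1 ler_wpM2l.
Qed.

Lemma freq_count N (s : seq (nat * int)) : uniq s -> 1 <= N ->
  (forall j, j \in s -> freq lam j <= N) ->
  (size s)%:R <= 2 * (2 / c) ^+ 2 * N ^+ 2.
Proof.
move=> us N1 sN; have N0 : 0 <= N by exact: le_trans N1.
have : (size s <= size (freq_box (box_size N)))%N.
  by apply: uniq_leq_size => // j /sN; exact: mem_freq_box.
rewrite size_allpairs size_cat !size_map size_iota -(ler_nat R) => h.
apply: (le_trans h); rewrite natrM natrD.
have := box_size_le N1; have : 0 <= (box_size N)%:R :> R by [].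
set M := _%:R; set B := 2 / c * N => M0 MB.
rewrite -[2 * _ * _]mulrA -exprMn -/B.
nra.
Qed.

(** The box is cut according to which leg of z is longer. Where lam_n is, n varies for fixed n':
    each of the 2 M values of n' contributes at most S. Elsewhere n' varies for fixed n, over each
    sign separately since z is even in n': each of the M values of n contributes at most 2 S. The
    total 4 S M is linear in N. *)
Lemma freq_schur N (s : seq (nat * int)) y : uniq s -> 1 <= N ->
  (forall j, j \in s -> freq lam j <= N) ->
  \sum_(j <- s) cauchy_kernel (y - freq lam j) <= 4 * schur_const (c / 2) * (2 / c) * N.
Proof.
move=> us N1 sN; have N0 : 0 <= N by exact: le_trans N1.
set M := box_size N; set S := schur_const (c / 2).
have S0 : 0 <= S by rewrite mulr_ge0// addr_ge0// divr_ge0// sqr_ge0.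
have c20 : 0 < c / 2 by rewrite divr_gt0.
apply: (@le_trans _ _ (\sum_(j <- freq_box M) cauchy_kernel (y - freq lam j))).
  apply: sum_uniq_subset_le => //; last by move=> j; exact: cauchy_kernel_ge0.
  by move=> j /sN; exact: mem_freq_box.
rewrite big_allpairs_dep.
apply: (@le_trans _ _ (4 * S * M%:R)); last first.
  have h := box_size_le N1.
  by rewrite -[leRHS]mulrA ler_wpM2l//; rewrite mulr_ge0.
pose A (n : nat) (k : int) := 2 * pi * `|k|%N%:R <= lam n.
rewrite (eq_bigr (fun n => \sum_(k <- int_box M | A n k) cauchy_kernel (y - freq lam (n, k))
   + \sum_(k <- int_box M | ~~ A n k) cauchy_kernel (y - freq lam (n, k)))); last first.
  by move=> n _; rewrite (bigID (A n)).
rewrite big_split (_ : 4 * S * M%:R = 2 * S * M%:R + 2 * S * M%:R); last by ring.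
apply: lerD.
  rewrite (exchange_big_dep xpredT)//.
  have hk k : \sum_(n <- iota 0 M | A n k) cauchy_kernel (y - freq lam (n, k)) <= S.
    have := @sum_cauchy_kernel_separated _ (fun n => freq lam (n, k)) (A ^~ k) _ y M c20.
    rewrite /index_iota subn0; apply => m n Am An mn.
    have lmn : lam m <= lam n.
      by rewrite -subr_ge0 (le_trans _ (gap mn))// mulr_ge0 ?(ltW c0)// subr_ge0 ler_nat.
    have p0 : 0 <= 2 * pi * `|k|%N%:R :> R by rewrite mulr_ge0// (le_trans _ ge2pi).
    have := hypot_separated p0 Am lmn; rewrite -!freqE => h.
    apply: (le_trans _ (ler_norm _)); apply: (le_trans _ h).
    by rewrite mulrAC ler_wpM2r// gap.
  apply: (@le_trans _ _ (\sum_(k <- int_box M) S)).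
    by apply: ler_sum => k _; exact: hk.
  rewrite big_const_seq count_predT size_cat !size_map size_iota iter_addr addr0 -[leLHS]mulr_natr.
  by rewrite natrD le_eqVlt; apply/orP; left; apply/eqP; ring.
have hn n : \sum_(k <- int_box M | ~~ A n k) cauchy_kernel (y - freq lam (n, k)) <= 2 * S.
  (* The shift b is 0 for [Posz] and 1 for [Negz], as |Negz i| = i + 1. *)
  have half (b : nat) (f : nat -> int) : (forall i, `|f i|%N = (i + b)%N) ->
      \sum_(k <- [seq f i | i <- iota 0 M] | ~~ A n k) cauchy_kernel (y - freq lam (n, k)) <= S.
    move=> fE; rewrite big_map.
    have := @sum_cauchy_kernel_separated _ (fun i => freq lam (n, f i)) (fun i => ~~ A n (f i)) _ y M c20.
    rewrite /index_iota subn0; apply => i j Ai Aj ij.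
    have pi2 := ge2pi.
    have lij : 2 * pi * `|f i|%N%:R <= 2 * pi * `|f j|%N%:R :> R.
      by rewrite !fE ler_wpM2l ?ler_nat ?leq_add2r//; lra.
    have Ai' : lam n <= 2 * pi * `|f i|%N%:R by rewrite ltW// ltNge.
    have := hypot_separated (ltW (lam_gt0 n)) Ai' lij.
    rewrite ![_ ^+ 2 + lam n ^+ 2]addrC -!freqE => h.
    apply: (le_trans _ (ler_norm _)); apply: (le_trans _ h).
    have -> : (2 * pi * `|f j|%N%:R - 2 * pi * `|f i|%N%:R) / 2 = 2 * pi / 2 * (j%:R - i%:R) :> R.
      by rewrite !fE !natrD; field.
    by rewrite ler_wpM2r ?subr_ge0 ?ler_nat// ler_wpM2r// (le_trans c1)// (le_trans _ pi2)// ler1n.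
  rewrite big_cat/= (_ : 2 = 1 + 1 :> R)// mulrDl mul1r; apply: lerD.
  - by apply: (half 0) => i; rewrite addn0.
  - by apply: (half 1%N) => i; rewrite addn1.
apply: (@le_trans _ _ (\sum_(n <- iota 0 M) (2 * S))).
  by apply: ler_sum => n _; exact: hn.
by rewrite big_const_seq count_predT size_iota iter_addr addr0 -[leLHS]mulr_natr.
Qed.

End FrequencyCount.

(** * Trigonometric sums *)

Section ComplexModulus.
Context {R : realType}.
Local Notation normc := Normc.normc.
Implicit Types z w : R[i].

Lemma Re_sum (J : Type) (s : seq J) (f : J -> R[i]) :
  complex.Re (\sum_(j <- s) f j) = \sum_(j <- s) complex.Re (f j).
Proof. by apply: (big_morph (@complex.Re R)) => // -[a b] [c d]. Qed.

Lemma Im_sum (J : Type) (s : seq J) (f : J -> R[i]) :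
  complex.Im (\sum_(j <- s) f j) = \sum_(j <- s) complex.Im (f j).
Proof. by apply: (big_morph (@complex.Im R)) => // -[a b] [c d]. Qed.

Lemma sqr_normcE z : normc z ^+ 2 = complex.Re z ^+ 2 + complex.Im z ^+ 2.
Proof. by case: z => a b /=; rewrite sqr_sqrtr// addr_ge0 ?sqr_ge0. Qed.

Lemma normc_ge0 z : 0 <= normc z.
Proof. by case: z => a b; exact: sqrtr_ge0. Qed.

Lemma normcD_le z w : normc (z + w) <= normc z + normc w.
Proof. by have := ler_normD z w; rewrite !normc_def -rmorphD/= lecR; case: z w => [a b] [c d]. Qed.

Lemma normc_sum_le (J : Type) (s : seq J) (f : J -> R[i]) :
  normc (\sum_(j <- s) f j) <= \sum_(j <- s) normc (f j).
Proof.
elim: s => [|j s IH]; first by rewrite !big_nil Normc.normc0.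
by rewrite !big_cons (le_trans (normcD_le _ _))// lerD2l.
Qed.

Lemma normc_cis (t : R) : normc (cis t) = 1.
Proof. by rewrite /cis /= cos2Dsin2 sqrtr1. Qed.

Lemma cisD (t u : R) : cis (t + u) = cis t * cis u.
Proof. by rewrite /cis cosD sinD; apply/eqP; rewrite eq_complex/= eqxx/= addrC eqxx. Qed.

Lemma cauchy_schwarz_sum (J : Type) (s : seq J) (f : J -> R) :
  (\sum_(j <- s) f j) ^+ 2 <= (size s)%:R * \sum_(j <- s) f j ^+ 2.
Proof.
elim: s => [|j s IH]; first by rewrite !big_nil expr0n mulr0.
rewrite !big_cons /= -natr1 mulrDl mul1r.
set S := \sum_(i <- s) _ in IH *; set Q := \sum_(i <- s) _ in IH *.
have n0 : 0 <= (size s)%:R :> R by [].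
have cross : 2 * f j * S <= (size s)%:R * f j ^+ 2 + Q.
  have [s0|s0] := eqVneq (size s) 0%N.
    by rewrite /S /Q (size0nil s0) !big_nil !mulr0 mul0r addr0.
  have np : 0 < (size s)%:R :> R by rewrite ltr0n lt0n.
  rewrite -(ler_pM2l np); have := sqr_ge0 ((size s)%:R * f j - S); nra.
nra.
Qed.

End ComplexModulus.

Section TrigonometricSums.
Context {R : realType}.
Local Notation mu1 := (@lebesgue_measure R).
Local Notation normc := Normc.normc.
Implicit Types (d p q t B : R).

Lemma is_derive_cos_lin d t : is_derive t 1 (fun t => cos (d * t)) (- sin (d * t) * d).
Proof.
have hd : is_derive t 1 (fun t => d * t) d by isd_eq; [isd|rewrite /=; ring].
exact: (is_derive_compf hd (is_derive_cos _)).
Qed.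

Lemma is_derive_sin_lin d t : is_derive t 1 (fun t => sin (d * t)) (cos (d * t) * d).
Proof.
have hd : is_derive t 1 (fun t => d * t) d by isd_eq; [isd|rewrite /=; ring].
exact: (is_derive_compf hd (is_derive_sin _)).
Qed.

(* Explicit primitive of (4 - t^2) (p cos (d t) + q sin (d t)). *)
Definition trig_primitive d p q t : R :=
  p * ((4 - t ^+ 2) * sin (d * t) / d - 2 * t * cos (d * t) / d ^+ 2
       + 2 * sin (d * t) / d ^+ 3)
  + q * (- ((4 - t ^+ 2) * cos (d * t) / d) - 2 * t * sin (d * t) / d ^+ 2
       - 2 * cos (d * t) / d ^+ 3).

Lemma is_derive_trig_primitive d p q t : d != 0 ->
  is_derive t 1 (trig_primitive d p q)
    ((4 - t ^+ 2) * (p * cos (d * t) + q * sin (d * t))).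
Proof.
move=> d0.
have hs := is_derive_sin_lin d t; have hc := is_derive_cos_lin d t.
isd_eq; first by rewrite /trig_primitive; isd.
by rewrite /=; field.
Qed.

(** The weight vanishes at both ends, which removes the terms of order 1/d, and the odd part in q
    integrates to 0. What is left is at most 12 B / d^2, and 1 + d^2 <= 2 d^2 turns 12 into 24. *)
Lemma trig_primitive_bound d p q B : 1 <= `|d| -> `|p| <= B ->
  trig_primitive d p q 2 - trig_primitive d p q (- 2) <= 24 * B * cauchy_kernel d.
Proof.
move=> d1 pB.
have d0 : d != 0 by rewrite -normr_gt0 (lt_le_trans _ d1).
have B0 : 0 <= B := le_trans (normr_ge0 p) pB.
have -> : trig_primitive d p q 2 - trig_primitive d p q (- 2) =
    p * (4 * (sin (d * 2) / d - 2 * cos (d * 2))) / d ^+ 2.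
  rewrite /trig_primitive mulrN sinN cosN; field.
  exact: d0.
have ds : `|sin (d * 2) / d| <= 1.
  rewrite normrM normfV ler_pdivrMr ?normr_gt0// mul1r (le_trans _ d1)//.
  by rewrite ler_norml sin_geN1 sin_le1.
have dc : `|cos (d * 2)| <= 1 by rewrite ler_norml cos_geN1 cos_le1.
have h : `|4 * (sin (d * 2) / d - 2 * cos (d * 2))| <= 12.
  rewrite normrM ger0_norm//; have := ler_normB (sin (d * 2) / d) (2 * cos (d * 2)).
  have -> : `|2 * cos (d * 2)| = 2 * `|cos (d * 2)| by rewrite normrM ger0_norm.
  lra.
apply: (@le_trans _ _ (B * 12 / d ^+ 2)).
  rewrite ler_wpM2r ?invr_ge0 ?sqr_ge0// (le_trans (ler_norm _))// normrM.
  by rewrite ler_pM.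
rewrite /cauchy_kernel.
have d2 : 1 <= d ^+ 2 by rewrite -(real_normK (num_real d)) expr_ge1.
have d20 : 0 < d ^+ 2 by exact: lt_le_trans d2.
have D0 : 0 < 1 + d ^+ 2 by rewrite ltr_pwDl// ltW.
rewrite ler_pdivrMr// -[24 * B * _ * _]mulrA [_^-1 * _]mulrC mulrA ler_pdivlMr//.
nra.
Qed.

(** The weight 4 - t^2 has integral 32/3 over [-2, 2], and for |d| < 1 the kernel exceeds 1/2; the
    constant 24 then agrees with that for |d| >= 1. *)
Lemma integral_weight_bound d B : `|d| < 1 -> 0 <= B ->
  B * (4 * 2 - 2 ^+ 3 / 3) - B * (4 * (- 2) - (- 2) ^+ 3 / 3) <= 24 * B * cauchy_kernel d.
Proof.
move=> d1 B0.
have -> : B * (4 * 2 - 2 ^+ 3 / 3) - B * (4 * (- 2) - (- 2) ^+ 3 / 3) = 32 / 3 * B :> R by field.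
have d2 : d ^+ 2 < 1 by rewrite -(real_normK (num_real d)) expr_lt1.
have D0 : 0 < 1 + d ^+ 2 by rewrite ltr_pwDl// sqr_ge0.
rewrite /cauchy_kernel ler_pdivlMr//.
have d0 := sqr_ge0 d.
nra.
Qed.

Section Sum.
Variables (J : eqType) (s : seq J) (b : J -> R[i]) (z : J -> R).

Definition trig_sum t : R[i] := \sum_(j <- s) b j * cis (- (z j * t)).

(** Here p + i q is b_j times the conjugate of b_k, so p cos + q sin is the real part of one term of
    the expanded square. *)
Let p j k := complex.Re (b j) * complex.Re (b k) + complex.Im (b j) * complex.Im (b k).
Let q j k := complex.Im (b j) * complex.Re (b k) - complex.Re (b j) * complex.Im (b k).

Lemma sqr_normc_trig_sum t : normc (trig_sum t) ^+ 2 =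
  \sum_(j <- s) \sum_(k <- s)
    (p j k * cos ((z j - z k) * t) + q j k * sin ((z j - z k) * t)).
Proof.
rewrite sqr_normcE Re_sum Im_sum !expr2 !mulr_suml -big_split/=.
apply: eq_bigr => j _; rewrite !mulr_sumr -big_split/=; apply: eq_bigr => k _.
rewrite mulrBl cosB sinB /cis !cosN !sinN /p /q.
by case: (b j) (b k) => [a1 a2] [b1 b2] /=; ring.
Qed.

Lemma trig_coef_le j k t : p j k * cos t + q j k * sin t <= normc (b j) * normc (b k).
Proof.
rewrite -Normc.normcM -[normc _]ger0_norm ?normc_ge0//.
apply: le_trans (ler_norm _) _.
rewrite -ler_sqr ?nnegrE// !real_normK ?num_real// sqr_normcE.
have := cos2Dsin2 t.
have := sqr_ge0 (p j k * sin t - q j k * cos t).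
rewrite /p /q; case: (b j) (b k) => [a1 a2] [b1 b2] /=.
move=> h1 h2.
set P := a1 * b1 + a2 * b2 in h1 *; set Q := a2 * b1 - a1 * b2 in h1 *.
have -> : (a1 * b1 - a2 * b2) ^+ 2 + (a1 * b2 + a2 * b1) ^+ 2 = P ^+ 2 + Q ^+ 2.
  by rewrite /P /Q; ring.
have -> : P ^+ 2 + Q ^+ 2 = (P ^+ 2 + Q ^+ 2) * (cos t ^+ 2 + sin t ^+ 2) by rewrite h2 mulr1.
by rewrite -subr_ge0; apply: le_trans h1 _; rewrite le_eqVlt; apply/orP; left; apply/eqP; ring.
Qed.

(** The times 0 and pi turn the preceding bound into one for p and one for - p. *)
Lemma trig_coef_abs j k : `|p j k| <= normc (b j) * normc (b k).
Proof.
have h0 := trig_coef_le j k 0; have hpi := trig_coef_le j k pi.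
rewrite cos0 sin0 mulr0 addr0 mulr1 in h0.
rewrite cospi sinpi mulr0 addr0 mulrN1 in hpi.
by rewrite ler_norml lerNl hpi.
Qed.

Let B j k := normc (b j) * normc (b k).

Lemma trig_coef_ge0 j k : 0 <= B j k.
Proof. by rewrite mulr_ge0 ?normc_ge0. Qed.

(* For close frequencies the trigonometric factor is replaced by its maximum, so
   that the weighted integral has an explicit primitive in all cases. *)
Let g j k t := (4 - t ^+ 2) *
  (if 1 <= `|z j - z k|
   then p j k * cos ((z j - z k) * t) + q j k * sin ((z j - z k) * t)
   else B j k).

Let P j k t := if 1 <= `|z j - z k| then trig_primitive (z j - z k) (p j k) (q j k) t
  else B j k * (4 * t - t ^+ 3 / 3).

Lemma is_derive_trig_majorant j k t : is_derive t 1 (P j k) (g j k t).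
Proof.
rewrite /P /g; case: ifPn => [d1|_].
  by apply: is_derive_trig_primitive; rewrite -normr_gt0 (lt_le_trans _ d1).
by isd_eq; [isd|rewrite /=; field].
Qed.

Lemma trig_majorant_continuous j k t : exists dg, is_derive t 1 (g j k) dg.
Proof.
have hc := is_derive_cos_lin (z j - z k) t; have hs := is_derive_sin_lin (z j - z k) t.
by rewrite /g; case: (1 <= `|z j - z k|); eexists; isd.
Qed.

Lemma trig_majorant_ge j k t : t ^+ 2 <= 4 ->
  (4 - t ^+ 2) * (p j k * cos ((z j - z k) * t) + q j k * sin ((z j - z k) * t)) <= g j k t.
Proof.
by move=> t4; rewrite ler_wpM2l ?subr_ge0//; case: ifPn => // _; exact: trig_coef_le.
Qed.

Lemma trig_majorant_integral j k :
  P j k 2 - P j k (- 2) <= 24 * B j k * cauchy_kernel (z j - z k).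
Proof.
rewrite /P; case: ifPn => [d1|]; first exact: trig_primitive_bound d1 (trig_coef_abs j k).
by rewrite -ltNge => d1; apply: integral_weight_bound => //; exact: trig_coef_ge0.
Qed.

(** Schur's test for a symmetric kernel: 2 |b_j| |b_k| <= |b_j|^2 + |b_k|^2, and the two resulting
    double sums coincide by symmetry. *)
Lemma sum_schur (K : R) :
  (forall j, j \in s -> \sum_(k <- s) cauchy_kernel (z j - z k) <= K) ->
  \sum_(j <- s) \sum_(k <- s) B j k * cauchy_kernel (z j - z k) <=
  K * \sum_(j <- s) normc (b j) ^+ 2.
Proof.
move=> sK.
have symm j k : cauchy_kernel (z j - z k) = cauchy_kernel (z k - z j).
  by rewrite /cauchy_kernel -opprB sqrrN.
pose T := \sum_(j <- s) \sum_(k <- s) normc (b j) ^+ 2 * cauchy_kernel (z j - z k).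
have TK : T <= K * \sum_(j <- s) normc (b j) ^+ 2.
  rewrite mulr_sumr /T !big_seq; apply: ler_sum => j js.
  by rewrite -mulr_sumr mulrC ler_wpM2r ?sqr_ge0// sK.
apply: le_trans TK; rewrite -(@ler_pM2l _ 2)//.
have -> : 2 * T = T + \sum_(j <- s) \sum_(k <- s) normc (b k) ^+ 2 * cauchy_kernel (z j - z k).
  rewrite exchange_big/= mulr_natl mulr2n; congr (_ + _).
  by apply: eq_bigr => j _; apply: eq_bigr => k _; rewrite symm.
rewrite /T -big_split/= mulr_sumr; apply: ler_sum => j _.
rewrite -big_split/= mulr_sumr; apply: ler_sum => k _.
rewrite -mulrDl mulrA ler_wpM2r ?cauchy_kernel_ge0// /B.
have := sqr_ge0 (normc (b j) - normc (b k)); lra.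
Qed.

Lemma is_derive_sumf (S : seq J) (f df : J -> R -> R) t :
  (forall j, is_derive t 1 (f j) (df j t)) ->
  is_derive t 1 (fun t => \sum_(j <- S) f j t) (\sum_(j <- S) df j t).
Proof.
move=> h; elim: S => [|j S IH].
  rewrite big_nil (_ : (fun _ => _) = fun=> 0); last by apply/funext => u; rewrite big_nil.
  by isd.
rewrite big_cons (_ : (fun _ => _) = fun u => f j u + \sum_(j <- S) f j u).
  by isd.
by apply/funext => u; rewrite big_cons.
Qed.

Lemma continuous_sumf (S : seq J) (f : J -> R -> R) :
  (forall j t, {for t, continuous (f j)}) ->
  continuous (fun t => \sum_(j <- S) f j t).
Proof.
move=> h; elim: S => [|j S IH] t.
  rewrite (_ : (fun _ => _) = fun=> 0); last by apply/funext => u; rewrite big_nil.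
  exact: cvg_cst.
rewrite (_ : (fun _ => _) = fun u => f j u + \sum_(j <- S) f j u).
  by apply: cvgD; [exact: h|exact: IH].
by apply/funext => u; rewrite big_cons.
Qed.

Lemma continuous_sqr_normc_trig_sum : continuous (fun t => normc (trig_sum t) ^+ 2).
Proof.
rewrite (_ : (fun _ => _) = (fun t => \sum_(j <- s) \sum_(k <- s)
  (p j k * cos ((z j - z k) * t) + q j k * sin ((z j - z k) * t)))); last first.
  by apply/funext => t; rewrite sqr_normc_trig_sum.
apply: continuous_sumf => j; apply: continuous_sumf => k t.
have hc := is_derive_cos_lin (z j - z k) t; have hs := is_derive_sin_lin (z j - z k) t.
by eapply is_derive_continuous; isd.
Qed.

Lemma trig_sum_L2_centered (K : R) t0 :
  (forall j, j \in s -> \sum_(k <- s) cauchy_kernel (z j - z k) <= K) ->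
  (\int[mu1]_(t in `[(t0 - 1)%R, (t0 + 1)%R]) (normc (trig_sum (t - t0)) ^+ 2)%:E <=
   (8 * K * \sum_(j <- s) normc (b j) ^+ 2)%:E)%E.
Proof.
(* The factor 1/3 reflects 4 - t^2 >= 3 for |t| <= 1, and 24 / 3 = 8 is the constant obtained. The
   majorant is nonnegative on the whole interval of radius 2, so the smaller interval may be
   enlarged to it. *)
move=> sK; pose gg t := 3^-1 * \sum_(j <- s) \sum_(k <- s) g j k (t - t0).
pose PP t := 3^-1 * \sum_(j <- s) \sum_(k <- s) P j k (t - t0).
have hshift t : is_derive t 1 (fun t => t - t0) 1.
  by isd_eq; [isd|rewrite /=; ring].
have dPP t : is_derive t 1 PP (gg t).
  isd_eq.
    notypeclasses refine (is_derive_mulf _ _); first by isd.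
    apply: (@is_derive_sumf s (fun j t => \sum_(k <- s) P j k (t - t0))
      (fun j t => \sum_(k <- s) g j k (t - t0))) => j.
    apply: (@is_derive_sumf s (fun k t => P j k (t - t0)) (fun k t => g j k (t - t0))) => k.
    isd_eq; first exact: (is_derive_compf (hshift t) (is_derive_trig_majorant j k _)).
    by rewrite mulr1.
  by rewrite /= mul0r add0r.
have cgg : continuous gg.
  move=> t; apply: cvgM; first exact: cvg_cst.
  move: t; apply: continuous_sumf => j; apply: continuous_sumf => k t.
  have [dg h] := trig_majorant_continuous j k (t - t0).
  exact: is_derive_continuous (is_derive_compf (hshift t) h).
have FTC : (\int[mu1]_(t in `[(t0 - 2)%R, (t0 + 2)%R]) (gg t)%:E = (PP (t0 + 2) - PP (t0 - 2))%:E)%E.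
  apply: integral_is_derive => //; first by lra.
  exact: continuous_subspaceT.
have sqr_le t : t0 - 2 <= t <= t0 + 2 -> (t - t0) ^+ 2 <= 4.
  by move=> /andP[h1 h2]; nra.
have gg_ge t : t0 - 2 <= t <= t0 + 2 ->
    (4 - (t - t0) ^+ 2) * normc (trig_sum (t - t0)) ^+ 2 <= 3 * gg t.
  move=> /sqr_le t4.
  rewrite /gg mulrA mulfV// mul1r sqr_normc_trig_sum mulr_sumr; apply: ler_sum => j _.
  by rewrite mulr_sumr; apply: ler_sum => k _; exact: trig_majorant_ge.
have gg0 t : t0 - 2 <= t <= t0 + 2 -> 0 <= gg t.
  move=> ht; rewrite -(@pmulr_rge0 _ 3)//; apply: le_trans (gg_ge _ ht).
  by rewrite mulr_ge0 ?sqr_ge0// subr_ge0 sqr_le.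
have mgg (D : set R) : measurable_fun D (fun t => (gg t)%:E).
  apply: measurable_funTS; apply/measurable_EFinP.
  exact: continuous_measurable_fun.
apply: (@le_trans _ _ (\int[mu1]_(t in `[(t0 - 2)%R, (t0 + 2)%R]) (gg t)%:E)%E); last first.
  rewrite FTC lee_fin /PP -mulrBr.
  rewrite (_ : t0 + 2 - t0 = 2); last by ring.
  rewrite (_ : t0 - 2 - t0 = - 2); last by ring.
  rewrite -sumrB (_ : 8 * K = 3^-1 * (24 * K)); last by field.
  rewrite -[leRHS]mulrA ler_wpM2l//.
  have -> : 24 * K * \sum_(j <- s) normc (b j) ^+ 2 = 24 * (K * \sum_(j <- s) normc (b j) ^+ 2) by rewrite mulrA.
  apply: (@le_trans _ _ (24 * \sum_(j <- s) \sum_(k <- s) B j k * cauchy_kernel (z j - z k))); last first.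
    by rewrite ler_wpM2l// sum_schur.
  rewrite mulr_sumr; apply: ler_sum => j _; rewrite mulr_sumr -sumrB; apply: ler_sum => k _.
  by rewrite mulrA trig_majorant_integral.
apply: (@le_trans _ _ (\int[mu1]_(t in `[(t0 - 1)%R, (t0 + 1)%R]) (gg t)%:E)%E); last first.
  apply: ge0_subset_integral => //; first exact: mgg.
  by apply: subset_itv; rewrite bnd_simp; lra.
apply: ge0_le_integral => //.
- by move=> t _; rewrite lee_fin sqr_ge0.
- apply: measurable_funTS; apply/measurable_EFinP; apply: continuous_measurable_fun => t.
  apply: (@continuous_comp R R R (fun t => t - t0) (fun u => normc (trig_sum u) ^+ 2)).
    exact: is_derive_continuous (hshift t).
  exact: continuous_sqr_normc_trig_sum.
- exact: mgg.
- move=> t /=; rewrite in_itv/= => /andP[h1 h2]; rewrite lee_fin.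
  rewrite -(@ler_pM2l _ 3)//; apply: le_trans (gg_ge _ _); last by apply/andP; split; lra.
  rewrite ler_wpM2r ?sqr_ge0//.
  nra.
Qed.

End Sum.

(** A translation in time only multiplies the coefficients by unimodular factors, so the centred
    bound holds around any t0. *)
Lemma trig_sum_shift (J : eqType) (s : seq J) (b : J -> R[i]) (z : J -> R) t0 t :
  trig_sum s b z t = trig_sum s (fun j => b j * cis (- (z j * t0))) z (t - t0).
Proof.
apply: eq_bigr => j _; rewrite -mulrA -cisD; congr (_ * cis _); ring.
Qed.

Lemma trig_sum_L2 (J : eqType) (s : seq J) (b : J -> R[i]) (z : J -> R) (K : R) t0 :
  (forall j, j \in s -> \sum_(k <- s) cauchy_kernel (z j - z k) <= K) ->
  (\int[mu1]_(t in `[(t0 - 1)%R, (t0 + 1)%R]) (normc (trig_sum s b z t) ^+ 2)%:E <=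
   (8 * K * \sum_(j <- s) normc (b j) ^+ 2)%:E)%E.
Proof.
move=> sK; under eq_integral do rewrite (trig_sum_shift _ _ _ t0).
apply: le_trans (trig_sum_L2_centered _ _ sK) _.
rewrite lee_fin le_eqVlt; apply/orP; left; apply/eqP; congr (_ * _).
by apply: eq_bigr => j _; rewrite Normc.normcM normc_cis mulr1.
Qed.

Lemma trig_sum_sup (J : eqType) (s : seq J) (b : J -> R[i]) (z : J -> R) t :
  normc (trig_sum s b z t) ^+ 2 <= (size s)%:R * \sum_(j <- s) normc (b j) ^+ 2.
Proof.
apply: le_trans (cauchy_schwarz_sum _ _).
rewrite ler_sqr ?nnegrE ?normc_ge0 ?sumr_ge0//; last by move=> j _; exact: normc_ge0.
apply: le_trans (normc_sum_le _ _) _; apply: ler_sum => j _.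
by rewrite Normc.normcM normc_cis mulr1.
Qed.

End TrigonometricSums.

Lemma powR_subn2 (R : realType) (x q : R) : 0 <= x -> 2 <= q ->
  x `^ q = x `^ (q - 2) * x ^+ 2.
Proof.
move=> x0 q2; have q0 : 0 < q by exact: lt_le_trans q2.
by rewrite -powR_mulrn// -powRD ?subrK// gt_eqF.
Qed.

Section LnormHelpers.
Local Open Scope ereal_scope.
Context d (T : measurableType d) (R : realType) (mu : {measure set T -> \bar R}).

Lemma Lnorm_restrictE (D : set T) (f : T -> \bar R) (r : R) : r != 0%R ->
  (forall x, D x -> 0 <= f x) ->
  'N[mu]_r%:E[f \_ D] = (\int[mu]_(x in D) (f x `^ r)) `^ r^-1.
Proof.
move=> r0 f0; rewrite unlock [in RHS]integral_mkcond; congr (_ `^ _).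
apply: eq_integral => x _; rewrite !patchE; case: ifPn => [|_].
  by rewrite inE => Dx; rewrite gee0_abs// f0.
by rewrite abse0 poweR0r.
Qed.

Lemma le_poweR (x y : \bar R) (r : R) : (0 <= r)%R -> 0 <= x -> x <= y ->
  x `^ r <= y `^ r.
Proof.
move=> r0 x0 xy; apply: gt0_ler_poweR => //; rewrite in_itv/= leey andbT//.
exact: le_trans xy.
Qed.

Lemma Lnorm_le_root (D : set T) (f : T -> \bar R) (r : R) (M : \bar R) :
  (0 < r)%R -> (forall x, D x -> 0 <= f x) -> 0 <= M ->
  \int[mu]_(x in D) (f x `^ r) <= M `^ r -> 'N[mu]_r%:E[f \_ D] <= M.
Proof.
move=> r0 f0 M0 h; rewrite Lnorm_restrictE ?gt_eqF//.
apply: (@le_trans _ _ ((M `^ r) `^ r^-1)).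
  by rewrite le_poweR ?invr_ge0 ?(ltW r0)//; apply: integral_ge0 => x _; exact: poweR_ge0.
by rewrite -poweRrM divff ?gt_eqF// poweRe1.
Qed.

Lemma le_Lnorm (f g : T -> R) (r : R) : (0 < r)%R ->
  measurable_fun setT f -> measurable_fun setT g ->
  (forall x, 0 <= f x <= g x)%R ->
  'N[mu]_r%:E[EFin \o f] <= 'N[mu]_r%:E[EFin \o g].
Proof.
move=> r0 mf mg fg.
have mp (h : T -> R) : measurable_fun setT h -> measurable_fun setT (fun x => `|(EFin \o h) x| `^ r).
  move=> mh; apply: (measurableT_comp (measurable_poweR r)).
  have mE : measurable_fun setT (EFin \o h) by exact/measurable_EFinP.
  exact: (measurableT_comp (@abse_measurable R setT) mE).
rewrite unlock le_poweR ?invr_ge0 ?(ltW r0)//.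
  by apply: integral_ge0 => x _; exact: poweR_ge0.
apply: ge0_le_integral => //; [by move=> x _; exact: poweR_ge0|exact: mp|exact: mp|].
move=> x _; have /andP[f0 le] := fg x.
by rewrite le_poweR ?(ltW r0)// !abse_EFin lee_fin !ger0_norm// (le_trans f0).
Qed.

Lemma Lnorm_sum_le (f : nat -> T -> R) (r : R) L : (1 <= r)%R ->
  (forall l, measurable_fun setT (f l)) ->
  'N[mu]_r%:E[EFin \o (fun x => \sum_(0 <= l < L) f l x)%R] <=
  \sum_(0 <= l < L) 'N[mu]_r%:E[EFin \o f l].
Proof.
move=> r1 mf; elim: L => [|L IH].
  rewrite big_geq// (_ : _ \o _ = cst 0); last first.
    by apply/funext => x /=; rewrite big_geq.
  by rewrite Lnorm0// eqe gt_eqF// (lt_le_trans _ r1).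
rewrite big_nat_recr//=; apply: le_trans (leeD2r _ IH).
rewrite (_ : (fun x => \sum_(0 <= l < L.+1) f l x)%R =
   (fun x => \sum_(0 <= l < L) f l x)%R \+ f L)%R; last first.
  by apply/funext => x /=; rewrite big_nat_recr.
apply: minkowski_EFin => //; exact: measurable_sum.
Qed.

End LnormHelpers.

(** * L^q bounds in time for finite frequency sums *)

Section FrequencySums.
Context {R : realType}.
Variables (lam : nat -> R) (c : R).
Hypotheses (c0 : 0 < c) (c1 : c <= 1) (lam_gt0 : forall n, 0 < lam n).
Hypothesis gap : forall m n, (m <= n)%N -> c * (n%:R - m%:R) <= lam n - lam m.
Local Notation mu1 := (@lebesgue_measure R).
Local Notation normc := Normc.normc.

Definition freq_sum (s : seq (nat * int)) (b : nat * int -> R[i]) (t : R) : R[i] :=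
  trig_sum s b (freq lam) t.

Let K1 : R := 2 * (2 / c) ^+ 2.
Let K2 : R := 8 * (4 * schur_const (c / 2) * (2 / c)).

(** [K1] comes from counting frequencies and [K2] from the L^2 bound. The summand 1 ensures C <=
    C^2, so that powers of the constant can be absorbed. *)
Definition block_const : R := 1 + K1 + K2.

Lemma K1_ge0 : 0 <= K1. Proof. by rewrite mulr_ge0// sqr_ge0. Qed.

Lemma K2_ge0 : 0 <= K2.
Proof.
rewrite mulr_ge0// mulr_ge0 ?divr_ge0 ?(ltW c0)// mulr_ge0// mulr_ge0//.
by rewrite addr_ge0// divr_ge0// sqr_ge0.
Qed.

Lemma block_const_ge1 : 1 <= block_const.
Proof. by rewrite /block_const -addrA lerDl addr_ge0 ?K1_ge0 ?K2_ge0. Qed.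

Lemma measurable_normc_freq_sum s b : measurable_fun setT (fun t => normc (freq_sum s b t)).
Proof.
rewrite (_ : (fun _ => _) = (fun t => Num.sqrt (normc (freq_sum s b t) ^+ 2))); last first.
  by apply/funext => t; rewrite sqrtr_sqr ger0_norm ?normc_ge0.
apply: (measurableT_comp (continuous_measurable_fun (@sqrt_continuous R))).
apply: continuous_measurable_fun; exact: continuous_sqr_normc_trig_sum.
Qed.

Lemma measurable_normc_freq_sum_restrict s b (D : set R) : measurable D ->
  measurable_fun setT ((fun t => normc (freq_sum s b t)) \_ D).
Proof.
move=> mD; apply/(measurable_restrictT _ mD).
exact: measurable_funTS (measurable_normc_freq_sum s b).
Qed.

(* Interpolation between the L^2 bound in time (almost orthogonality) and the
   trivial L^oo bound (counting frequencies). *)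
Lemma freq_sum_Lq_block (N q t0 A : R) (s : seq (nat * int)) b (D : set R) :
  1 <= N -> 2 <= q -> uniq s -> (forall j, j \in s -> freq lam j <= N) ->
  0 <= A -> \sum_(j <- s) normc (b j) ^+ 2 <= A ^+ 2 ->
  measurable D -> D `<=` `[t0 - 1, t0 + 1] ->
  ('N[mu1]_q%:E[(fun t => (normc (freq_sum s b t))%:E) \_ D] <=
   (block_const * N `^ (1 - q^-1) * A)%:E)%E.
Proof.
move=> N1 q2 us sN A0 bA mD Dt.
have N0 : 0 < N := lt_le_trans ltr01 N1.
have q0 : 0 < q by exact: lt_le_trans q2.
have C1 := block_const_ge1; set C := block_const.
have C0 : 0 < C := lt_le_trans ltr01 C1.
have sup t : normc (freq_sum s b t) <= C * N * A.
  rewrite -ler_sqr ?nnegrE ?normc_ge0 ?mulr_ge0 ?(ltW C0) ?(ltW N0)//.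
  apply: (le_trans (trig_sum_sup _ _ _ _)).
  apply: (@le_trans _ _ (K1 * N ^+ 2 * A ^+ 2)).
    apply: ler_pM => //; first by rewrite sumr_ge0// => j _; exact: sqr_ge0.
    exact: (freq_count c0 c1 lam_gt0 gap us N1 sN).
  rewrite !exprMn ler_wpM2r ?sqr_ge0// ler_wpM2r ?sqr_ge0//.
  have := K1_ge0; have := K2_ge0; rewrite /C /block_const; nra.
have L2 : (\int[mu1]_(t in D) (normc (freq_sum s b t) ^+ 2)%:E <= (C * N * A ^+ 2)%:E)%E.
  have msq (E : set R) : measurable_fun E (fun t => (normc (freq_sum s b t) ^+ 2)%:E).
    by apply: measurable_funTS; apply/measurable_EFinP; apply: measurable_funX; exact: measurable_normc_freq_sum.
  apply: (@le_trans _ _ (\int[mu1]_(t in `[(t0 - 1)%R, (t0 + 1)%R]) (normc (freq_sum s b t) ^+ 2)%:E)%E).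
    apply: ge0_subset_integral => //; first exact: msq.
    by move=> t _; rewrite lee_fin sqr_ge0.
  apply: (le_trans (trig_sum_L2 b t0 (fun j _ => freq_schur c0 c1 lam_gt0 gap (freq lam j) us N1 sN))).
  rewrite lee_fin [8 * _]mulrA -/K2; apply: ler_pM => //.
  - by rewrite mulr_ge0 ?K2_ge0 ?(ltW N0).
  - by rewrite sumr_ge0// => j _; exact: sqr_ge0.
  - rewrite ler_wpM2r ?(ltW N0)// /C /block_const; have := K1_ge0; lra.
set M := C * N `^ (1 - q^-1) * A.
have M0 : 0 <= M by rewrite !mulr_ge0 ?powR_ge0 ?(ltW C0).
apply: Lnorm_le_root => //; [by move=> t _; rewrite lee_fin normc_ge0|].
have q20 : 0 <= q - 2 by rewrite subr_ge0.
(* All but two powers are estimated by the supremum. The outcome (C N A)^(q - 2) C N A^2 contains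
   N^(q - 1), whose q-th root is N^(1 - 1/q). *)
apply: (@le_trans _ _ (\int[mu1]_(t in D) (((C * N * A) `^ (q - 2))%:E * (normc (freq_sum s b t) ^+ 2)%:E))%E).
  apply: ge0_le_integral => //.
  - by move=> t _; exact: poweR_ge0.
  - apply: measurable_funTS; apply: (measurableT_comp (measurable_poweR q)).
    by apply/measurable_EFinP; exact: measurable_normc_freq_sum.
  - apply: measurable_funTS; apply/measurable_EFinP; apply: measurable_funM => //.
    by apply: measurable_funX; exact: measurable_normc_freq_sum.
  - move=> t _; rewrite poweR_EFin lee_fin (powR_subn2 (normc_ge0 _) q2).
    rewrite ler_wpM2r ?sqr_ge0// ge0_ler_powR// ?nnegrE ?normc_ge0//.
    by rewrite !mulr_ge0 ?(ltW C0) ?(ltW N0).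
rewrite ge0_integralZl//; last 3 first.
- by apply: measurable_funTS; apply/measurable_EFinP; apply: measurable_funX; exact: measurable_normc_freq_sum.
- by move=> t _; rewrite lee_fin sqr_ge0.
- by rewrite lee_fin powR_ge0.
apply: (le_trans (lee_wpmul2l _ L2)); first by rewrite lee_fin powR_ge0.
rewrite poweR_EFin lee_fin /M.
have [->|An0] := eqVneq A 0.
  by rewrite expr0n/= !mulr0 powR_ge0.
have A_gt0 : 0 < A by rewrite lt_neqAle eq_sym An0.
rewrite !powRM ?powR_ge0 ?mulr_ge0 ?(ltW C0) ?(ltW N0) ?powR_ge0//.
rewrite -powRrM mulrBl mul1r mulVf ?gt_eqF//.
have eC := powR_subn2 (ltW C0) q2; have eA := powR_subn2 A0 q2.
have eN : N `^ (q - 1) = N `^ (q - 2) * N.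
  rewrite -{3}[N]powRr1 ?(ltW N0)// -powRD; last by rewrite (gt_eqF N0) implybT.
  by congr (_ `^ _); ring.
rewrite eC eA eN.
set x := C `^ _; set y := N `^ _; set w := A `^ _.
have -> : x * y * w * (C * N * A ^+ 2) = (x * y * w * N * A ^+ 2) * C by ring.
have -> : x * C ^+ 2 * (y * N) * (w * A ^+ 2) = (x * y * w * N * A ^+ 2) * C ^+ 2 by ring.
rewrite ler_wpM2l ?expr2 ?ler_peMl ?(ltW C0)//.
by rewrite !mulr_ge0 ?sqr_ge0 ?powR_ge0 ?(ltW N0).
Qed.

Lemma bracket_ge1 (x : R) : 1 <= bracket x.
Proof. by rewrite -[leLHS]sqrtr1 ler_sqrt ?lerDl ?addr_ge0 ?sqr_ge0. Qed.

Lemma le_bracket (x : R) : 0 <= x -> x <= bracket x.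
Proof.
by move=> x0; rewrite -[leLHS]ger0_norm// -sqrtr_sqr ler_sqrt ?addr_ge0 ?sqr_ge0// lerDr.
Qed.

Definition dyadic_block (s : seq (nat * int)) (l : nat) : seq (nat * int) :=
  [seq j <- s | 2 ^+ l <= bracket (freq lam j) < 2 ^+ l.+1].

Lemma dyadic_exists (x : R) : 1 <= x -> exists l, 2 ^+ l <= x < 2 ^+ l.+1.
Proof.
move=> x1; have [m xm] : exists m, x < 2 ^+ m.
  exists (Num.bound x); apply: lt_le_trans (archi_boundP _) _; first by rewrite (le_trans _ x1).
  by rewrite -natrX ler_nat ltnW// ltn_expl.
elim: m xm => [|m IH xm]; first by rewrite expr0 ltNge x1.
by have [/IH//|h] := ltP x (2 ^+ m); exists m; rewrite h.
Qed.

(** Sum of a geometric series of ratio 2^(1 - 1/q - sigma). The factor 2^(1 - 1/q) appears because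
    block l is estimated with N = 2^(l + 1). *)
Definition sobolev_const (q sigma : R) : R :=
  block_const * 2 `^ (1 - q^-1) / (1 - 2 `^ (1 - q^-1 - sigma)).

Lemma freq_sum_Lq (q sigma t0 T : R) (s : seq (nat * int)) b (D : set R) :
  2 <= q -> 1 - q^-1 < sigma -> uniq s -> 0 <= T ->
  \sum_(j <- s) bracket (freq lam j) `^ (2 * sigma) * normc (b j) ^+ 2 <= T ^+ 2 ->
  measurable D -> D `<=` `[t0 - 1, t0 + 1] ->
  ('N[mu1]_q%:E[(fun t => (normc (freq_sum s b t))%:E) \_ D] <=
   (sobolev_const q sigma * T)%:E)%E.
Proof.
move=> q2 hs us T0 bT mD Dt.
have q0 : 0 < q by exact: lt_le_trans q2.
have q1 : 1 <= q by apply: le_trans q2; rewrite ler1n.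
(* Only finitely many blocks meet the finite list; L does not enter the final constant. *)
have [L sL] : exists L, forall j, j \in s -> bracket (freq lam j) < 2 ^+ L.
  elim: s {us bT} => [|j s [L IH]]; first by exists 0%N.
  have [l /andP[_ hl]] := dyadic_exists (bracket_ge1 (freq lam j)).
  exists (maxn L l.+1) => i; rewrite inE => /predU1P[->|/IH h].
    by apply: (lt_le_trans hl); rewrite ler_weXn2l ?ler1n// leq_maxr.
  by apply: (lt_le_trans h); rewrite ler_weXn2l ?ler1n// leq_maxl.
pose f l := (fun t => normc (freq_sum (dyadic_block s l) b t)) \_ D.
have mf l : measurable_fun setT (f l).
  exact: measurable_normc_freq_sum_restrict.
have split_sum t : normc (freq_sum s b t) <= \sum_(0 <= l < L) normc (freq_sum (dyadic_block s l) b t).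
  rewrite (_ : freq_sum s b t = \sum_(0 <= l < L) freq_sum (dyadic_block s l) b t).
    exact: normc_sum_le.
  rewrite /freq_sum /trig_sum /dyadic_block.
  under [RHS]eq_bigr do rewrite big_filter big_mkcond/=.
  rewrite exchange_big/= !big_seq; apply: eq_bigr => j js.
  have [l hl] := dyadic_exists (bracket_ge1 (freq lam j)).
  have lL : (l < L)%N.
    have /andP[h1 _] := hl; have := le_lt_trans h1 (sL _ js).
    by rewrite ltr_eXn2l// ltr1n.
  rewrite (bigD1_seq l)/= ?mem_index_iota ?iota_uniq// hl.
  rewrite big1 ?addr0// => i il; rewrite ifN//; apply: contra il => /andP[h1 h2].
  have /andP[g1 g2] := hl.
  have := le_lt_trans h1 g2; have := le_lt_trans g1 h2.
  by rewrite !ltr_eXn2l ?ltr1n// !ltnS => li il; rewrite eqn_leq il li.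
have -> : (fun t => (normc (freq_sum s b t))%:E) \_ D = EFin \o ((fun t => normc (freq_sum s b t)) \_ D).
  by rewrite restrict_EFin.
apply: (@le_trans _ _ 'N[mu1]_q%:E[EFin \o (fun t => \sum_(0 <= l < L) f l t)%R]%E).
  apply: le_Lnorm => //.
  - exact: measurable_normc_freq_sum_restrict.
  - exact: measurable_sum.
  - move=> t; rewrite /f patchE; case: ifPn => [tD|tD].
      rewrite normc_ge0/=; apply: (le_trans (split_sum t)).
      by rewrite le_eqVlt; apply/orP; left; apply/eqP; apply: eq_bigr => l _; rewrite patchE tD.
    by rewrite lexx/= sumr_ge0// => l _; rewrite patchE (negbTE tD).
have mink := @Lnorm_sum_le _ _ R mu1 f q L q1 mf.
apply: (le_trans mink).
set rho := 2 `^ (1 - q^-1 - sigma).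
have rho0 : 0 < rho by rewrite powR_gt0.
have rho1 : rho < 1.
  rewrite /rho -opprB powRN invf_lt1 ?powR_gt0//.
  have : (1 : R) `^ (sigma - (1 - q^-1)) < 2 `^ (sigma - (1 - q^-1)).
    by apply: gt0_ltr_powR; rewrite ?subr_gt0 ?nnegrE// ltr1n.
  by rewrite powR1.
(* On block l the bracket is at least 2^l, so the coefficients there have l^2 norm at most 2^(-
   sigma l) T. *)
have block l : ('N[mu1]_q%:E[EFin \o f l] <= (block_const * 2 `^ (1 - q^-1) * T * rho ^+ l)%:E)%E.
  have N1 : 1 <= 2 ^+ l.+1 :> R by rewrite expr_ge1// ler1n.
  have A0 : 0 <= 2 `^ (- (sigma * l%:R)) * T by rewrite mulr_ge0 ?powR_ge0.
  rewrite /f -restrict_EFin.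
  apply: (le_trans (@freq_sum_Lq_block _ q t0 _ (dyadic_block s l) b D N1 q2 _ _ A0 _ mD Dt)).
  - by rewrite filter_uniq.
  - move=> j; rewrite mem_filter => /andP[/andP[_ h] _].
    by rewrite ltW// (le_lt_trans _ h)// le_bracket// sqrtr_ge0.
  - rewrite exprMn -powR_mulrn ?powR_ge0// -powRrM.
    rewrite (_ : - (sigma * l%:R) * 2 = - (2 * sigma * l%:R)); last by ring.
    rewrite powRN mulrC ler_pdivlMr ?powR_gt0//.
    apply: (le_trans _ bT); rewrite mulr_suml big_filter.
    rewrite [leRHS](bigID (fun j => 2 ^+ l <= bracket (freq lam j) < 2 ^+ l.+1))/=.
    apply: ler_wpDr.
      by rewrite sumr_ge0// => j _; rewrite mulr_ge0 ?powR_ge0 ?sqr_ge0.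
    apply: ler_sum => j /andP[h _]; rewrite mulrC ler_wpM2r ?sqr_ge0//.
    have -> : 2 `^ (2 * sigma * l%:R) = (2 ^+ l) `^ (2 * sigma) :> R.
      by rewrite -[2 ^+ l]powR_mulrn// -powRrM mulrC.
    have s0 : 0 <= 2 * sigma.
      rewrite mulr_ge0// (le_trans _ (ltW hs))// subr_ge0 invf_le1//.
    by apply: ge0_ler_powR => //; rewrite ?nnegrE ?exprn_ge0// (le_trans _ h)// exprn_ge0.
  - rewrite lee_fin le_eqVlt; apply/orP; left; apply/eqP.
    have e1 : (2 ^+ l.+1) `^ (1 - q^-1) = 2 `^ (l.+1%:R * (1 - q^-1)) :> R.
      by rewrite -[2 ^+ l.+1]powR_mulrn// -powRrM.
    have e2 : rho ^+ l = 2 `^ ((1 - q^-1 - sigma) * l%:R).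
      by rewrite -[rho ^+ l]powR_mulrn ?powR_ge0// /rho -powRrM.
    have e3 : 2 `^ (l.+1%:R * (1 - q^-1)) * (2 `^ (- (sigma * l%:R))) =
        2 `^ (1 - q^-1) * 2 `^ ((1 - q^-1 - sigma) * l%:R) :> R.
      have tw : (2 : R) != 0 by [].
      rewrite -!powRD ?tw ?implybT//; congr (_ `^ _).
      by rewrite -natr1; ring.
    rewrite e1 e2; transitivity (block_const *
      (2 `^ (l.+1%:R * (1 - q^-1)) * (2 `^ (- (sigma * l%:R)))) * T); first by ring.
    by rewrite e3; ring.
apply: (@le_trans _ _ (\sum_(0 <= l < L) (block_const * 2 `^ (1 - q^-1) * T * rho ^+ l)%:E)%E).
  by apply: lee_sum => l _; exact: block.
rewrite sumEFin lee_fin.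
have := @geometric_le_lim _ L (block_const * 2 `^ (1 - q^-1) * T) rho.
rewrite /series/= => h; apply: le_trans (h _ rho0 _) _.
- by rewrite !mulr_ge0 ?powR_ge0// (le_trans _ block_const_ge1).
- by rewrite ger0_norm ?(ltW rho0).
- by rewrite /sobolev_const -/rho mulrAC.
Qed.

End FrequencySums.

(** * Limits and measurability *)

Section SectionwiseConvergence.
Local Open Scope ereal_scope.
Context d1 d2 (T1 : measurableType d1) (T2 : measurableType d2) (R : realType).
Variables (m1 : {sigma_finite_measure set T1 -> \bar R})
  (m2 : {sigma_finite_measure set T2 -> \bar R}).

(* By Fubini and dominated convergence a subsequence of g is summable in
   L^1(D1 x D2), hence pointwise summable on almost every section D1 x {x}. *)
Lemma ae_section_subsequence (D1 : set T1) (D2 : set T2) (g : nat -> T1 * T2 -> R) :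
  measurable D1 -> measurable D2 -> m1 D1 < +oo -> m2 D2 < +oo ->
  (forall n, measurable_fun (D1 `*` D2) (g n)) ->
  (forall n z, (0 <= g n z <= 1)%R) ->
  (forall t, D1 t -> (fun n => \int[m2]_(x in D2) (g n (t, x))%:E) @ \oo --> 0) ->
  exists N : nat -> nat, \forall x \ae m2, D2 x ->
    \forall t \ae m1, D1 t -> (fun k => (g (N k) (t, x))%:E) @ \oo --> 0.
Proof.
move=> mD1 mD2 fD1 fD2 mg g01 cvg0.
have mD12 : measurable (D1 `*` D2) by exact: measurableX.
pose F n := (EFin \o g n) \_ (D1 `*` D2).
have F0 n z : 0 <= F n z.
  by rewrite /F patchE; case: ifPn => // _; rewrite lee_fin; have /andP[] := g01 n z.
have mF n : measurable_fun setT (F n).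
  by apply/(measurable_restrictT _ mD12)/measurable_EFinP.
have FE n t x : D1 t -> D2 x -> F n (t, x) = (g n (t, x))%:E.
  by move=> Dt Dx; rewrite /F patchE mem_set.
have F_out n t x : ~ D1 t -> F n (t, x) = 0.
  by move=> Dt; rewrite /F patchE memNset// => -[].
pose phi n := fubini_F m2 (F n).
have mphi n : measurable_fun setT (phi n) by exact: measurable_fun_fubini_tonelli_F.
have phi0 n t : 0 <= phi n t by apply: integral_ge0.
have phiE n t : D1 t -> phi n t = \int[m2]_(x in D2) (g n (t, x))%:E.
  move=> Dt; rewrite [RHS]integral_mkcond; apply: eq_integral => x _.
  have [Dx|Dx] := pselect (D2 x); first by rewrite FE// patchE mem_set.
  by rewrite /F !patchE !memNset// => -[].
have phi_le n t : D1 t -> phi n t <= m2 D2.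
  move=> Dt; rewrite phiE//.
  apply: (@le_trans _ _ (\int[m2]_(x in D2) cst 1 x)); last by rewrite integral_cst// mul1e.
  apply: ge0_le_integral => //.
  - by move=> x _; rewrite lee_fin; have /andP[] := g01 n (t, x).
  - apply: (@eq_measurable_fun _ _ _ _ _ (fun x => F n (t, x))).
      by move=> x; rewrite inE => Dx; rewrite FE.
    apply: measurable_funTS.
    exact: (measurableT_comp (mF n) (pair1_measurable t)).
  - by move=> x _; rewrite lee_fin; have /andP[] := g01 n (t, x).
have total n : \int[m1 \x m2]_z F n z = \int[m1]_(t in D1) phi n t.
  rewrite fubini_tonelli1// [RHS]integral_mkcond; apply: eq_integral => t _.
  rewrite patchE; case: ifPn => //; rewrite notin_setE => Dt.
  by apply: integral0_eq => x _; exact: F_out.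
have fin2 : m2 D2 \is a fin_num by rewrite ge0_fin_numE.
(* Dominated convergence in t: since g <= 1, the inner integrals never exceed the finite constant m2
   D2. *)
have lim0 : (fun n => \int[m1 \x m2]_z F n z) @ \oo --> 0.
  rewrite (_ : (fun n => _) = (fun n => \int[m1]_(t in D1) phi n t)); last exact/funext.
  suff : (fun n => \int[m1]_(t in D1) phi n t) @ \oo --> \int[m1]_(t in D1) cst 0 t.
    by rewrite integral0.
  apply: (@dominated_cvg _ _ _ m1 D1 mD1 phi (cst 0) (cst (m2 D2))) => //.
  - by move=> n; apply: measurable_funTS.
  - move=> t Dt; apply: cvg_trans (cvg0 t Dt); apply: near_eq_cvg.
    by near=> n; rewrite phiE.
  - apply/integrableP; split; first exact: measurable_cst.
    rewrite (_ : (fun x => _) = cst (m2 D2)); last by apply/funext => x /=; rewrite gee0_abs.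
    by rewrite integral_cst// lte_mul_pinfty.
  - by move=> n t Dt; rewrite gee0_abs//; exact: phi_le.
have /choice[N HN] : forall k, exists n, \int[m1 \x m2]_z F n z <= (1 / (2 ^ k.+1)%:R)%:E.
  move=> k; have e0 : (0 : \bar R) < (1 / (2 ^ k.+1)%:R)%:E by rewrite lte_fin divr_gt0// ltr0n expn_gt0.
  have : nbhs (0 : \bar R) [set y | y < (1 / (2 ^ k.+1)%:R)%:E].
    by apply: open_nbhs_nbhs; split => //; exact: open_ereal_lt_ereal.
  by move=> /lim0[n _ h]; exists n; apply/ltW/h => /=.
exists N.
pose S z := \sum_(0 <= k <oo) F (N k) z.
have mS : measurable_fun setT S by apply: ge0_emeasurable_sum.
have S0 z : 0 <= S z by apply: nneseries_ge0.
have S_fin : \int[m1 \x m2]_z S z < +oo.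
  rewrite integral_nneseries//; apply: (@le_lt_trans _ _ (0 + 1%:E)); last by rewrite add0e ltry.
  have := @epsilon_trick R (fun=> 0) 1%R xpredT (fun=> lexx 0) ler01.
  rewrite [X in _ <= X + _]eseries0// => h; apply: le_trans h.
  apply: lee_nneseries => [k _ _|k _]; last by rewrite add0e; exact: HN.
  by apply: integral_ge0 => z _; exact: F0.
pose V := fubini_G m1 S.
have mV : measurable_fun setT V by exact: measurable_fun_fubini_tonelli_G.
have V0 x : 0 <= V x by apply: integral_ge0.
have iV : m2.-integrable setT V.
  apply/integrableP; split => //.
  under eq_integral do rewrite gee0_abs//.
  by move: S_fin; rewrite fubini_tonelli1// fubini_tonelli.
have := integrable_ae measurableT iV; apply: filterS => x /(_ Logic.I) Vx D2x.
have mSx : measurable_fun setT (fun t => S (t, x)).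
  exact: (measurableT_comp mS (pair2_measurable x)).
have iSx : m1.-integrable setT (fun t => S (t, x)).
  apply/integrableP; split => //.
  under eq_integral do rewrite gee0_abs//.
  by rewrite -ge0_fin_numE//; exact: V0.
have := integrable_ae measurableT iSx; apply: filterS => t /(_ Logic.I) Sx D1t.
have Sxlt : S (t, x) < +oo by rewrite -(ge0_fin_numE (S0 _)).
have tail := nneseries_tail_cvg Sxlt (fun k _ => F0 (N k) (t, x)).
apply: (squeeze_cvge _ (cvg_cst 0) tail); near=> k.
rewrite -FE// F0/=.
have := @nneseries_lim_ge _ (fun k => F (N k) (t, x)) xpredT k k.+1 (fun _ _ _ => F0 _ _).
by rewrite big_nat1.
Unshelve. all: by end_near.
Qed.

End SectionwiseConvergence.

Lemma integral_cst_indic d (T : measurableType d) (R : realType)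
    (mu : {measure set T -> \bar R}) (D A : set T) (c : R) :
  measurable D -> measurable A -> 0 <= c ->
  (\int[mu]_(x in D) (c%:E * (\1_A x)%:E) = c%:E * mu (A `&` D))%E.
Proof.
move=> mD mA c0; rewrite ge0_integralZl//; first by rewrite integral_indic.
by apply/measurable_EFinP; exact: measurable_indic.
Qed.

(** * An integrable majorant for negative powers of the radius *)

Section RadialWeight.
Context {R : realType}.
Local Notation mu1 := (@lebesgue_measure R).
Local Notation mu2 := (mu1 \x mu1)%E.
Local Notation mu3 := (mu2 \x mu1)%E.
Implicit Types (beta r : R) (k : nat).

(** Squares replace discs because their product measure is immediate. *)
Definition square r : set (R * R) := `[- r, r] `*` `[- r, r].

Definition weight_term beta k (y : R * R) : \bar R :=
  ((2 `^ (k.+1%:R * beta))%:E * (\1_(square ((2 : R) ^- k)) y)%:E)%E.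

(* A majorant of |y|^(-beta) on the disk whose integral is a geometric series. *)
Definition radial_weight beta (y : R * R) : \bar R :=
  (\sum_(0 <= k <oo) weight_term beta k y)%E.

Lemma weight_term_ge0 beta k y : (0 <= weight_term beta k y)%E.
Proof. by rewrite mule_ge0// lee_fin ?powR_ge0// indicE ler0n. Qed.

Lemma radial_weight_ge0 beta y : (0 <= radial_weight beta y)%E.
Proof. by apply: nneseries_ge0 => k _ _; exact: weight_term_ge0. Qed.

Lemma measurable_square r : measurable (square r).
Proof. by apply: measurableX; exact: measurable_itv. Qed.

Lemma measurable_weight_term beta k : measurable_fun setT (weight_term beta k).
Proof.
apply/measurable_EFinP; apply: measurable_funM => //.
exact: measurable_indic (measurable_square _).
Qed.

Lemma measurable_radial_weight beta : measurable_fun setT (radial_weight beta).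
Proof.
apply: ge0_emeasurable_sum => [k y _ _|k _]; first exact: weight_term_ge0.
exact: measurable_weight_term.
Qed.

Lemma enorm_le_square y r : enorm y <= r -> square r y.
Proof.
case: y => y1 y2; rewrite /enorm/= => h.
have h1 (a b : R) : `|a| <= Num.sqrt (a ^+ 2 + b ^+ 2).
  by rewrite -sqrtr_sqr ler_sqrt ?addr_ge0 ?sqr_ge0// lerDl sqr_ge0.
split; rewrite /= in_itv/= -ler_norml; first exact: le_trans (h1 _ _) h.
by rewrite addrC in h; exact: le_trans (h1 _ _) h.
Qed.

(** If 2^(- (k + 1)) < |y| <= 2^(- k), the k-th term alone is at least |y|^(- beta). *)
Lemma radial_weight_ge beta y : 0 <= beta -> disk y -> 0 < enorm y ->
  ((enorm y `^ (- beta))%:E <= radial_weight beta y)%E.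
Proof.
move=> beta0 dy y0.
have [k /andP[h1 h2]] : exists k, 2 ^+ k <= (enorm y)^-1 < 2 ^+ k.+1.
  by apply: dyadic_exists; rewrite invf_ge1// ltW.
have yk : enorm y <= 2 ^- k.
  by rewrite -[leLHS]invrK lef_pV2 ?posrE ?invr_gt0// exprn_gt0.
apply: (@le_trans _ _ (\sum_(0 <= i < k.+1) weight_term beta i y)%E); last first.
  by apply: nneseries_lim_ge => i _ _; exact: weight_term_ge0.
rewrite big_nat_recr//=; apply: (@le_trans _ _ (weight_term beta k y)); last first.
  by rewrite leeDr// sume_ge0// => i _; exact: weight_term_ge0.
rewrite /weight_term indicE mem_set; last exact: enorm_le_square.
have -> : enorm y `^ (- beta) = (enorm y)^-1 `^ beta.
  by rewrite -powR_inv1 ?(ltW y0)// -powRrM mulN1r.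
rewrite mule1 lee_fin powRrM powR_mulrn//.
by apply: ge0_ler_powR => //; rewrite ?nnegrE ?invr_ge0 ?exprn_ge0// ltW.
Qed.

Lemma measurable_cylinder : measurable (@cylinder R).
Proof. by apply: measurableX; [exact: measurable_disk|exact: measurable_itv]. Qed.

Lemma square_cylinder_measure r : 0 <= r ->
  mu3 (square r `*` `[0, 1[) = ((2 * r) ^+ 2)%:E.
Proof.
move=> r0.
have h : mu1 `[- r, r] = (2 * r)%:E.
  rewrite lebesgue_measure_itv/= lte_fin; case: ltP => [_|].
    by rewrite opprK -EFinD; congr EFin; ring.
  by move=> h; congr EFin; lra.
have hs : mu2 (square r) = ((2 * r) ^+ 2)%:E.
  transitivity (mu1 `[(- r)%R, r] * mu1 `[(- r)%R, r])%E.
    by apply: product_measure1E; exact: measurable_itv.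
  by rewrite h -EFinM -expr2.
transitivity (mu2 (square r) * mu1 `[0%R, 1%R[)%E.
  by apply: product_measure1E; [exact: measurable_square|exact: measurable_itv].
rewrite hs lebesgue_measure_itv/= lte_fin ltr01 -EFinB subr0.
exact: mule1.
Qed.

Lemma cylinder_finite : (mu3 cylinder < +oo)%E.
Proof.
apply: (@le_lt_trans _ _ (mu3 (square 1 `*` `[0, 1[))).
  apply: le_measure; rewrite ?inE; [exact: measurable_cylinder| |].
    by apply: measurableX; [exact: measurable_square|exact: measurable_itv].
  by move=> x [dx h]; split => //; apply: enorm_le_square; exact: ltW.
by rewrite square_cylinder_measure// ltry.
Qed.

(** The k-th term integrates to at most 2^((k + 1) beta) (2 * 2^(- k))^2 = 4 * 2^beta * 2^(k (beta -
    2)), a geometric sequence that is summable for beta < 2. *)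
Lemma radial_weight_integrable beta : beta < 2 ->
  (\int[mu3]_(x in cylinder) radial_weight beta x.1 < +oo)%E.
Proof.
move=> beta2; rewrite integral_nneseries; last 3 first.
- exact: measurable_cylinder.
- move=> k; apply: measurable_funTS.
  exact: (measurableT_comp (measurable_weight_term beta k) measurable_fst).
- by move=> k x _; exact: weight_term_ge0.
set a : R := 4 * 2 `^ beta; set rho : R := 2 `^ (beta - 2).
have rho0 : 0 < rho by rewrite powR_gt0.
have rho1 : rho < 1.
  rewrite /rho -opprB powRN invf_lt1 ?powR_gt0//.
  have : (1 : R) `^ (2 - beta) < 2 `^ (2 - beta).
    by apply: gt0_ltr_powR; rewrite ?subr_gt0 ?nnegrE// ltr1n.
  by rewrite powR1.
have term k : (\int[mu3]_(x in cylinder) weight_term beta k x.1 <= (a * rho ^+ k)%:E)%E.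
  pose Q : set (R * R * R) := square ((2 : R) ^- k) `*` setT.
  have mQ : measurable Q by apply: measurableX => //; exact: measurable_square.
  have -> : (\int[mu3]_(x in cylinder) weight_term beta k x.1 =
      \int[mu3]_(x in cylinder) ((2 `^ (k.+1%:R * beta))%:E * (\1_Q x)%:E))%E.
    apply: eq_integral => x _; rewrite /weight_term !indicE; congr (_ * _%:R%:E)%E.
    by congr (nat_of_bool _); apply/idP/idP; rewrite !inE/= => // -[].
  rewrite integral_cst_indic ?powR_ge0//; last exact: measurable_cylinder.
  apply: (@le_trans _ _ ((2 `^ (k.+1%:R * beta))%:E * ((2 * (2 : R) ^- k) ^+ 2)%:E)%E).
    rewrite lee_wpmul2l ?lee_fin ?powR_ge0// -square_cylinder_measure ?invr_ge0 ?exprn_ge0//.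
    apply: le_measure; rewrite ?inE.
    - by apply: measurableI => //; exact: measurable_cylinder.
    - by apply: measurableX; [exact: measurable_square|exact: measurable_itv].
    - by move=> x [[h1 _] [_ h2]]; split.
  rewrite -EFinM lee_fin le_eqVlt; apply/orP; left; apply/eqP.
  have -> : rho ^+ k = 2 `^ (beta * k%:R) * (2 ^- k) ^+ 2.
    rewrite -[rho ^+ k]powR_mulrn ?powR_ge0// /rho -powRrM.
    have -> : ((2 : R) ^- k) ^+ 2 = 2 `^ (- (2 * k%:R)).
      by rewrite powRN -natrM powR_mulrn// exprVn -exprM mulnC.
    have tw : (2 : R) != 0 by [].
    by rewrite -powRD ?tw ?implybT//; congr (_ `^ _); ring.
  have -> : 2 `^ (k.+1%:R * beta) = 2 `^ beta * 2 `^ (beta * k%:R) :> R.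
    have tw : (2 : R) != 0 by [].
    by rewrite -powRD ?tw ?implybT//; congr (_ `^ _); rewrite -natr1; ring.
  by rewrite /a; ring.
apply: (@le_lt_trans _ _ (a / (1 - rho))%:E); last exact: ltry.
apply: lime_le; first by apply: is_cvg_nneseries => k _ _; apply: integral_ge0 => x _; exact: weight_term_ge0.
near=> n; apply: (@le_trans _ _ (\sum_(0 <= k < n) (a * rho ^+ k)%:E)%E).
  by apply: lee_sum => k _; exact: term.
rewrite sumEFin lee_fin.
have := @geometric_le_lim _ n a rho; rewrite /series/= => h; apply: h => //.
- by rewrite /a mulr_ge0 ?powR_ge0.
- by rewrite ger0_norm ?(ltW rho0).
Unshelve. all: by end_near.
Qed.

(** The axis lies in the null set x_1 = 0. The bounds with a negative power of |x'| are claimed only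
    off it. *)
Lemma cylinder_axis_negligible :
  mu3.-negligible [set x : R * R * R | enorm x.1 = 0].
Proof.
have E : [set x : R * R * R | enorm x.1 = 0] `<=` ([set 0] `*` setT) `*` setT.
  move=> [[x y] z]/=; rewrite /enorm/= => h; split => //; split => //=.
  have : x ^+ 2 + y ^+ 2 <= 0 by rewrite -sqrtr_eq0 h.
  move=> h2; apply/eqP; rewrite -sqrf_eq0 eq_le sqr_ge0 andbT.
  by have := sqr_ge0 y; lra.
have m : measurable (([set 0] `*` setT) `*` setT : set (R * R * R)).
  by apply: measurableX => //; apply: measurableX.
exists (([set 0] `*` setT) `*` setT); split => //.
have h2 : mu2 ([set 0] `*` setT) = 0%E.
  transitivity (mu1 [set 0%R] * mu1 setT)%E; first exact: product_measure1E.
  by rewrite lebesgue_measure_set1 mul0e.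
transitivity (mu2 ([set 0%R] `*` setT) * mu1 setT)%E.
  by apply: product_measure1E => //; exact: measurableX.
by rewrite h2 mul0e.
Qed.

Lemma itv_length_le1 (I : interval R) : (mu1 [set` I] <= 1)%E ->
  exists t0 : R, [set` I] `<=` `[t0 - 1, t0 + 1].
Proof.
move=> I1; have [I0|/set0P[t0 It0]] := eqVneq [set` I] set0.
  by exists 0; rewrite I0; exact: sub0set.
exists t0 => t It.
have dist (u v : R) : u \in I -> v \in I -> v - u <= 1.
  move=> Iu Iv; have [uv|uv] := leP v u; first by lra.
  have sub : `[u, v] `<=` [set` I].
    move=> w /=; rewrite in_itv/= => uwv.
    exact: (interval_is_interval Iu Iv uwv).
  have h : (mu1 `[u, v] <= mu1 [set` I])%E.
    by apply: le_measure => //; rewrite inE; exact: measurable_itv.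
  move: (le_trans h I1).
  by rewrite lebesgue_measure_itv/= lte_fin uv -EFinB lee_fin.
rewrite /= in_itv/=; have := dist _ _ It0 It; have := dist _ _ It It0.
by move=> h1 h2; apply/andP; split; lra.
Qed.

End RadialWeight.

Section ComplexMeasurability.
Context d (T : measurableType d) (R : realType) (D : set T).
Local Notation normc := Normc.normc.
Implicit Types f g : T -> R[i].

Lemma cmeasurableM f g : cmeasurable D f -> cmeasurable D g ->
  cmeasurable D (fun x => f x * g x).
Proof.
move=> [f1 f2] [g1 g2]; split.
- apply: (@eq_measurable_fun _ _ _ _ _ (fun x =>
    complex.Re (f x) * complex.Re (g x) - complex.Im (f x) * complex.Im (g x))).
    by move=> x _; case: (f x) (g x) => [? ?] [? ?].
  by apply: measurable_funB; apply: measurable_funM.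
- apply: (@eq_measurable_fun _ _ _ _ _ (fun x =>
    complex.Re (f x) * complex.Im (g x) + complex.Im (f x) * complex.Re (g x))).
    by move=> x _; case: (f x) (g x) => [? ?] [? ?].
  by apply: measurable_funD; apply: measurable_funM.
Qed.

Lemma cmeasurableB f g : cmeasurable D f -> cmeasurable D g ->
  cmeasurable D (fun x => f x - g x).
Proof.
move=> [f1 f2] [g1 g2]; split.
- apply: (@eq_measurable_fun _ _ _ _ _ (fun x => complex.Re (f x) - complex.Re (g x))).
    by move=> x _; case: (f x) (g x) => [? ?] [? ?].
  exact: measurable_funB.
- apply: (@eq_measurable_fun _ _ _ _ _ (fun x => complex.Im (f x) - complex.Im (g x))).
    by move=> x _; case: (f x) (g x) => [? ?] [? ?].
  exact: measurable_funB.
Qed.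

Lemma cmeasurable_sum (J : Type) (s : seq J) (f : J -> T -> R[i]) :
  (forall j, cmeasurable D (f j)) -> cmeasurable D (fun x => \sum_(j <- s) f j x).
Proof.
move=> mf; split.
- apply: (@eq_measurable_fun _ _ _ _ _ (fun x => \sum_(j <- s) complex.Re (f j x))).
    by move=> x _; rewrite Re_sum.
  by apply: measurable_sum => j; have [] := mf j.
- apply: (@eq_measurable_fun _ _ _ _ _ (fun x => \sum_(j <- s) complex.Im (f j x))).
    by move=> x _; rewrite Im_sum.
  by apply: measurable_sum => j; have [] := mf j.
Qed.

Lemma cmeasurable_cst (z : R[i]) : cmeasurable D (fun=> z).
Proof. by split; exact: measurable_cst. Qed.

Lemma cmeasurable_real (h : T -> R) : measurable_fun D h ->
  cmeasurable D (fun x => (h x)%:C%C).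
Proof. by move=> mh; split => //; exact: measurable_cst. Qed.

Lemma cmeasurable_cis (h : T -> R) : measurable_fun D h ->
  cmeasurable D (fun x => cis (h x)).
Proof.
move=> mh; split.
- by apply: (measurableT_comp (continuous_measurable_fun (@continuous_cos R))).
- by apply: (measurableT_comp (continuous_measurable_fun (@continuous_sin R))).
Qed.

Lemma measurable_normc f : cmeasurable D f -> measurable_fun D (fun x => normc (f x)).
Proof.
move=> [f1 f2].
apply: (@eq_measurable_fun _ _ _ _ _ (fun x => Num.sqrt (complex.Re (f x) ^+ 2 + complex.Im (f x) ^+ 2))).
  by move=> x _; rewrite -sqr_normcE sqrtr_sqr ger0_norm ?normc_ge0.
apply: (measurableT_comp (continuous_measurable_fun (@sqrt_continuous R))).
by apply: measurable_funD; apply: measurable_funX.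
Qed.

End ComplexMeasurability.

Lemma cmeasurable_comp d1 d2 (T1 : measurableType d1) (T2 : measurableType d2)
    (R : realType) (D : set T1) (E : set T2) (h : T1 -> T2) (f : T2 -> R[i]) :
  measurable E -> h @` D `<=` E -> measurable_fun D h -> cmeasurable E f ->
  cmeasurable D (fun x => f (h x)).
Proof.
by move=> mE hDE mh [f1 f2]; split;
  [exact: (measurable_comp mE hDE f1 mh)|exact: (measurable_comp mE hDE f2 mh)].
Qed.

Section Limits.
Context {R : realType}.
Local Notation normc := Normc.normc.

Lemma cvge0_small (f : nat -> \bar R) : (forall n, 0 <= f n)%E ->
  (forall eps : R, 0 < eps -> \forall n \near \oo, (f n <= eps%:E)%E) ->
  f @ \oo --> 0%E.
Proof.
move=> f0 small; apply/fine_cvgP; split.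
  have := small 1 ltr01; apply: filterS => n fn.
  by rewrite ge0_fin_numE// (le_lt_trans fn)// ltry.
apply/cvgrPdist_le => eps eps0; near=> n.
have fn : (f n <= eps%:E)%E by near: n; exact: small.
have ffin : f n \is a fin_num by rewrite ge0_fin_numE// (le_lt_trans fn)// ltry.
by rewrite sub0r normrN ger0_norm ?fine_ge0// -lee_fin fineK.
Unshelve. all: by end_near.
Qed.

Lemma normc_dist_le (z w : R[i]) : `|normc z - normc w| <= normc (z - w).
Proof.
have sub (x y : R[i]) : normc x - normc y <= normc (x - y).
  by rewrite lerBlDr -[x in leLHS](subrK y) normcD_le.
have sym : normc (w - z) = normc (z - w).
  by case: z w => [a b] [c d] /=; rewrite -(opprB a c) -(opprB b d) !sqrrN.
by rewrite ler_norml sub andbT lerNl opprB -sym sub.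
Qed.

(** Truncating the distance at 1 does not affect convergence to 0. *)
Lemma cvg_normc (z : R[i]) (w : nat -> R[i]) :
  (fun k => (Num.min 1 (normc (z - w k) ^+ 2))%:E) @ \oo --> 0%E ->
  (fun k => normc (w k)) @ \oo --> normc z.
Proof.
move=> /fine_cvgP[_ /cvgrPdist_lt h].
apply/cvgrPdist_lt => eps eps0.
have e0 : 0 < Num.min 1 (eps ^+ 2) by rewrite lt_min ltr01 exprn_gt0.
have := h _ e0; apply: filterS => k /=.
rewrite sub0r normrN ger0_norm; last by rewrite le_min ler01 sqr_ge0.
rewrite lt_min !gt_min ltxx/= => /andP[d1 d2].
have d : normc (z - w k) < eps.
  rewrite -ltr_sqr ?nnegrE ?normc_ge0 ?(ltW eps0)//.
  by case/orP: d2 => // ?; exact: lt_trans d1 _.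
by apply: le_lt_trans d; exact: normc_dist_le.
Qed.

Lemma cvg_powR_pos (r : nat -> R) (a q : R) : 0 < a -> r @ \oo --> a ->
  (fun k => r k `^ q) @ \oo --> a `^ q.
Proof.
move=> a0 ra.
have c : {for a, continuous (fun x => x `^ q)}.
  apply/differentiable_continuous/derivable1_diffP.
  by apply: derivable_powR; rewrite in_itv/= a0.
exact: (cvg_comp r (fun x => x `^ q) ra c).
Qed.

Lemma limn_einf_ge0 (r : nat -> \bar R) : (forall k, 0 <= r k)%E ->
  (0 <= limn_einf r)%E.
Proof.
move=> r0; rewrite limn_einf_lim; apply: lime_ge; first exact: is_cvg_einfs.
by apply: nearW => n; apply: le_ereal_inf_tmp => _ [k _ <-].
Qed.

Lemma limn_einf_le (r : nat -> \bar R) M : (forall k, r k <= M)%E ->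
  (limn_einf r <= M)%E.
Proof.
move=> rM; rewrite limn_einf_lim; apply: lime_le; first exact: is_cvg_einfs.
apply: nearW => n; apply: le_trans (rM n); apply: ereal_inf_lbound.
by exists n => /=.
Qed.

(** For a > 0 this follows from continuity of the power at a; for a = 0 the left side is 0, as q >
    0. *)
Lemma powR_le_limn_einf (r : nat -> R) (a q : R) : 0 < q -> 0 <= a ->
  r @ \oo --> a -> ((a `^ q)%:E <= limn_einf (fun k => (r k `^ q)%:E))%E.
Proof.
move=> q0; rewrite le_eqVlt => /predU1P[<- _|a0 ra].
  by rewrite powR0 ?gt_eqF//; apply: limn_einf_ge0 => k; rewrite lee_fin powR_ge0.
have c : (fun k => (r k `^ q)%:E) @ \oo --> (a `^ q)%:E.
  by apply: cvg_EFin; [exact: nearW|exact: cvg_powR_pos].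
by rewrite is_cvg_limn_einfE ?(cvg_lim _ c)//; apply/cvg_ex; eexists; exact: c.
Qed.

End Limits.

Section FrequencyBoxes.

Definition freq_fset (n : nat) : {fset nat * int} := [fset j in freq_box n]%fset.

(** The boxes are cofinal among finite index sets, so unconditional convergence yields convergence
    along an ordinary sequence. *)
Lemma freq_fset_exhausts (A : {fset nat * int}) : exists n0, forall n,
  (n0 <= n)%N -> (A `<=` freq_fset n)%fset.
Proof.
exists (\max_(j <- A) (maxn j.1 `|j.2|%N)).+1 => n n0; apply/fsubsetP => -[m k] jA.
have : (maxn m `|k| <= \max_(j <- A) (maxn j.1 `|j.2|))%N.
  exact: (@leq_bigmax_seq _ (enum_fset A) xpredT (fun j => maxn j.1 `|j.2|) (m, k) jA isT).
rewrite geq_max => /andP[h1 h2].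
rewrite in_fset; apply: allpairs_f.
  by rewrite mem_iota/= add0n; apply: leq_trans n0; rewrite ltnS.
exact: mem_int_box (leq_ltn_trans h2 n0).
Qed.

End FrequencyBoxes.

Section SpaceMeasure.
Context {R : realType}.
Local Notation mu1 := (@lebesgue_measure R).
Local Notation mu2 := (mu1 \x mu1)%E.
Local Notation mu3 := (mu2 \x mu1)%E.

(* A copy of the product measure: the library's sigma-finiteness instance for
   products is shadowed by its instance for products of subprobabilities. *)
Definition space_measure :
  set (measurableTypeR R * measurableTypeR R * measurableTypeR R) -> \bar R := mu3.

HB.instance Definition _ := Measure.on space_measure.

Let space_measure_sigma_finite : sigma_finite setT space_measure.
Proof.
exists (fun n => square n%:R `*` `[- n%:R, n%:R]).
  rewrite predeqE => -[[y1 y2] y3]; split => // _.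
  pose r := `|y1| + `|y2| + `|y3|.
  have [n hn] : exists n : nat, r <= n%:R.
    by exists (Num.bound r); rewrite ltW// archi_boundP// !addr_ge0.
  have [a1 [a2 a3]] := (normr_ge0 y1, (normr_ge0 y2, normr_ge0 y3)).
  exists n => //; split => /=; [split => /=|]; rewrite in_itv/= -ler_norml;
    apply: le_trans hn; rewrite /r; lra.
move=> n; split.
  by apply: measurableX; [exact: measurable_square|exact: measurable_itv].
have -> : space_measure (square n%:R `*` `[- n%:R, n%:R]) =
    (mu1 `[(- n%:R)%R, n%:R] * mu1 `[(- n%:R)%R, n%:R] * mu1 `[(- n%:R)%R, n%:R])%E.
  transitivity (mu2 (square n%:R) * mu1 `[(- n%:R)%R, n%:R])%E.
    by apply: product_measure1E; [exact: measurable_square|exact: measurable_itv].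
  by congr (_ * _)%E; apply: product_measure1E; exact: measurable_itv.
rewrite lebesgue_measure_itv/= lte_fin; case: ifP => _; last by rewrite !mul0e ltry.
by rewrite -EFinB -!EFinM ltry.
Qed.

HB.instance Definition _ :=
  Measure_isSigmaFinite.Build _ _ _ space_measure space_measure_sigma_finite.

End SpaceMeasure.

Lemma measurable_limn_einf d (T : measurableType d) (R : realType) (D : set T)
    (f : (T -> \bar R)^nat) : (forall n, measurable_fun D (f n)) ->
  measurable_fun D (fun x => limn_einf (f ^~ x)).
Proof.
move=> mf; apply: (@measurableT_comp _ _ _ _ _ _ -%E) => //.
by apply: (@measurable_fun_limn_esup _ _ _ _ (fun n x => - f n x)%E) => n; exact: measurableT_comp.
Qed.

(** * The evolution *)

Section Evolution.
Context {R : realType}.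
Variables (lam : nat -> R) (e : nat -> R * R -> R).
Hypothesis he : radial_dirichlet_sequence lam e.
Local Notation mu1 := (@lebesgue_measure R).
Local Notation mu2 := (mu1 \x mu1)%E.
Local Notation mu3 := (mu2 \x mu1)%E.
Local Notation normc := Normc.normc.
Implicit Types (a : nat * int -> R[i]) (x : R * R * R) (t : R).

Definition partial_evolution a n t x : R[i] :=
  \sum_(j <- freq_fset n) a j * cis (- (freq lam j * t)) * mode e j x.

Lemma partial_evolutionE a n t x : partial_evolution a n t x =
  freq_sum lam (freq_fset n) (fun j => a j * mode e j x) t.
Proof. by apply: eq_bigr => j _; rewrite mulrAC. Qed.

Lemma normc_mode j x : normc (mode e j x) = `|e j.1 x.1|.
Proof.
by rewrite Normc.normcM normc_cis mulr1 /= expr0n/= addr0 sqrtr_sqr.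
Qed.

(** With tau = 2 theta, the eigenfunction bound costs the bracket to the power 1 - 2 theta, which
    together with 2 (s - 1/2 + theta) makes 2 s. Replacing lam_n + 1 by twice the bracket costs at
    most a factor 2, so 96 becomes 192. *)
Lemma mode_coef_bound (s theta : R) a j x : disk x.1 -> 0 < enorm x.1 ->
  0 <= theta -> 2 * theta <= 1 ->
  bracket (freq lam j) `^ (2 * (s - 1 / 2 + theta)) * normc (a j * mode e j x) ^+ 2 <=
  192 * enorm x.1 `^ (- (2 * theta)) * (bracket (freq lam j) `^ (2 * s) * normc (a j) ^+ 2).
Proof.
move=> dx x0 th0 th1; case: j => n k.
have [lam_gt0 _ _ _ _] := he.
set br := bracket (freq lam (n, k)).
have br1 : 1 <= br by exact: bracket_ge1.
have br0 : 0 < br := lt_le_trans ltr01 br1.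
have lbr : lam n + 1 <= 2 * br.
  have h1 : lam n <= freq lam (n, k) by exact: freq_ge_lam.
  have h2 : freq lam (n, k) <= br by apply: le_bracket; exact: sqrtr_ge0.
  lra.
have e2 : e n x.1 ^+ 2 <= 192 * br `^ (1 - 2 * theta) * enorm x.1 `^ (- (2 * theta)).
  have th : 0 <= 2 * theta <= 1 by rewrite th1 mulr_ge0.
  apply: (le_trans (radial_eigenfunction_bound he n dx x0 th)).
  rewrite ler_wpM2r ?powR_ge0// (_ : 192 = 96 * 2 :> R); last by rewrite -natrM.
  rewrite -mulrA ler_wpM2l//.
  have t0 : 0 <= 1 - 2 * theta by rewrite subr_ge0.
  apply: (@le_trans _ _ ((2 * br) `^ (1 - 2 * theta))).
    apply: ge0_ler_powR => //; rewrite ?nnegrE ?mulr_ge0 ?(ltW br0)//.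
    by rewrite addr_ge0// ltW.
  rewrite powRM ?(ltW br0)// ler_wpM2r ?powR_ge0//.
  rewrite -[leRHS]powRr1//; apply: ler_powR; first by rewrite ler1n.
  by rewrite gerBl mulr_ge0.
rewrite Normc.normcM exprMn normc_mode real_normK ?num_real//=.
apply: (@le_trans _ _ (br `^ (2 * (s - 1 / 2 + theta)) * (normc (a (n, k)) ^+ 2 *
    (192 * br `^ (1 - 2 * theta) * enorm x.1 `^ (- (2 * theta)))))).
  by rewrite ler_wpM2l ?powR_ge0// ler_wpM2l ?sqr_ge0.
have -> : br `^ (2 * s) = br `^ (2 * (s - 1 / 2 + theta)) * br `^ (1 - 2 * theta).
  by rewrite -powRD ?(gt_eqF br0) ?implybT//; congr (_ `^ _); field.
by rewrite le_eqVlt; apply/orP; left; apply/eqP; ring.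
Qed.

Lemma Hs_norm_sum_le (s : R) a (B : {fset nat * int}) : (Hs_norm lam s a < +oo)%E ->
  \sum_(j <- B) bracket (freq lam j) `^ (2 * s) * normc (a j) ^+ 2 <=
  fine (Hs_norm lam s a) ^+ 2.
Proof.
move=> Hfin; rewrite -lee_fin.
set F := fun j => (bracket (freq lam j) `^ (2 * s) * normc (a j) ^+ 2)%:E.
have F0 j : (0 <= F j)%E by rewrite lee_fin mulr_ge0 ?powR_ge0 ?sqr_ge0.
have E0 : (0 <= \esum_(j in [set: nat * int]) F j)%E by exact: esum_ge0.
have -> : ((fine (Hs_norm lam s a)) ^+ 2)%:E = \esum_(j in [set: nat * int]) F j.
  have H0 : (0 <= Hs_norm lam s a)%E by exact: poweR_ge0.
  rewrite -powR_mulrn ?fine_ge0// -poweR_EFin fineK ?ge0_fin_numE//.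
  by rewrite -poweRrM mulVf// poweRe1.
apply: esum_ge; exists [set` B].
  by split => //; exact: finite_fset.
by rewrite fsbig_finite//= ?set_fsetK ?sumEFin//; exact: finite_fset.
Qed.

Lemma measurable_mode_evolution a n :
  cmeasurable (setT `*` cylinder) (fun tx : R * (R * R * R) => partial_evolution a n tx.1 tx.2).
Proof.
have [_ _ eg _ _] := he.
have m1 : measurable (setT `*` cylinder : set (R * (R * R * R))).
  by apply: measurableX => //; exact: measurable_cylinder.
have mt : measurable_fun (setT `*` cylinder : set (R * (R * R * R))) (fun tx => tx.1).
  by apply: measurable_funTS; exact: measurable_fst.
have mx : measurable_fun (setT `*` cylinder : set (R * (R * R * R))) (fun tx => tx.2).
  by apply: measurable_funTS; exact: measurable_snd.
apply: (@cmeasurable_sum _ _ _ _ _ _ (fun j (tx : R * (R * R * R)) =>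
  a j * cis (- (freq lam j * tx.1)) * mode e j tx.2)) => j.
apply: cmeasurableM.
  apply: cmeasurableM; first exact: cmeasurable_cst.
  apply: cmeasurable_cis; apply: measurableT_comp => //.
  exact: measurable_funM.
apply: (@cmeasurable_comp _ _ _ _ _ _ cylinder (fun tx : R * (R * R * R) => tx.2) (mode e j)) => //.
- exact: measurable_cylinder.
- by move=> _ [tx [_ h] <-].
apply: cmeasurableM.
  apply: cmeasurable_real.
  apply: (@measurable_comp _ _ _ _ _ _ disk) => //.
  - exact: measurable_disk.
  - by move=> _ [x [h _] <-].
  - exact: measurable_radial_eigenfunction (eg j.1).
  - by apply: measurable_funTS; exact: measurable_fst.
apply: cmeasurable_cis; apply: measurable_funM => //.
by apply: measurable_funTS; exact: measurable_snd.
Qed.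

Lemma evolution_L2_cvg a u t (eps : R) : evolution lam e a u -> 0 < eps ->
  \forall n \near \oo,
    (\int[mu3]_(x in cylinder) (normc (u t x - partial_evolution a n t x) ^+ 2)%:E <= eps%:E)%E.
Proof.
move=> [_ /(_ t)[_ sum]] eps0.
have se0 : 0 < Num.sqrt eps by rewrite sqrtr_gt0.
have [A hA] := sum _ se0.
have [n0 hn0] := freq_fset_exhausts A.
exists n0 => // n /= /hn0/hA; rewrite /L2_norm -/(partial_evolution a n t _) => h.
rewrite Lnorm_restrictE// in h; last by move=> x _; rewrite lee_fin normc_ge0.
set X := (\int[_]_(_ in _) _)%E in h *.
have XE : X = (\int[mu3]_(x in cylinder) (normc (u t x - partial_evolution a n t x) ^+ 2)%:E)%E.
  by apply: eq_integral => x _; rewrite poweR_EFin powR_mulrn ?normc_ge0.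
rewrite -XE.
have X0 : (0 <= X)%E by apply: integral_ge0 => x _; exact: poweR_ge0.
rewrite -[X in (X <= _)%E](@poweRe1 _ X)// -(@mulVf _ 2)// poweRrM.
apply: (@le_trans _ _ ((Num.sqrt eps)%:E `^ 2)%E).
  by apply: le_poweR => //; [exact: poweR_ge0|exact: ltW].
by rewrite poweR_EFin powR_mulrn ?sqrtr_ge0// sqr_sqrtr// ltW.
Qed.

Variables (p q s theta c : R).
Hypotheses (hp : 2 <= p) (hq : 2 <= q) (th0 : 0 <= theta) (th1 : 2 * theta <= 1)
  (thp : theta * p < 2) (ths : 1 - q^-1 < s - 1 / 2 + theta).
Hypotheses (c0 : 0 < c) (c1 : c <= 1)
  (gap : forall m n, (m <= n)%N -> c * (n%:R - m%:R) <= lam n - lam m).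

(** The factor 14 absorbs the square root of 192, as 14^2 = 196. *)
Let K : R := 14 * `|sobolev_const c q (s - 1 / 2 + theta)|.

Lemma partial_evolution_Lq a n x t0 (D : set R) : (Hs_norm lam s a < +oo)%E ->
  disk x.1 -> 0 < enorm x.1 -> measurable D -> D `<=` `[t0 - 1, t0 + 1] ->
  ('N[mu1]_q%:E[(fun t => (normc (partial_evolution a n t x))%:E) \_ D] <=
   (K * enorm x.1 `^ (- theta) * fine (Hs_norm lam s a))%:E)%E.
Proof.
move=> Hfin dx x0 mD Dt; have [lam_gt0 _ _ _ _] := he.
set H := fine _; have H0 : 0 <= H by rewrite fine_ge0// poweR_ge0.
have -> : (fun t => (normc (partial_evolution a n t x))%:E) =
    (fun t => (normc (freq_sum lam (freq_fset n) (fun j => a j * mode e j x) t))%:E).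
  by apply/funext => t; rewrite partial_evolutionE.
set T := 14 * enorm x.1 `^ (- theta) * H.
have T0 : 0 <= T by rewrite !mulr_ge0 ?powR_ge0.
have sumT : \sum_(j <- freq_fset n) bracket (freq lam j) `^ (2 * (s - 1 / 2 + theta)) *
    normc (a j * mode e j x) ^+ 2 <= T ^+ 2.
  apply: (@le_trans _ _ (192 * enorm x.1 `^ (- (2 * theta)) *
      \sum_(j <- freq_fset n) bracket (freq lam j) `^ (2 * s) * normc (a j) ^+ 2)).
    by rewrite mulr_sumr; apply: ler_sum => j _; exact: mode_coef_bound.
  have -> : T ^+ 2 = 196 * enorm x.1 `^ (- (2 * theta)) * H ^+ 2.
    rewrite /T !exprMn -[(_ `^ _) ^+ 2]powR_mulrn ?powR_ge0// -powRrM.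
    rewrite -natrX; congr (_ * _ `^ _ * _); ring.
  apply: ler_pM.
  - by rewrite mulr_ge0 ?powR_ge0.
  - by rewrite sumr_ge0// => j _; rewrite mulr_ge0 ?powR_ge0 ?sqr_ge0.
  - by rewrite ler_wpM2r ?powR_ge0// ler_nat.
  - exact: Hs_norm_sum_le.
apply: le_trans (freq_sum_Lq c0 c1 lam_gt0 gap hq ths (fset_uniq _) T0 sumT mD Dt) _.
have -> : K * enorm x.1 `^ (- theta) * H = `|sobolev_const c q (s - 1 / 2 + theta)| * T.
  by rewrite /T /K; ring.
by rewrite lee_fin ler_wpM2r// ler_norm.
Qed.

(** Convergence is given in L^2(x) for every t but is needed for almost every t at fixed x.
    [ae_section_subsequence] exchanges the two variables, with one subsequence for all x. *)
Lemma evolution_section_bound a u (I : interval R) :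
  (Hs_norm lam s a < +oo)%E -> evolution lam e a u -> (mu1 [set` I] <= 1)%E ->
  \forall x \ae mu3, cylinder x ->
    (\int[mu1]_(t in [set` I]) ((normc (u t x))%:E `^ q) <=
     (K * enorm x.1 `^ (- theta) * fine (Hs_norm lam s a))%:E `^ q)%E.
Proof.
move=> Hfin evo I1; have [t0 It0] := itv_length_le1 I1.
have q0 : 0 < q by exact: lt_le_trans hq.
have mI : measurable ([set` I] : set R) by exact: measurable_itv.
have [mu_ _] := evo.
have msub n : cmeasurable (setT `*` cylinder)
    (fun tx : R * (R * R * R) => u tx.1 tx.2 - partial_evolution a n tx.1 tx.2).
  by apply: cmeasurableB => //; exact: measurable_mode_evolution.
(* The L^2 convergence at each t comes with no uniformity in t. Truncation at 1 supplies the
   domination needed to integrate in t. *)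
pose g n (tx : R * (R * R * R)) := Num.min 1 (normc (u tx.1 tx.2 - partial_evolution a n tx.1 tx.2) ^+ 2).
have mg n : measurable_fun ([set` I] `*` cylinder) (g n).
  apply: (@measurable_funS _ _ _ _ (setT `*` cylinder)).
  - by apply: measurableX => //; exact: measurable_cylinder.
  - by move=> [t x] [_ h]; split.
  - apply: measurable_minr; first exact: measurable_cst.
    by apply: measurable_funX; exact: measurable_normc.
have g01 n tx : 0 <= g n tx <= 1.
  by rewrite le_min ler01 sqr_ge0 ge_min lexx.
have I_fin : (mu1 [set` I] < +oo)%E by apply: le_lt_trans I1 _; exact: ltry.
have g_cvg t : [set` I] t -> (fun n => \int[mu3]_(x in cylinder) (g n (t, x))%:E)%E @ \oo --> 0%E.
  move=> It; apply: cvge0_small => [n|eps eps0].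
    by apply: integral_ge0 => x _; rewrite lee_fin; have /andP[] := g01 n (t, x).
  have mgt n : measurable_fun cylinder (fun x => (g n (t, x))%:E).
    apply/measurable_EFinP.
    apply: (@measurable_comp _ _ _ _ _ _ ([set` I] `*` cylinder) (g n) _ (fun x => (t, x))) => //.
    - by apply: measurableX => //; exact: measurable_cylinder.
    - by move=> _ [x cx <-].
    - by apply: measurable_funTS; exact: pair1_measurable.
  have mst n : measurable_fun cylinder (fun x => (normc (u t x - partial_evolution a n t x) ^+ 2)%:E).
    apply/measurable_EFinP; apply: measurable_funX; apply: measurable_normc.
    apply: (@cmeasurable_comp _ _ _ _ _ _ (setT `*` cylinder) (fun x => (t, x)) _ _ _ _ (msub n)).
    - by apply: measurableX => //; exact: measurable_cylinder.
    - by move=> _ [x cx <-].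
    - by apply: measurable_funTS; exact: pair1_measurable.
  have := evolution_L2_cvg t evo eps0; apply: filterS => n; apply: le_trans.
  apply: ge0_le_integral => //.
  - exact: measurable_cylinder.
  - by move=> x _; rewrite lee_fin; have /andP[] := g01 n (t, x).
  - exact: mgt.
  - exact: mst.
  - by move=> x _; rewrite lee_fin ge_min lexx orbT.
have [N HN] := @ae_section_subsequence _ _ _ _ R mu1 space_measure [set` I] cylinder g mI measurable_cylinder I_fin
  cylinder_finite mg g01 g_cvg.
have axis : \forall x \ae mu3, enorm x.1 <> 0.
  by apply: negligibleS cylinder_axis_negligible => x /= h; exact: contrapT.
have {}HN : \forall x \ae mu3, cylinder x ->
  \forall t \ae mu1, [set` I] t -> (fun k => (g (N k) (t, x))%:E) @ \oo --> 0%E by exact: HN.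
apply: (@filterS2 _ _ (ae_filter_ringOfSetsType space_measure) _ _ _ _ axis HN) => x x0 hx cx.
have dx : disk x.1 by case: cx.
have {}x0 : 0 < enorm x.1 by rewrite lt_neqAle enorm_ge0 andbT eq_sym; apply/eqP.
have section_measurable (f : R -> R * R * R -> R[i]) :
    cmeasurable (setT `*` cylinder) (fun tx : R * (R * R * R) => f tx.1 tx.2) ->
    measurable_fun [set` I] (fun t => (normc (f t x))%:E `^ q)%E.
  move=> mf; apply: (measurableT_comp (measurable_poweR q)).
  apply/measurable_EFinP; apply: measurable_normc.
  apply: (@cmeasurable_comp _ _ _ _ _ _ (setT `*` cylinder) (fun t => (t, x)) _ _ _ _ mf).
  - by apply: measurableX => //; exact: measurable_cylinder.
  - by move=> _ [t _ <-].
  - by apply: measurable_funTS; exact: pair2_measurable.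
pose f k t := ((normc (partial_evolution a (N k) t x))%:E `^ q)%E.
have mf k : measurable_fun [set` I] (f k).
  exact: section_measurable (measurable_mode_evolution a (N k)).
have f0 k t : (0 <= f k t)%E by exact: poweR_ge0.
apply: (@le_trans _ _ (\int[mu1]_(t in [set` I]) limn_einf (f^~ t))%E).
  apply: ae_ge0_le_integral => //.
  - by move=> t _; exact: poweR_ge0.
  - exact: section_measurable.
  - by move=> t _; exact: limn_einf_ge0.
  - exact: measurable_limn_einf.
  - apply: (@filterS _ _ (ae_filter_ringOfSetsType mu1) _ _ _ (hx cx)) => t ht It.
    rewrite poweR_EFin.
    apply: powR_le_limn_einf => //; first exact: normc_ge0.
    exact: cvg_normc (ht It).
apply: (le_trans (fatou mu1 mI mf (fun k t _ => f0 k t))).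
apply: limn_einf_le => k.
have X0 : (0 <= \int[mu1]_(t in [set` I]) f k t)%E by apply: integral_ge0.
rewrite -[leLHS](@poweRe1 _ _ X0) -(@mulVf _ q) ?gt_eqF// poweRrM.
apply: le_poweR; [exact: ltW|exact: poweR_ge0|].
have := partial_evolution_Lq (N k) Hfin dx x0 mI It0.
by rewrite Lnorm_restrictE ?gt_eqF// => t _; rewrite lee_fin normc_ge0.
Qed.

End Evolution.

(** * The mixed norm *)

Section MixedNorm.
Context {R : realType}.
Local Notation mu1 := (@lebesgue_measure R).
Local Notation mu2 := (mu1 \x mu1)%E.
Local Notation mu3 := (mu2 \x mu1)%E.
Local Notation normc := Normc.normc.

Lemma measurable_section_integral (q : R) (u : R -> R * R * R -> R[i]) (I : set R) :
  measurable I ->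
  cmeasurable (setT `*` cylinder) (fun tx : R * (R * R * R) => u tx.1 tx.2) ->
  measurable_fun cylinder (fun x => \int[mu1]_(t in I) ((normc (u t x))%:E `^ q))%E.
Proof.
move=> mI mu_.
have mIc : measurable (I `*` cylinder : set (R * (R * R * R))).
  by apply: measurableX => //; exact: measurable_cylinder.
pose F := (fun tx : R * (R * R * R) => (normc (u tx.1 tx.2))%:E `^ q)%E \_ (I `*` cylinder).
have mF : measurable_fun setT F.
  apply/(measurable_restrictT _ mIc); apply: (measurableT_comp (measurable_poweR q)).
  apply/measurable_EFinP.
  apply: (@measurable_funS _ _ _ _ (setT `*` cylinder)).
  - by apply: measurableX => //; exact: measurable_cylinder.
  - by move=> [t x] [_ h]; split.
  - exact: measurable_normc.
have F0 z : (0 <= F z)%E by rewrite /F patchE; case: ifPn => // _; exact: poweR_ge0.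
have := @measurable_fun_fubini_tonelli_G _ _ _ _ R mu1 F mF F0.
move=> /(@measurable_funTS _ _ _ _ cylinder); apply: eq_measurable_fun => x /set_mem cx.
rewrite [RHS]integral_mkcond; apply: eq_integral => t _; rewrite /F !patchE.
by congr (if _ then _ else _); apply/idP/idP => /set_mem h; apply/mem_set; [case: h|split].
Qed.

Variables (lam : nat -> R) (e : nat -> R * R -> R).
Hypothesis he : radial_dirichlet_sequence lam e.
Variables (p q s theta c : R).
Hypotheses (hp : 2 <= p) (hq : 2 <= q) (th0 : 0 <= theta) (th1 : 2 * theta <= 1)
  (thp : theta * p < 2) (ths : 1 - q^-1 < s - 1 / 2 + theta).
Hypotheses (c0 : 0 < c) (c1 : c <= 1)
  (gap : forall m n, (m <= n)%N -> c * (n%:R - m%:R) <= lam n - lam m).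

Let K : R := 14 * `|sobolev_const c q (s - 1 / 2 + theta)|.
Let W : \bar R := (\int[mu3]_(x in cylinder) radial_weight (theta * p) x.1)%E.

(** For almost every x the p-th power of the time norm is at most (K H)^p |x'|^(- theta p).
    [radial_weight] majorizes the last factor, and theta p < 2 makes W finite, so [fine W] is its
    true value. *)
Lemma evolution_mixed_norm_le a u (I : interval R) :
  (Hs_norm lam s a < +oo)%E -> evolution lam e a u -> (mu1 [set` I] <= 1)%E ->
  (LpxLqt_norm p q [set` I] u <=
   (K * fine (Hs_norm lam s a) * fine W `^ p^-1)%:E)%E.
Proof.
move=> Hfin evo I1; have [mu_ _] := evo.
have p0 : 0 < p by exact: lt_le_trans hp.
have q0 : 0 < q by exact: lt_le_trans hq.
have mI : measurable ([set` I] : set R) by exact: measurable_itv.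
set H := fine (Hs_norm _ _ _); have H0 : 0 <= H by rewrite fine_ge0// poweR_ge0.
have K0 : 0 <= K by rewrite mulr_ge0.
have KH0 : 0 <= K * H by rewrite mulr_ge0.
have W0 : (0 <= W)%E by apply: integral_ge0 => x _; exact: radial_weight_ge0.
have Wfin : W = (fine W)%:E.
  by rewrite fineK// ge0_fin_numE//; exact: radial_weight_integrable.
have fW0 : 0 <= fine W by exact: fine_ge0.
pose G (x : R * R * R) := (\int[mu1]_(t in [set` I]) ((normc (u t x))%:E `^ q))%E.
have G0 x : (0 <= G x)%E by apply: integral_ge0 => t _; exact: poweR_ge0.
have mG : measurable_fun cylinder G by exact: measurable_section_integral.
have normE x : ('N[mu1]_q%:E[(fun t => (normc (u t x))%:E) \_ [set` I]] = G x `^ q^-1)%E.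
  by rewrite Lnorm_restrictE ?gt_eqF// => t _; rewrite lee_fin normc_ge0.
rewrite /LpxLqt_norm.
have -> : (fun x => 'N[mu1]_q%:E[(fun t => (normc (u t x))%:E) \_ [set` I]])%E = (fun x => G x `^ q^-1)%E.
  by apply/funext.
apply: (Lnorm_le_root p0).
- by move=> x _; exact: poweR_ge0.
- by rewrite lee_fin mulr_ge0 ?powR_ge0.
have mw : measurable_fun cylinder (fun x : R * R * R => radial_weight (theta * p) x.1).
  apply: measurable_funTS; apply: (measurableT_comp (measurable_radial_weight (theta * p))).
  exact: measurable_fst.
have tp0 : 0 <= theta * p by rewrite mulr_ge0 ?(ltW p0).
apply: (@le_trans _ _ (\int[mu3]_(x in cylinder) (((K * H) `^ p)%:E * radial_weight (theta * p) x.1))%E).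
  apply: ae_ge0_le_integral.
  - exact: measurable_cylinder.
  - by move=> x _; exact: poweR_ge0.
  - apply: (measurableT_comp (measurable_poweR p)).
    exact: (measurableT_comp (measurable_poweR q^-1)).
  - by move=> x _; rewrite mule_ge0 ?lee_fin ?powR_ge0 ?radial_weight_ge0.
  - exact: measurable_funeM.
  have axis : \forall x \ae mu3, enorm x.1 <> 0.
    by apply: negligibleS cylinder_axis_negligible => x /= h; exact: contrapT.
  have bound := evolution_section_bound he hq th0 th1 ths c0 c1 gap Hfin evo I1.
  apply: (@filterS2 _ _ (ae_filter_ringOfSetsType space_measure) _ _ _ _ axis bound) => x x0 hx cx.
  have dx : disk x.1 by case: cx.
  have {}x0 : 0 < enorm x.1 by rewrite lt_neqAle enorm_ge0 andbT eq_sym; apply/eqP.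
  have wx := radial_weight_ge tp0 dx x0.
  apply: (@le_trans _ _ ((K * enorm x.1 `^ (- theta) * H)%:E `^ p)%E).
    apply: le_poweR; [exact: ltW|exact: poweR_ge0|].
    apply: (@le_trans _ _ (((K * enorm x.1 `^ (- theta) * H)%:E `^ q) `^ q^-1)%E).
      by apply: le_poweR; [rewrite invr_ge0 ltW|exact: G0|exact: hx].
    by rewrite -poweRrM divff ?gt_eqF// poweRe1// lee_fin !mulr_ge0 ?powR_ge0.
  have -> : K * enorm x.1 `^ (- theta) * H = K * H * enorm x.1 `^ (- theta) by ring.
  rewrite poweR_EFin (powRM _ KH0 (powR_ge0 _ _)) -powRrM EFinM mulNr.
  by apply: lee_wpmul2l => //; rewrite lee_fin powR_ge0.
rewrite ge0_integralZl//; last 3 first.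
- exact: measurable_cylinder.
- by move=> x _; exact: radial_weight_ge0.
- by rewrite lee_fin powR_ge0.
rewrite -/W Wfin poweR_EFin [in leRHS]powRM ?powR_ge0// -powRrM mulVf ?gt_eqF//.
by rewrite powRr1.
Qed.

End MixedNorm.

Theorem proposition2p1 (R : realType) (lam : nat -> R) (e : nat -> R * R -> R)
    (he : radial_dirichlet_sequence lam e)
    (p q s : R) (hp : 2 <= p) (hq : 2 <= q) (s_gt0 : 0 < s)
    (hs : Num.max (1 - 1 / q) (3 / 2 - 1 / q - 2 / p) < s) :
  exists C : R, 0 < C /\
    forall (f : R * R * R -> R[i]) (a : nat * int -> R[i]),
      Hs_with_coefs lam e s f a ->
      forall u : R -> R * R * R -> R[i], evolution lam e a u ->
      forall I : interval R, (lebesgue_measure [set` I] <= 1)%E ->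
        (LpxLqt_norm p q [set` I] u <= C%:E * Hs_norm lam s a)%E.
Proof.
have p0 : 0 < p by exact: lt_le_trans hp.
have [c /andP[c0 c1] gap] := radial_eigenvalue_gap he.
move: hs; rewrite gt_max => /andP[hs1 hs2].
(* The two lower bounds on s say exactly that 3/2 - 1/q - s is below 1/2 and below 2/p. As 0 is
   below both as well, the midpoint between the maximum and the minimum serves as theta. *)
have [theta [th0 th1 thp ths]] : exists theta : R,
    [/\ 0 <= theta, 2 * theta <= 1, theta < 2 / p & 3 / 2 - 1 / q - s < theta].
  have hm : Num.max 0 (3 / 2 - 1 / q - s) < Num.min (1 / 2) (2 / p).
    by rewrite gt_max !lt_min !divr_gt0//=; apply/andP; split; lra.
  have [] := midf_lt hm; rewrite gt_max lt_min; set th := (_ + _) / 2.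
  by move=> /andP[? ?] /andP[? ?]; exists th; split => //; lra.
have thp' : theta * p < 2 by rewrite -ltr_pdivlMr.
have ths' : 1 - q^-1 < s - 1 / 2 + theta.
  by move: ths; rewrite div1r; lra.
set K := 14 * `|sobolev_const c q (s - 1 / 2 + theta)|.
set W := (\int[((@lebesgue_measure R \x @lebesgue_measure R) \x @lebesgue_measure R)]_(x in cylinder)
  radial_weight (theta * p) x.1)%E.
have B0 : 0 <= K * fine W `^ p^-1 by rewrite !mulr_ge0 ?powR_ge0.
(* The product is only known to be nonnegative; adding 1 makes the constant positive. *)
exists (K * fine W `^ p^-1 + 1); split; first exact: ltr_wpDl.
move=> f a [_ Hfin] u evo I I1.
have H0 : (0 <= Hs_norm lam s a)%E by exact: poweR_ge0.
apply: (le_trans (evolution_mixed_norm_le he hp hq th0 th1 thp' ths' c0 c1 gap Hfin evo I1)).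
rewrite -/K -/W -[in leRHS](@fineK _ (Hs_norm lam s a)) ?ge0_fin_numE//.
by rewrite -EFinM lee_fin mulrAC ler_wpM2r ?fine_ge0// lerDl.
Qed.
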